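(* Let $Z=\prod_i\zeta_i^{\check\alpha_i}\in H$ with $\zeta_i\in\mathbb{C}^\times$ and $\prod_{i=1}^r\zeta_i^{a_{ij}}\notin q^{\mathbb{Z}}$ for all $j=1,\dots,r$, and let $\Lambda_1(z),\dots,\Lambda_r(z)$ be monic polynomials. There is a one-to-one correspondence between the set of nondegenerate $Z$-twisted Miura-Pl\''ucker $(G,q)$-opers (with regular singularities determined by $\{\Lambda_i(z)\}$) and the set of nondegenerate polynomial solutions $\{Q^i_+(z),Q^i_-(z)\}_{i=1,\dots,r}$ of the $QQ$-system $$\widetilde\xi_i\,Q^i_-(z)Q^i_+(qz)-\xi_i\,Q^i_-(qz)Q^i_+(z)=\Lambda_i(z)\prod_{j>i}\big[Q^j_+(qz)\big]^{-a_{ji}}\prod_{j<i}\big[Q^j_+(z)\big]^{-a_{ji}},\qquad i=1,\dots,r,$$ where $\widetilde\xi_i=\zeta_i\prod_{j>i}\zeta_j^{a_{ji}}$ and $\xi_i=\zeta_i^{-1}\prod_{j<i}\zeta_j^{-a_{ji}}$.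
   Context: Conventions. $q\in\mathbb{C}^\times$ is not a root of unity. $G$ is a connected, simply connected, simple complex algebraic group of rank $r$, with opposite Borel subgroups $B_\pm$, $N_\pm=[B_\pm,B_\pm]$, maximal torus $H=B_+\cap B_-$, simple roots $\alpha_i$ (positive for $B_+$), coroots $\check\alpha_i$, Cartan matrix $a_{ij}=\langle\alpha_j,\check\alpha_i\rangle$, fundamental weights $\omega_i$, Chevalley generators $e_i,f_i,\check\alpha_i$. For an algebraic group $K$, $K(z):=K(\mathbb{C}(z))$; for $t\in\mathbb{C}(z)^\times$, $t^{\check\alpha_i}\in H(z)$ is the value of the cocharacter $\check\alpha_i$. A total ordering of the simple roots is fixed; all products over $i$ are taken in this order, and $j<i$ (resp. $j>i$) means that $\alpha_j$ precedes (resp. follows) $\alpha_i$. Numbers $v,w\in\mathbb{C}$ are $q$-distinct if $q^{\mathbb Z}v\cap q^{\mathbb Z}w=\varnothing$. Opers. A Miura $(G,q)$-oper with regular singularities determined by $\{\Lambda_i\}$ is a principal $G$-bundle on $\mathbb{P}^1$ with a meromorphic $q$-connection (locally an element $A(z)\in G(z)$, with changes of trivialization acting by $A(z)\mapsto g(qz)A(z)g(z)^{-1}$), a reduction to $B_-$ with respect to which $A(z)\in N_-(z)\prod_i(\Lambda_i(z)^{\check\alpha_i}s_i)N_-(z)$ in some trivialization, and a reduction to $B_+$ preserved by the $q$-connection. Here $s_i$ is the lifting of the $i$th simple reflection given by the image of $\begin{pmatrix}0&1\\-1&0\end{pmatrix}$ under the homomorphism $\mathrm{SL}(2)\to G$ attached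 to $\alpha_i$. It is represented by its $q$-connection in the normal form $$A(z)=\prod_i g_i(z)^{\check\alpha_i}e^{\frac{\Lambda_i(z)}{g_i(z)}e_i},\qquad g_i(z)\in\mathbb{C}(z)^\times .$$ Miura-Pl\''ucker condition. Let $V_i$ be the irreducible representation of $G$ with highest weight $\omega_i$ and highest weight vector $\nu_{\omega_i}$, and let $W_i=\mathrm{span}(\nu_{\omega_i},f_i\nu_{\omega_i})\subset V_i$, a $B_+$-invariant subspace. Put $A_i(z)=A(z)|_{W_i}$. The oper is $Z$-twisted Miura-Pl\''ucker if there is $v(z)\in B_+(z)$ such that $A_i(z)=v(qz)Zv(z)^{-1}|_{W_i}$ for all $i$. Then $g_i(z)=\zeta_i\,y_i(qz)/y_i(z)$ for some $y_i\in\mathbb{C}(z)^\times$, unique up to nonzero scalars. Nondegenerate opers. If $r>1$, the oper is nondegenerate if (a) ($H$-nondegeneracy) for all $i,j,k$ with $i\ne j$, $a_{ik}\neq0$, $a_{jk}\ne0$, the zeros and poles of $y_i(z)$ and $y_j(z)$ are $q$-distinct from each other and from the zeros of $\Lambda_k(z)$; and (b) for each $i$, $y_i(z)$ is a polynomial whose zeros are $q$-distinct from the zeros of $\rho_i(z)=\Lambda_i(z)\prod_{j>i}(\zeta_jy_j(qz))^{-a_{ji}}\prod_{j<i}y_j(z)^{-a_{ji}}$ (this says that the $\mathrm{SL}(2)$ Miura $q$-oper $\begin{pmatrix}\zeta_iy_i(qz)/y_i(z)&\rho_i(z)\\0&\zeta_i^{-1}y_i(z)/y_i(qz)\end{pmatrix}$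 is nondegenerate). If $r=1$, it is nondegenerate if $y(z)$ is a polynomial whose zeros are $q$-distinct from the zeros of $\Lambda(z)$. Nondegenerate solutions. A polynomial solution $\{Q^i_+,Q^i_-\}$ of the $QQ$-system is nondegenerate if all $Q^i_+$ are monic, $\prod_i\zeta_i^{a_{ij}}\notin q^{\mathbb Z}$ for all $j$, and for all $i,j,k$ with $i\neq j$, $a_{ik}\ne0$, $a_{jk}\neq0$, the zeros of $Q^i_+(z)$ and $Q^j_+(z)$ are $q$-distinct from each other and from the zeros of $\Lambda_k(z)$ (for $r=1$: the zeros of $Q_+$ are $q$-distinct from those of $\Lambda$). The correspondence meant is the one under which $\{Q^i_\pm\}$ corresponds to $A(z)=\prod_j\Big[\zeta_j\frac{Q^j_+(qz)}{Q^j_+(z)}\Big]^{\check\alpha_j}\exp\Big(\frac{\Lambda_j(z)Q^j_+(z)}{\zeta_jQ^j_+(qz)}e_j\Big)$.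
   Formalization: Surjectivity is claimed only for opers where no y_i vanishes at 0 and distinct zeros of each y_i are q-distinct; without this it fails (e.g. SL(2), y=(z-x)(z-q^2x), where Q_- has a pole at qx). The map is well defined and injective on all nondegenerate solutions. *)

(* Defs.v *)
(* The complex numbers are C = R[i], for R : realType. *)
From HB Require Import structures.
From mathcomp Require Import all_boot all_order all_algebra generic_quotient.
From mathcomp Require Import classical_sets reals.
From mathcomp Require Import complex mpoly.

Set Implicit Arguments.
Unset Strict Implicit.
Unset Printing Implicit Defensive.

Import Order.TTheory GRing.Theory Num.Theory.

Local Open Scope ring_scope.
Local Open Scope quotient_scope.
Local Open Scope classical_set_scope.
Local Open Scope complex_scope.

Section Evaluation.
Variables (C S : comNzRingType) (iota : C -> S).

Definition mxeval n (g : 'M[S]_n) (p : {mpoly C[n * n]}) : S :=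
  mmap iota (fun k => mxvec g 0 k) p.

(* A polynomial map 'M_n -> 'M_m is an m x m matrix of polynomials in n * n
   variables; this is its value at an S-point. *)
Definition mxapp n m (f : 'M[{mpoly C[n * n]}]_m) (g : 'M[S]_n) : 'M[S]_m :=
  map_mx (mxeval g) f.

End Evaluation.

Definition mat2 (S : nzRingType) (a b c d : S) : 'M[S]_2 :=
  \matrix_(i, j) if i == 0 then (if j == 0 then a else b)
                 else (if j == 0 then c else d).

(* The exponential of a nilpotent matrix of size n. *)
Definition expmx (S : unitRingType) n (M : 'M[S]_n) : 'M[S]_n :=
  \sum_(k < n.+1) (k`!%:R)^-1 *: M ^+ k.

Definition mxbracket (S : nzRingType) n (M N : 'M[S]_n) : 'M[S]_n :=
  M *m N - N *m M.

Section Setup.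
Variable R : realType.
Local Notation C := R[i].

Definition ratfun : fieldType := {fraction {poly C}}.
Local Notation K := ratfun.

Definition ofpoly (p : {poly C}) : K := @FracField.tofrac {poly C} p.
Definition ofconst (c : C) : K := ofpoly c%:P.

Definition scalep (q : C) (p : {poly C}) : {poly C} := p \Po (q *: 'X).

(* f(z) |-> f(qz); see qshiftE for the independence of the representative *)
Definition qshift (q : C) (f : K) : K :=
  ofpoly (scalep q \n_(repr f)) / ofpoly (scalep q \d_(repr f)).

Lemma ratfunE (f : K) : f = ofpoly \n_(repr f) / ofpoly \d_(repr f).
Proof.
have d0 : \d_(repr f) != 0 by exact: denom_ratioP.
apply: (canRL (mulfK _)); first by rewrite tofrac_eq0.
have P (x : {ratio {poly C}}) :
    FracField.mul (\pi_(FracField.type {poly C}) x) (ofpoly \d_x)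
      = ofpoly \n_x.
  rewrite /ofpoly !piE; apply/eqmodP => /=.
  rewrite FracField.equivfE /FracField.mulf.
  have dx0 : \d_x != 0 by exact: denom_ratioP.
  by rewrite !numden_Ratio ?mulr1 ?oner_neq0 // mulrC.
by move: (P (repr f)); rewrite reprK.
Qed.

Lemma scalep_eq0 (q : C) (p : {poly C}) :
  q != 0 -> (scalep q p == 0) = (p == 0).
Proof.
by move=> q0; rewrite comp_poly2_eq0 // size_scale // size_polyX.
Qed.

Lemma qshiftE (q : C) (p s : {poly C}) : q != 0 -> s != 0 ->
  qshift q (ofpoly p / ofpoly s) = ofpoly (scalep q p) / ofpoly (scalep q s).
Proof.
move=> q0 s0; rewrite /qshift; set f := ofpoly p / ofpoly s.
have d0 : \d_(repr f) != 0 by exact: denom_ratioP.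
have e : p * \d_(repr f) = \n_(repr f) * s.
  apply/eqP; rewrite -tofrac_eq !tofracM; have /eqP := ratfunE f.
  by rewrite {1}/f eqr_div ?tofrac_eq0.
apply/eqP; rewrite eqr_div ?tofrac_eq0 ?scalep_eq0 //.
by rewrite -!tofracM tofrac_eq /scalep -!comp_polyM e.
Qed.

(* Zeros of f, and poles of f as zeros of f^-1; meant for f != 0. *)
Definition is_zero (f : K) (x : C) : Prop :=
  exists p s : {poly C}, [/\ s.[x] != 0, p.[x] = 0 & f = ofpoly p / ofpoly s].
Definition is_pole (f : K) (x : C) : Prop := is_zero f^-1 x.

Definition q_distinct (q v w : C) : Prop :=
  forall k l : int, q ^ k * v != q ^ l * w.

Definition in_qZ (q c : C) : Prop := exists k : int, c = q ^ k.

(* Affine algebraic groups over C, as Zariski closed subgroups of SL_n   *)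
(* (every affine algebraic group is isomorphic to one). Such a subgroup  *)
(* is closed in 'M_n, so its regular functions are the polynomials in    *)
(* the matrix entries.                                                   *)

Definition vanishes_on n (X : set 'M[C]_n) (p : {mpoly C[n * n]}) : Prop :=
  forall x, X x -> mxeval id x p = 0.

Definition zclosed n (X : set 'M[C]_n) : Prop :=
  forall x, (forall p, vanishes_on X p -> mxeval id x p = 0) -> X x.

Definition zconnected n (X : set 'M[C]_n) : Prop :=
  forall Y1 Y2 : set 'M[C]_n, zclosed Y1 -> zclosed Y2 ->
    X `<=` Y1 `|` Y2 -> X `&` Y1 `&` Y2 = set0 -> X `<=` Y1 \/ X `<=` Y2.

Definition mxsubgroup n (X : set 'M[C]_n) : Prop :=
  [/\ X 1%:M, forall x y, X x -> X y -> X (x *m y)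
    & forall x, X x -> X (invmx x)].

Definition alg_group n (X : set 'M[C]_n) : Prop :=
  [/\ zclosed X, mxsubgroup X & forall x, X x -> \det x = 1].

Definition alg_morphism n m (X : set 'M[C]_n) (Y : set 'M[C]_m)
    (f : 'M[{mpoly C[n * n]}]_m) : Prop :=
  (forall x, X x -> Y (mxapp id f x)) /\
  (forall x y, X x -> X y ->
     mxapp id f (x *m y) = mxapp id f x *m mxapp id f y).

Definition alg_isomorphic n m (X : set 'M[C]_n) (Y : set 'M[C]_m) : Prop :=
  exists f g, [/\ alg_morphism X Y f, alg_morphism Y X g,
    forall x, X x -> mxapp id g (mxapp id f x) = x
    & forall y, Y y -> mxapp id f (mxapp id g y) = y].

(* K-points, for K = C(z): the ideal of X is generated over K by its elements
   with coefficients in C. *)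
Definition points n (X : set 'M[C]_n) : set 'M[K]_n :=
  [set g | forall p, vanishes_on X p -> mxeval ofconst g p = 0].

(* Directional derivatives at 1, computed with 1 + 'X M as a point over C['X]. *)
Definition tangent_point n (M : 'M[C]_n) : 'M[{poly C}]_n :=
  1%:M + 'X *: map_mx polyC M.

Definition lie n (X : set 'M[C]_n) : set 'M[C]_n :=
  [set M | forall p, vanishes_on X p ->
             (mxeval polyC (tangent_point M) p)`_1 = 0].

Definition mxdiff n m (f : 'M[{mpoly C[n * n]}]_m) (M : 'M[C]_n) : 'M[C]_m :=
  \matrix_(i, j) (mxapp polyC f (tangent_point M) i j)`_1.

Definition derived n (X : set 'M[C]_n) : set 'M[C]_n :=
  [set g | forall S : set 'M[C]_n, mxsubgroup S ->
     (forall x y, X x -> X y -> S (x *m y *m invmx x *m invmx y)) -> S g].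

Definition solvable_group n (X : set 'M[C]_n) : Prop :=
  exists k : nat, iter k (@derived n) X `<=` [set 1%:M].

Definition borel n (G B : set 'M[C]_n) : Prop :=
  let P B := [/\ alg_group B, zconnected B, solvable_group B & B `<=` G] in
  P B /\ (forall B', P B' -> B `<=` B' -> B' = B).

(* (C^* )^m, as the group of diagonal matrices diag(t, t^-1) *)
Definition std_torus m : set 'M[C]_(m + m) :=
  [set g | exists t : 'rV[C]_m, (forall k, t 0 k != 0) /\
     g = diag_mx (row_mx t (\row_k (t 0 k)^-1))].

Definition torus m n (T : set 'M[C]_n) : Prop :=
  alg_group T /\ alg_isomorphic (@std_torus m) T.

Definition maximal_torus m n (G T : set 'M[C]_n) : Prop :=
  [/\ torus m T, T `<=` G &
    forall m' T', torus m' T' -> T `<=` T' -> T' `<=` G -> T' = T].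

Definition simple_alg_group n (G : set 'M[C]_n) : Prop :=
  [/\ alg_group G, zconnected G,
      exists x y, [/\ G x, G y & x *m y <> y *m x]
    & forall N, alg_group N -> zconnected N -> N `<=` G ->
        (forall g x, G g -> N x -> N (g *m x *m invmx g)) ->
        N = [set 1%:M] \/ N = G].

Definition SL2 : set 'M[C]_2 := [set g | \det g = 1].

Definition weight_vector n (H : set 'M[C]_n) (chi : 'M[C]_n -> C)
    (M : 'M[C]_n) : Prop :=
  M != 0 /\ forall h, H h -> h *m M *m invmx h = chi h *: M.

Definition is_root n (H L : set 'M[C]_n) (chi : 'M[C]_n -> C) : Prop :=
  (exists2 M, L M & weight_vector H chi M) /\ (exists2 h, H h & chi h != 1).

(* The simple roots are indexed by 'I_r in the chosen total order.
   sg_sl2 i is the homomorphism SL(2) -> G attached to the i-th simple root.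
   The fields sg_Bp_dec, sg_Bm_dec (B = H [B, B] for a Borel subgroup B) and
   sg_indecomposable (the root system of a simple group is irreducible) record
   standard facts, which hold for every G, B_+, B_-, H as in the other fields. *)
Record simple_group (n r : nat) := SimpleGroup {
  sg_G : set 'M[C]_n;
  sg_Bp : set 'M[C]_n;
  sg_Bm : set 'M[C]_n;
  sg_H : set 'M[C]_n;
  sg_e : 'I_r -> 'M[C]_n;
  sg_f : 'I_r -> 'M[C]_n;
  sg_alpha : 'I_r -> 'M[C]_n -> C;
  sg_sl2 : 'I_r -> 'M[{mpoly C[2 * 2]}]_n;
  sg_a : 'M[int]_r;

  sg_simple : simple_alg_group sg_G;
  sg_Bp_borel : borel sg_G sg_Bp;
  sg_Bm_borel : borel sg_G sg_Bm;
  sg_H_def : sg_H = sg_Bp `&` sg_Bm;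
  sg_H_max : maximal_torus r sg_G sg_H;
  sg_Bp_dec : forall b, sg_Bp b ->
    exists h u, [/\ sg_H h, derived sg_Bp u & b = h *m u];
  sg_Bm_dec : forall b, sg_Bm b ->
    exists h u, [/\ sg_H h, derived sg_Bm u & b = h *m u];

  sg_e_lie : forall i, lie sg_Bp (sg_e i);
  sg_e_weight : forall i, weight_vector sg_H (sg_alpha i) (sg_e i);
  sg_f_lie : forall i, lie sg_Bm (sg_f i);
  sg_f_weight : forall i,
    weight_vector sg_H (fun h => (sg_alpha i h)^-1) (sg_f i);
  sg_simple_root : forall i, is_root sg_H (lie sg_Bp) (sg_alpha i);
  sg_base : forall chi, is_root sg_H (lie sg_Bp) chi ->
    exists k : 'I_r -> nat,
      forall h, sg_H h -> chi h = \prod_i sg_alpha i h ^+ k i;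

  sg_sl2_morph : forall i, alg_morphism SL2 sg_G (sg_sl2 i);
  sg_e_nilp : forall i, sg_e i ^+ n = 0;
  sg_f_nilp : forall i, sg_f i ^+ n = 0;
  sg_sl2_e : forall i (x : C),
    mxapp id (sg_sl2 i) (mat2 1 x 0 1) = expmx (x *: sg_e i);
  sg_sl2_f : forall i (x : C),
    mxapp id (sg_sl2 i) (mat2 1 0 x 1) = expmx (x *: sg_f i);
  sg_sl2_Bp : forall i (t x : C), t != 0 ->
    sg_Bp (mxapp id (sg_sl2 i) (mat2 t x 0 t^-1));
  sg_sl2_Bm : forall i (t x : C), t != 0 ->
    sg_Bm (mxapp id (sg_sl2 i) (mat2 t 0 x t^-1));
  sg_ef : forall i j, i != j -> mxbracket (sg_e i) (sg_f j) = 0;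
  sg_cartan : forall i j (t : C), t != 0 ->
    sg_alpha j (mxapp id (sg_sl2 i) (mat2 t 0 0 t^-1)) = t ^ sg_a i j;
  sg_indecomposable : forall J : {set 'I_r}, J != finset.set0 ->
    (forall i j, i \in J -> j \notin J -> sg_a i j = 0) -> J = finset.setT;

  (* simply connected: the coroots form a Z-basis of the cocharacters of H *)
  sg_sc : forall c : 'M[{mpoly C[2 * 2]}]_n,
    alg_morphism (@std_torus 1) sg_H c ->
    exists! k : {ffun 'I_r -> int}, forall t : C, t != 0 ->
      mxapp id c (mat2 t 0 0 t^-1) =
      \big[mulmx/1%:M]_(i < r)
         mxapp id (sg_sl2 i) (mat2 (t ^ k i) 0 0 (t ^ (- k i)))
}.

Section Opers.
Variables (n r : nat) (D : simple_group n r).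
Local Notation G := (sg_G D).
Local Notation Bp := (sg_Bp D).
Local Notation Bm := (sg_Bm D).
Local Notation a := (sg_a D).

Definition Np : set 'M[C]_n := derived Bp.
Definition Nm : set 'M[C]_n := derived Bm.

(* t^{\check\alpha_i}, for t in C(z)^* *)
Definition coroot_val (i : 'I_r) (t : K) : 'M[K]_n :=
  mxapp ofconst (sg_sl2 D i) (mat2 t 0 0 t^-1).

Definition s_lift (i : 'I_r) : 'M[K]_n :=
  mxapp ofconst (sg_sl2 D i) (mat2 0 1 (-1) 0).

Definition exp_e (i : 'I_r) (t : K) : 'M[K]_n :=
  expmx (t *: map_mx ofconst (sg_e D i)).

(* The irreducible representation V_i with highest weight omega_i, where
   <omega_i, \check\alpha_j> = delta_ij. *)
Record fund_rep (i : 'I_r) := FundRep {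
  fr_dim : nat;
  fr_rho : 'M[{mpoly C[n * n]}]_fr_dim;
  fr_nu : 'cV[C]_fr_dim;
  fr_rho1 : mxapp id fr_rho 1%:M = 1%:M;
  fr_rhoM : forall x y, G x -> G y ->
    mxapp id fr_rho (x *m y) = mxapp id fr_rho x *m mxapp id fr_rho y;
  (* the column space of U^T is the subspace *)
  fr_irr : forall U : 'M[C]_fr_dim,
    (forall x, G x -> (U *m (mxapp id fr_rho x)^T <= U)%MS) ->
    U = 0 \/ row_full U;
  fr_nu0 : fr_nu != 0;
  fr_nu_Np : forall u, Np u -> mxapp id fr_rho u *m fr_nu = fr_nu;
  fr_nu_wt : forall j (t : C), t != 0 ->
    mxapp id fr_rho (mxapp id (sg_sl2 D j) (mat2 t 0 0 t^-1)) *m fr_nu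
      = (if j == i then t else 1) *: fr_nu;
  (* B_+ preserves W_i, the span of nu and f_i nu *)
  fr_W_Bp : forall b, Bp b -> exists x y : C,
    mxapp id fr_rho b *m (mxdiff fr_rho (sg_f D i) *m fr_nu)
      = x *: fr_nu + y *: (mxdiff fr_rho (sg_f D i) *m fr_nu)
}.

Definition fr_fnu i (V : fund_rep i) : 'cV[C]_(fr_dim V) :=
  mxdiff (fr_rho V) (sg_f D i) *m fr_nu V.

Definition W_space i (V : fund_rep i) : set 'cV[K]_(fr_dim V) :=
  [set w | exists x y : K,
     w = x *: map_mx ofconst (fr_nu V) + y *: map_mx ofconst (fr_fnu V)].

Variables (q : C) (Lambda : 'I_r -> {poly C}).

Local Notation sh := (map_mx (qshift q)).

Definition gauge (g A : 'M[K]_n) : 'M[K]_n := sh g *m A *m invmx g.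

(* A q-connection A on a principal G-bundle, with reductions given by the cosets
   redm B_-(z) and redp B_+(z), all at the generic point of P^1, where the bundle
   is trivial. *)
Record qconn := QConn { qc_A : 'M[K]_n; redm : 'M[K]_n; redp : 'M[K]_n }.

Definition oper_cell : set 'M[K]_n :=
  [set A | exists u1 u2, [/\ points Nm u1, points Nm u2 &
     A = u1 *m (\big[mulmx/1%:M]_(i < r)
                  (coroot_val i (ofpoly (Lambda i)) *m s_lift i)) *m u2]].

(* The trivializations adapted to the B_- reduction are the redm b, b in B_-(z). *)
Definition miura_oper (O : qconn) : Prop :=
  [/\ points G (qc_A O), points G (redm O), points G (redp O),
      exists2 b, points Bm b &
        oper_cell (gauge (invmx (redm O *m b)) (qc_A O))
    & points Bp (gauge (invmx (redp O)) (qc_A O))].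

Definition oper_iso (O O' : qconn) : Prop :=
  exists g, [/\ points G g, qc_A O' = gauge g (qc_A O),
    exists2 b, points Bm b & redm O' = g *m redm O *m b
    & exists2 b, points Bp b & redp O' = g *m redp O *m b].

Definition normal_form (g : 'I_r -> K) : 'M[K]_n :=
  \big[mulmx/1%:M]_(i < r)
     (coroot_val i (g i) *m exp_e i (ofpoly (Lambda i) / g i)).

Definition normal_oper (g : 'I_r -> K) : qconn :=
  QConn (normal_form g) 1%:M 1%:M.

Variables (zeta : 'I_r -> C) (V : forall i, fund_rep i).

Definition twist : 'M[K]_n :=
  \big[mulmx/1%:M]_(i < r) coroot_val i (ofconst (zeta i)).

Definition miura_plucker (A : 'M[K]_n) : Prop :=
  exists2 v, points Bp v & forall i w, @W_space i (V i) w ->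
    mxapp ofconst (fr_rho (V i)) A *m w =
    mxapp ofconst (fr_rho (V i)) (sh v *m twist *m invmx v) *m w.

Definition cartan_of (y : 'I_r -> K) (i : 'I_r) : K :=
  ofconst (zeta i) * qshift q (y i) / y i.

Definition rho_fun (y : 'I_r -> K) (i : 'I_r) : K :=
  ofpoly (Lambda i)
  * (\prod_(j < r | (i < j)%N)
       (ofconst (zeta j) * qshift q (y j)) ^ (- a j i))
  * (\prod_(j < r | (j < i)%N) (y j) ^ (- a j i)).

Definition zero_or_pole (f : K) (x : C) : Prop := is_zero f x \/ is_pole f x.

Definition H_nondegenerate (y : 'I_r -> K) : Prop :=
  forall i j k, i != j -> a i k != 0 -> a j k != 0 ->
    forall x, zero_or_pole (y i) x ->
      (forall w, zero_or_pole (y j) w -> q_distinct q x w) /\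
      (forall w, root (Lambda k) w -> q_distinct q x w).

(* For r = 1 one has rho_fun y i = Lambda i, and H_nondegenerate is void. *)
Definition nondegenerate_y (y : 'I_r -> K) : Prop :=
  ((1 < r)%N -> H_nondegenerate y) /\
  forall i, (exists p : {poly C}, y i = ofpoly p) /\
    forall x w, is_zero (y i) x -> is_zero (rho_fun y i) w -> q_distinct q x w.

(* O is a nondegenerate Z-twisted Miura-Pluecker oper with Cartan data y. *)
Definition nondegenerate_ZMP (O : qconn) (y : 'I_r -> K) : Prop :=
  [/\ miura_oper O, forall i, y i != 0,
      oper_iso O (normal_oper (cartan_of y)),
      miura_plucker (normal_form (cartan_of y))
    & nondegenerate_y y].

Definition nondegenerate_ZMP_oper (O : qconn) : Prop :=
  exists y, nondegenerate_ZMP O y.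

(* Distinct zeros of y_i lie in distinct q-orbits, and y_i does not vanish at 0.
   Surjectivity of the correspondence needs this. For G = SL(2),
   y = (z - x)(z - q^2 x) and phi = c / ((z - x)(z - q x)(z - q^2 x)), the function
   Lambda = y(z) y(qz) (zeta phi(z) - zeta^-1 phi(qz)) is a polynomial of degree 1
   whose root is, for generic zeta, q-distinct from x. The oper with this y and
   Lambda (made monic by the choice of c) is nondegenerate and twisted by
   v = ((y, - y phi), (0, y^-1)), but its only Q_- would be y phi = c / (z - q x).
   A zero at 0 has the same effect: take y = z and Lambda(0) <> 0. *)
Definition q_generic (y : 'I_r -> K) : Prop :=
  forall i x w (k : int), is_zero (y i) x -> is_zero (y i) w ->
    x = q ^ k * w -> k = 0.

Definition xi_tilde (i : 'I_r) : C :=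
  zeta i * \prod_(j < r | (i < j)%N) zeta j ^ a j i.
Definition xi (i : 'I_r) : C :=
  (zeta i)^-1 * \prod_(j < r | (j < i)%N) zeta j ^ (- a j i).

(* (Q^i_+)_i and (Q^i_-)_i *)
Definition qq_data : Type :=
  ({ffun 'I_r -> {poly C}} * {ffun 'I_r -> {poly C}})%type.

Definition qq_system (Q : qq_data) : Prop :=
  forall i,
    ofconst (xi_tilde i) * ofpoly (Q.2 i) * qshift q (ofpoly (Q.1 i))
    - ofconst (xi i) * qshift q (ofpoly (Q.2 i)) * ofpoly (Q.1 i)
    = ofpoly (Lambda i)
      * (\prod_(j < r | (i < j)%N) qshift q (ofpoly (Q.1 j)) ^ (- a j i))
      * (\prod_(j < r | (j < i)%N) ofpoly (Q.1 j) ^ (- a j i)).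

Definition zeta_generic : Prop :=
  forall j, ~ in_qZ q (\prod_(i < r) zeta i ^ a i j).

Definition nondegenerate_solution (Q : qq_data) : Prop :=
  [/\ qq_system Q, forall i, Q.1 i \is monic, zeta_generic,
      forall i j k, i != j -> a i k != 0 -> a j k != 0 ->
        forall x, root (Q.1 i) x ->
          (forall w, root (Q.1 j) w -> q_distinct q x w) /\
          (forall w, root (Lambda k) w -> q_distinct q x w)
    & r = 1%N -> forall i x w,
        root (Q.1 i) x -> root (Lambda i) w -> q_distinct q x w].

Definition oper_of (Q : qq_data) : qconn :=
  normal_oper (cartan_of (fun j => ofpoly (Q.1 j))).

End Opers.
End Setup.

(* Main.v *)
Require Import Defs.
From HB Require Import structures.
From mathcomp Require Import all_boot all_order all_algebra generic_quotient.
From mathcomp Require Import classical_sets reals.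
From mathcomp Require Import complex mpoly ring fraction.
Import Order.TTheory GRing.Theory Num.Theory.
Local Open Scope ring_scope.
Local Open Scope complex_scope.

Set Implicit Arguments.
Unset Strict Implicit.
Unset Printing Implicit Defensive.

(* A statement about C(z)-points is checked at all but finitely many values of z,
   where it becomes one about complex points. On W_i, with basis nu and f_i nu, an
   element of B_+ acts by an upper triangular 2x2 matrix; for the elements of H,
   which are products of coroots, it is diagonal with entries chi_i and
   chi_i prod_j chi_j^(-a_ji). Comparing the matrices of A(z) v(z) and v(qz) Z, the
   diagonal gives chi_i = c_i y_i and the corner is the i-th equation of the
   QQ-system for Q_- = - (corner of v). Its rational solution is unique, and is a
   polynomial because poles would propagate along q-orbits. Conversely
   v = prod y_i^(coroot i) prod exp(- Q_-^i / Q_+^i e_i) twists the oper of a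
   solution. An isomorphism of two such opers is given by an element of H(z), with
   weights chi_i = c_i Q'_i / Q_i; comparing the matrices on W_i,
   chi_i(z) chi_i(qz) = prod_(j > i) chi_j(qz)^(-a_ji) prod_(j < i) chi_j(z)^(-a_ji).
   So the zeros and poles of the chi_i other than 0 are stable under
   multiplication by q, hence absent, and nondegeneracy excludes 0. *)

(** * Relations compatible with ring operations *)

HB.instance Definition _ (S : pzRingType) n :=
  Monoid.isLaw.Build 'M[S]_n 1%:M (@mulmx S n n n)
    (@mulmxA S n n n n) (@mul1mx S n n) (@mulmx1 S n n).

Record ring_rel (S T : nzRingType) (E : S -> T -> Prop) : Prop := RingRel {
  rel1 : E 1 1;
  relN : forall x y, E x y -> E (- x) (- y);
  relD : forall x y x' y', E x y -> E x' y' -> E (x + x') (y + y');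
  relM : forall x y x' y', E x y -> E x' y' -> E (x * x') (y * y')
}.

Definition mx_rel (S T : Type) (E : S -> T -> Prop) m n
  (g : 'M[S]_(m, n)) (h : 'M[T]_(m, n)) : Prop := forall i j, E (g i j) (h i j).

Section RingRel.
Variables (S T : nzRingType) (E : S -> T -> Prop).
Hypothesis EP : ring_rel E.

Lemma rel0 : E 0 0.
Proof.
have := relD EP (rel1 EP) (relN EP (rel1 EP)).
by rewrite !subrr.
Qed.

Lemma rel_sum I (s : seq I) (P : pred I) F G :
  (forall i, P i -> E (F i) (G i)) ->
  E (\sum_(i <- s | P i) F i) (\sum_(i <- s | P i) G i).
Proof. by move=> EFG; elim/big_rec2: _ => [|i x y Pi]; [exact: rel0|apply: relD; auto]. Qed.

Lemma rel_prod I (s : seq I) (P : pred I) F G :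
  (forall i, P i -> E (F i) (G i)) ->
  E (\prod_(i <- s | P i) F i) (\prod_(i <- s | P i) G i).
Proof. by move=> EFG; elim/big_rec2: _ => [|i x y Pi]; [exact: rel1|apply: relM; auto]. Qed.

Lemma rel_exp x y k : E x y -> E (x ^+ k) (y ^+ k).
Proof.
by move=> xy; elim: k => [|k IH]; rewrite ?expr0 ?exprS; [exact: rel1|exact: relM].
Qed.

Lemma mx_relM m n p (g : 'M_(m, n)) (h : 'M_(n, p)) g' h' :
  mx_rel E g g' -> mx_rel E h h' -> mx_rel E (g *m h) (g' *m h').
Proof. by move=> Eg Eh i j; rewrite !mxE; apply: rel_sum => k _; exact: relM. Qed.

Lemma mx_relD m n (g h : 'M_(m, n)) g' h' :
  mx_rel E g g' -> mx_rel E h h' -> mx_rel E (g + h) (g' + h').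
Proof. by move=> Eg Eh i j; rewrite !mxE; exact: relD. Qed.

Lemma mx_relZ m n c c' (g : 'M_(m, n)) g' :
  E c c' -> mx_rel E g g' -> mx_rel E (c *: g) (c' *: g').
Proof. by move=> Ec Eg i j; rewrite !mxE; exact: relM. Qed.

Lemma mx_rel_id n : mx_rel E (1%:M : 'M_n) 1%:M.
Proof. by move=> i j; rewrite !mxE; case: eqP => _; [exact: rel1|exact: rel0]. Qed.

Lemma mx_rel_sum I (s : seq I) m n (F G : I -> 'M_(m, n)) :
  (forall i, mx_rel E (F i) (G i)) ->
  mx_rel E (\sum_(i <- s) F i) (\sum_(i <- s) G i).
Proof. by move=> EFG i j; rewrite !summxE; apply: rel_sum => k _; exact: EFG. Qed.

Lemma mx_rel_exp n (g : 'M_n) g' k : mx_rel E g g' -> mx_rel E (g ^+ k) (g' ^+ k).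
Proof.
move=> Eg; elim: k => [|k IH]; rewrite ?expr0 ?exprS; first exact: mx_rel_id.
exact: mx_relM.
Qed.

Lemma rel_det n (g : 'M_n) g' : mx_rel E g g' -> E (\det g) (\det g').
Proof.
move=> Eg; rewrite /determinant; apply: rel_sum => s _; apply: relM => //.
  by apply: rel_exp; apply: relN => //; exact: rel1.
by apply: rel_prod.
Qed.

Lemma mx_rel_adj n (g : 'M_n) g' : mx_rel E g g' -> mx_rel E (\adj g) (\adj g').
Proof.
move=> Eg i j; rewrite !mxE; apply: relM => //.
  by apply: rel_exp; apply: relN => //; exact: rel1.
by apply: rel_det => k l; rewrite !mxE.
Qed.

Lemma mx_rel_mat2 a b c d a' b' c' d' :
  E a a' -> E b b' -> E c c' -> E d d' -> mx_rel E (mat2 a b c d) (mat2 a' b' c' d').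
Proof. by move=> *; move=> i j; rewrite !mxE; do 2 case: ifP => _. Qed.

End RingRel.

Lemma rel_mxeval (C S T : comNzRingType) (E : S -> T -> Prop)
    (iota : C -> S) (kappa : C -> T) n (g : 'M[S]_n) h p :
  ring_rel E -> (forall c, E (iota c) (kappa c)) -> mx_rel E g h ->
  E (mxeval iota g p) (mxeval kappa h p).
Proof.
move=> EP Ec Eg; apply: rel_sum => // m _; apply: relM => //.
apply: rel_prod => // k _; apply: rel_exp => //.
by case/mxvec_indexP: k => i j; rewrite !mxvecE.
Qed.

Lemma rel_mxapp (C S T : comNzRingType) (E : S -> T -> Prop)
    (iota : C -> S) (kappa : C -> T) n m (g : 'M[S]_n) h (f : 'M_m) :
  ring_rel E -> (forall c, E (iota c) (kappa c)) -> mx_rel E g h ->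
  mx_rel E (mxapp iota f g) (mxapp kappa f h).
Proof. by move=> EP Ec Eg i j; rewrite !mxE; exact: rel_mxeval. Qed.

Lemma rel_expmx (S T : unitRingType) (E : S -> T -> Prop) n (g : 'M[S]_n) h :
  ring_rel E -> (forall k, E (k`!%:R^-1) (k`!%:R^-1)) -> mx_rel E g h ->
  mx_rel E (expmx g) (expmx h).
Proof.
move=> EP Ek Eg; apply: mx_rel_sum => // k.
by apply: mx_relZ => //; exact: mx_rel_exp.
Qed.

Lemma morph_rel (S T : nzRingType) (phi : {rmorphism S -> T}) :
  ring_rel (fun x y => phi x = y).
Proof.
split; first exact: rmorph1.
- by move=> x _ <-; rewrite rmorphN.
- by move=> x _ x' _ <- <-; rewrite rmorphD.
- by move=> x _ x' _ <- <-; rewrite rmorphM.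
Qed.

Lemma mxapp_map (C S T : comNzRingType) (phi : {rmorphism S -> T})
    (iota : C -> S) (kappa : C -> T) n m (f : 'M_m) (g : 'M[S]_n) :
  (forall c, phi (iota c) = kappa c) ->
  map_mx phi (mxapp iota f g) = mxapp kappa f (map_mx phi g).
Proof.
move=> pi; apply/matrixP => i j; rewrite mxE.
apply: (rel_mxapp f (morph_rel phi) pi (h := map_mx phi g)).
by move=> k l; rewrite mxE.
Qed.

Lemma mxeval_map (C S T : comNzRingType) (phi : {rmorphism S -> T})
    (iota : C -> S) (kappa : C -> T) n p (g : 'M[S]_n) :
  (forall c, phi (iota c) = kappa c) ->
  phi (mxeval iota g p) = mxeval kappa (map_mx phi g) p.
Proof.
move=> pi; apply: (rel_mxeval p (morph_rel phi) pi (h := map_mx phi g)).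
by move=> k l; rewrite mxE.
Qed.

Section Precomposition.
Variables (C S : comNzRingType) (iota : {rmorphism C -> S}).

Definition precomp n m (f : 'M[{mpoly C[n * n]}]_m) (p : {mpoly C[m * m]}) :
    {mpoly C[n * n]} :=
  mmap (@mpolyC (n * n) C) (fun k => mxvec f 0 k) p.

Lemma mxeval_precomp n m (f : 'M_m) p (g : 'M[S]_n) :
  mxeval iota g (precomp f p) = mxeval iota (mxapp iota f g) p.
Proof.
rewrite {1}/mxeval.
have := @mxeval_map C _ S (mmap iota (fun k => mxvec g 0 k))
  (@mpolyC (n * n) C) iota m p f (mmapC _ _).
by [].
Qed.

Definition mxcoord n : 'M[{mpoly C[n * n]}]_n :=
  \matrix_(i, j) 'X_(mxvec_index i j).

Lemma mxapp_coord n (g : 'M[S]_n) : mxapp iota (mxcoord n) g = g.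
Proof.
apply/matrixP => i j; rewrite !mxE /mxeval mmapX mmap1U.
by rewrite mxvecE.
Qed.

Lemma mxapp_const n m (g : 'M[S]_n) (c : 'M[C]_m) :
  mxapp iota (map_mx (@mpolyC (n * n) C) c) g = map_mx iota c.
Proof. by apply/matrixP => i j; rewrite !mxE /mxeval mmapC. Qed.

Lemma mxapp_mul n m (f h : 'M_m) (g : 'M[S]_n) :
  mxapp iota (f *m h) g = mxapp iota f g *m mxapp iota h g.
Proof. exact: (map_mxM (mmap iota (fun k => mxvec g 0 k))). Qed.

End Precomposition.

(** * Rational functions and their values *)

Section Specialization.
Variable R : realType.
Local Notation C := R[i].
Local Notation K := (ratfun R).

Lemma poly_neq0_nonroot (p : {poly C}) : p != 0 -> exists z, p.[z] != 0.
Proof.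
move=> p0; pose s : seq C := [seq k%:R | k <- iota 0 (size p)].
have : ~~ all (root p) s.
  apply/negP => rs; have us : uniq s.
    rewrite map_inj_uniq ?iota_uniq // => i j /eqP.
    by rewrite eqr_nat => /eqP.
  by have := max_poly_roots p0 rs us; rewrite size_map size_iota ltnn.
by case/allPn => z _ pz; exists z.
Qed.

Lemma poly_eq_off (d p s : {poly C}) : d != 0 ->
  (forall z, d.[z] != 0 -> p.[z] = s.[z]) -> p = s.
Proof.
move=> d0 ps; apply/eqP; rewrite -subr_eq0; apply/negPn/negP => ps0.
have [|z] := @poly_neq0_nonroot (d * (p - s)); first by rewrite mulf_neq0.
rewrite hornerM mulf_eq0 negb_or => /andP[dz].
by rewrite !hornerE ps // subrr eqxx.
Qed.

Definition ae (P : C -> Prop) : Prop :=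
  exists2 d : {poly C}, d != 0 & forall z, d.[z] != 0 -> P z.

Lemma ae_true (P : C -> Prop) : (forall z, P z) -> ae P.
Proof. by move=> HP; exists 1; rewrite ?oner_neq0. Qed.

Lemma ae_and (P Q : C -> Prop) : ae P -> ae Q -> ae (fun z => P z /\ Q z).
Proof.
move=> [d d0 HP] [e e0 HQ]; exists (d * e); first by rewrite mulf_neq0.
by move=> z; rewrite hornerM mulf_eq0 negb_or => /andP[/HP ? /HQ ?].
Qed.

Lemma ae_sub (P Q : C -> Prop) : (forall z, P z -> Q z) -> ae P -> ae Q.
Proof. by move=> PQ [d d0 HP]; exists d => // z /HP/PQ. Qed.

Lemma ae_forall (I : finType) (P : I -> C -> Prop) :
  (forall i, ae (P i)) -> ae (fun z => forall i, P i z).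
Proof.
move=> HP; suff: ae (fun z => forall i, i \in enum I -> P i z).
  by apply: ae_sub => z Hz i; apply: Hz; rewrite mem_enum.
elim: (enum I) => [|i s IH]; first exact: ae_true.
move: (ae_and (HP i) IH); apply: ae_sub => z [Hi Hs] j.
by rewrite inE => /orP[/eqP->|/Hs].
Qed.

Lemma ae_exists (P : C -> Prop) : ae P -> exists z, P z.
Proof. by case=> d /poly_neq0_nonroot[z dz] /(_ z dz) Pz; exists z. Qed.

Local Notation ofp := (@ofpoly R).
Local Notation ofc := (@ofconst R).

Lemma ofpolyD : {morph ofp : p s / p + s}. Proof. exact: tofracD. Qed.
Lemma ofpolyN : {morph ofp : p / - p}. Proof. exact: tofracN. Qed.
Lemma ofpolyB : {morph ofp : p s / p - s}. Proof. exact: tofracB. Qed.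
Lemma ofpolyM : {morph ofp : p s / p * s}. Proof. exact: tofracM. Qed.
Lemma ofpoly1 : ofp 1 = 1. Proof. exact: tofrac1. Qed.
Lemma ofpoly0 : ofp 0 = 0. Proof. exact: tofrac0. Qed.
Lemma ofpoly_eq0 p : (ofp p == 0) = (p == 0). Proof. exact: tofrac_eq0. Qed.
Lemma ofpoly_inj : injective ofp.
Proof. by move=> p s /eqP; rewrite tofrac_eq => /eqP. Qed.

HB.instance Definition _ := GRing.isZmodMorphism.Build _ _ ofp ofpolyB.
HB.instance Definition _ := GRing.isMonoidMorphism.Build _ _ ofp (ofpoly1, ofpolyM).

Lemma ofconstB : {morph ofc : p s / p - s}.
Proof. by move=> x y; rewrite /ofconst polyCB ofpolyB. Qed.
Lemma ofconstM : {morph ofc : p s / p * s}.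
Proof. by move=> x y; rewrite /ofconst polyCM ofpolyM. Qed.
Lemma ofconst1 : ofc 1 = 1. Proof. by rewrite /ofconst polyC1 ofpoly1. Qed.

HB.instance Definition _ := GRing.isZmodMorphism.Build _ _ ofc ofconstB.
HB.instance Definition _ := GRing.isMonoidMorphism.Build _ _ ofc (ofconst1, ofconstM).

Lemma ratfun_frac (f : K) : exists p s, s != 0 /\ f = ofp p / ofp s.
Proof.
exists \n_(repr f), \d_(repr f); split; first exact: denom_ratioP.
exact: ratfunE.
Qed.

Lemma frac_eq (p s p' s' : {poly C}) : s != 0 -> s' != 0 ->
  (ofp p / ofp s = ofp p' / ofp s') <-> (p * s' = p' * s).
Proof.
move=> s0 s0'; split.
  move/eqP; rewrite eqr_div ?ofpoly_eq0 // -!ofpolyM => /eqP.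
  exact: ofpoly_inj.
by move=> e; apply/eqP; rewrite eqr_div ?ofpoly_eq0 // -!ofpolyM e.
Qed.

(* A relation rather than a function, so that poles need no default value. *)
Definition evalat (z : C) (f : K) (c : C) : Prop :=
  exists p s : {poly C}, [/\ s.[z] != 0, c = p.[z] / s.[z] & f = ofp p / ofp s].

Lemma horner_neq0 (s : {poly C}) z : s.[z] != 0 -> s != 0.
Proof. by apply: contra_neq => ->; rewrite horner0. Qed.

Lemma evalat_uniq z f c c' : evalat z f c -> evalat z f c' -> c = c'.
Proof.
move=> [p [s [sz -> ->]]] [p' [s' [sz' -> /frac_eq]]].
move/(_ (horner_neq0 sz) (horner_neq0 sz')) => e.
by apply/eqP; rewrite eqr_div // -!hornerM e.
Qed.

Lemma evalat_ofpoly z p : evalat z (ofp p) p.[z].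
Proof. by exists p, 1; rewrite ofpoly1 hornerC oner_neq0 !divr1. Qed.

Lemma evalat_ofconst z c : evalat z (ofc c) c.
Proof. by have := evalat_ofpoly z c%:P; rewrite hornerC. Qed.

Lemma evalat_rel z : ring_rel (evalat z).
Proof.
split.
- by have := evalat_ofconst z 1; rewrite ofconst1.
- move=> f c [p [s [sz -> ->]]]; exists (- p), s; split=> //.
    by rewrite hornerN mulNr.
  by rewrite ofpolyN mulNr.
- move=> f c g d [p [s [sz -> ->]]] [p' [s' [sz' -> ->]]].
  exists (p * s' + p' * s), (s * s'); split.
  + by rewrite hornerM mulf_neq0.
  + by rewrite addf_div // !hornerE.
  + by rewrite addf_div ?ofpoly_eq0 ?(@horner_neq0 _ z) // ofpolyD !ofpolyM.
- move=> f c g d [p [s [sz -> ->]]] [p' [s' [sz' -> ->]]].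
  exists (p * p'), (s * s'); split.
  + by rewrite hornerM mulf_neq0.
  + by rewrite mulf_div // !hornerE.
  + by rewrite mulf_div !ofpolyM.
Qed.

Lemma evalatV z f c : c != 0 -> evalat z f c -> evalat z f^-1 c^-1.
Proof.
move=> c0 [p [s [sz ec ef]]]; exists s, p; split.
- by apply: contraNneq c0 => pz; rewrite ec pz mul0r.
- by rewrite ec invf_div.
- by rewrite ef invf_div.
Qed.

Lemma evalat_div z f c g d : d != 0 ->
  evalat z f c -> evalat z g d -> evalat z (f / g) (c / d).
Proof. by move=> d0 fc gd; exact (relM (evalat_rel z) fc (evalatV d0 gd)). Qed.

Lemma evalat_exp z f c k : evalat z f c -> evalat z (f ^+ k) (c ^+ k).
Proof. by move=> fc; exact (rel_exp (evalat_rel z) k fc). Qed.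

Lemma evalat_expz z f c (k : int) : c != 0 -> evalat z f c -> evalat z (f ^ k) (c ^ k).
Proof.
move=> c0 fc; case: k => k; first exact: evalat_exp.
have ck : c ^+ k.+1 != 0 by rewrite expf_neq0.
exact (evalatV ck (evalat_exp k.+1 fc)).
Qed.

Lemma ae_evalat f : ae (fun z => exists c, evalat z f c).
Proof.
have [p [s [s0 ->]]] := ratfun_frac f; exists s => // z sz.
by exists (p.[z] / s.[z]), p, s.
Qed.

Lemma ae_evalat_neq0 f : f != 0 -> ae (fun z => exists2 c, c != 0 & evalat z f c).
Proof.
have [p [s [s0 ->]]] := ratfun_frac f => f0; exists (p * s).
  rewrite mulf_neq0 //; apply: contraNneq f0 => ->.
  by rewrite ofpoly0 mul0r.
move=> z; rewrite hornerM mulf_eq0 negb_or => /andP[pz sz].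
by exists (p.[z] / s.[z]); [rewrite mulf_neq0 ?invr_eq0|exists p, s].
Qed.

Lemma ae_eq (f g : K) :
  ae (fun z => exists2 c, evalat z f c & evalat z g c) -> f = g.
Proof.
have [p [s [s0 ->]]] := ratfun_frac f; have [p' [s' [s0' ->]]] := ratfun_frac g.
move=> [d d0 H]; apply/(frac_eq _ _ s0 s0').
apply: (@poly_eq_off (d * (s * s'))); first by rewrite !mulf_neq0.
move=> z; rewrite !hornerM !mulf_eq0 !negb_or => /and3P[/H[c c1 c2] sz sz'].
have e1 : c = p.[z] / s.[z] by apply: evalat_uniq c1 _; exists p, s.
have e2 : c = p'.[z] / s'.[z] by apply: evalat_uniq c2 _; exists p', s'.
by apply/eqP; rewrite -eqr_div // -e1 -e2.
Qed.

Definition spec z m n := @mx_rel K C (evalat z) m n.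

Lemma ae_spec m n (g : 'M[K]_(m, n)) : ae (fun z => exists x, spec z g x).
Proof.
have: ae (fun z => forall ij : 'I_m * 'I_n, exists c, evalat z (g ij.1 ij.2) c).
  by apply: ae_forall => ij; exact: ae_evalat.
apply: ae_sub => z /fin_all_exists[x gx].
by exists (\matrix_(i, j) x (i, j)) => i j; rewrite mxE; exact: (gx (i, j)).
Qed.

Lemma ae_mx_eq m n (g h : 'M[K]_(m, n)) :
  ae (fun z => exists2 x, spec z g x & spec z h x) -> g = h.
Proof.
move=> H; apply/matrixP => i j; apply: ae_eq.
by move: H; apply: ae_sub => z [x gx hx]; exists (x i j).
Qed.

Lemma spec_map z m n (x : 'M[C]_(m, n)) : spec z (map_mx ofc x) x.
Proof. by move=> i j; rewrite mxE; exact: evalat_ofconst. Qed.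

Lemma specM z m n p (g : 'M_(m, n)) (h : 'M_(n, p)) x y :
  spec z g x -> spec z h y -> spec z (g *m h) (x *m y).
Proof. by move=> gx hy; exact (mx_relM (evalat_rel z) gx hy). Qed.

Lemma specZ z m n c d (g : 'M_(m, n)) x :
  evalat z c d -> spec z g x -> spec z (c *: g) (d *: x).
Proof. by move=> gx hy; exact (mx_relZ (evalat_rel z) gx hy). Qed.

Lemma specD z m n (g h : 'M_(m, n)) x y :
  spec z g x -> spec z h y -> spec z (g + h) (x + y).
Proof. by move=> gx hy; exact (mx_relD (evalat_rel z) gx hy). Qed.

Lemma spec_mxapp z n m (f : 'M_m) (g : 'M_n) x :
  spec z g x -> spec z (mxapp ofc f g) (mxapp id f x).
Proof. by move=> gx; apply: rel_mxapp gx => //; [exact: evalat_rel|exact: evalat_ofconst]. Qed.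

Lemma evalat_mxeval z n p (g : 'M_n) x :
  spec z g x -> evalat z (mxeval ofc g p) (mxeval id x p).
Proof. by move=> gx; apply: rel_mxeval gx => //; [exact: evalat_rel|exact: evalat_ofconst]. Qed.

Lemma spec_expmx z n (g : 'M_n) x : spec z g x -> spec z (expmx g) (expmx x).
Proof.
apply: rel_expmx => [|k]; first exact: evalat_rel.
have := evalat_ofconst z (k`!%:R^-1); rewrite fmorphV.
by rewrite rmorph_nat.
Qed.

Lemma spec_invmx z n (g : 'M_n) x :
  spec z g x -> \det x != 0 -> spec z (invmx g) (invmx x).
Proof.
move=> gx dx; have dgx := rel_det (evalat_rel z) gx.
have dg : \det g != 0.
  apply: contraNneq dx => dg; rewrite dg in dgx; apply/eqP.
  exact: evalat_uniq dgx (rel0 (evalat_rel z)).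
rewrite /invmx !unitmxE !unitfE dx dg; apply: specZ; first exact: evalatV.
exact: mx_rel_adj (evalat_rel z) _ _ _ gx.
Qed.

Lemma spec1 z n : spec z (1%:M : 'M_n) 1%:M.
Proof. exact (@mx_rel_id _ _ _ (evalat_rel z) n). Qed.

Lemma points_ae n (X : set 'M[C]_n) g :
  ae (fun z => exists2 x, spec z g x & X x) -> points X g.
Proof.
move=> H p pX; apply: ae_eq; move: H; apply: ae_sub => z [x gx Xx].
exists 0; last exact: rel0 (evalat_rel z).
by rewrite -(pX x Xx); exact: evalat_mxeval.
Qed.

Definition zclosure n (X : set 'M[C]_n) : set 'M[C]_n :=
  [set x | forall p, vanishes_on X p -> mxeval id x p = 0]%classic.

Lemma points_zclosure n (X : set 'M[C]_n) g z x :
  points X g -> spec z g x -> zclosure X x.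
Proof.
move=> Xg gx p pX; apply: evalat_uniq (evalat_mxeval p gx) _.
by rewrite Xg //; exact: rel0 (evalat_rel z).
Qed.

Lemma points_closureP n (X : set 'M[C]_n) g :
  ae (fun z => exists2 x, spec z g x & zclosure X x) -> points X g.
Proof.
move=> H p pX; apply: (points_ae H).
by move=> x; apply.
Qed.

Lemma points_spec n (X : set 'M[C]_n) g z x :
  zclosed X -> points X g -> spec z g x -> X x.
Proof. by move=> cX Xg gx; apply: cX; exact: points_zclosure Xg gx. Qed.

Lemma points_sub n (X Y : set 'M[C]_n) g :
  (X `<=` Y)%classic -> points X g -> points Y g.
Proof. by move=> XY Xg p pY; apply: Xg => x /XY; exact: pY. Qed.

End Specialization.

Section QShift.
Variable R : realType.
Local Notation C := R[i].
Local Notation K := (ratfun R).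
Local Notation ofp := (@ofpoly R).
Local Notation ofc := (@ofconst R).
Variable q : C.
Hypothesis q0 : q != 0.

Lemma horner_scalep p z : (scalep q p).[z] = p.[q * z].
Proof. by rewrite /scalep horner_comp !hornerE. Qed.

Lemma lead_coef_scalep p : lead_coef (scalep q p) = lead_coef p * q ^+ (size p).-1.
Proof.
rewrite lead_coef_comp; last by rewrite size_scale // size_polyX.
by rewrite lead_coefZ lead_coefX mulr1.
Qed.

Lemma qshift_ofpoly p : qshift q (ofp p) = ofp (scalep q p).
Proof.
have := qshiftE p q0 (oner_neq0 {poly C}).
by rewrite ofpoly1 divr1 /scalep -polyC1 comp_polyC polyC1 ofpoly1 divr1.
Qed.

Lemma qshift_ofconst c : qshift q (ofc c) = ofc c.
Proof. by rewrite /ofconst qshift_ofpoly /scalep comp_polyC. Qed.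

Lemma qshiftB : {morph qshift q : f g / f - g}.
Proof.
move=> f g; have [p [s [s0 ->]]] := ratfun_frac f.
have [p' [s' [s0' ->]]] := ratfun_frac g.
have sub_div (a b c d : {poly C}) : b != 0 -> d != 0 ->
    ofp a / ofp b - ofp c / ofp d = ofp (a * d - c * b) / ofp (b * d).
  move=> b0 d0; rewrite -mulNr addf_div ?ofpoly_eq0 //.
  by rewrite ofpolyB !ofpolyM mulNr.
rewrite sub_div // !qshiftE ?mulf_neq0 // sub_div ?scalep_eq0 //.
by rewrite /scalep comp_polyB !comp_polyM.
Qed.

Lemma qshiftM : {morph qshift q : f g / f * g}.
Proof.
move=> f g; have [p [s [s0 ->]]] := ratfun_frac f.
have [p' [s' [s0' ->]]] := ratfun_frac g.
rewrite mulf_div -!ofpolyM !qshiftE ?mulf_neq0 // mulf_div -!ofpolyM.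
by rewrite /scalep !comp_polyM.
Qed.

Lemma qshift1 : qshift q 1 = 1.
Proof. by have := qshift_ofconst 1; rewrite rmorph1. Qed.

Definition qshift_morph : {rmorphism K -> K} :=
  HB.pack_for {rmorphism K -> K} (qshift q)
    (GRing.isZmodMorphism.Build _ _ (qshift q) qshiftB)
    (GRing.isMonoidMorphism.Build _ _ (qshift q) (qshift1, qshiftM)).

Lemma qshift_eq0 f : (qshift q f == 0) = (f == 0).
Proof. exact: (fmorph_eq0 qshift_morph). Qed.

Lemma qshiftV f : qshift q f^-1 = (qshift q f)^-1.
Proof. exact: (fmorphV qshift_morph). Qed.

Lemma qshift_prod I (s : seq I) (P : pred I) F :
  qshift q (\prod_(i <- s | P i) F i) = \prod_(i <- s | P i) qshift q (F i).
Proof. exact: (rmorph_prod qshift_morph). Qed.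

Lemma qshiftXz f (k : int) : qshift q (f ^ k) = qshift q f ^ k.
Proof.
have X (n : nat) : qshift q (f ^+ n) = qshift q f ^+ n.
  exact: (rmorphXn qshift_morph).
by case: k => k; rewrite /exprz ?qshiftV X.
Qed.

Lemma evalat_qshift z f c : evalat (q * z) f c -> evalat z (qshift q f) c.
Proof.
move=> [p [s [sz -> ->]]]; exists (scalep q p), (scalep q s).
by rewrite !horner_scalep qshiftE // (horner_neq0 sz).
Qed.

Lemma qshift_eigen_size (p s : {poly C}) c : p != 0 -> s != 0 ->
  qshift q (ofp p / ofp s) = ofc c * (ofp p / ofp s) ->
  c * q ^+ (size s).-1 = q ^+ (size p).-1.
Proof.
move=> p0 s0; rewrite qshiftE // mulrA /ofconst -ofpolyM.
have ss0 : scalep q s != 0 by rewrite scalep_eq0.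
move/(frac_eq _ _ ss0 s0)/(congr1 lead_coef).
rewrite !lead_coefM !lead_coef_scalep lead_coefC => e.
have ps0 : lead_coef p * lead_coef s != 0 by rewrite mulf_neq0 ?lead_coef_eq0.
apply: (mulfI ps0); transitivity (c * lead_coef p * (lead_coef s * q ^+ (size s).-1)).
  by ring.
by rewrite -e; ring.
Qed.

Lemma qshift_eigen f c : f != 0 -> qshift q f = ofc c * f -> in_qZ q c.
Proof.
have [p [s [s0 ->]]] := ratfun_frac f => f0.
have p0 : p != 0 by apply: contraNneq f0 => ->; rewrite ofpoly0 mul0r.
move/(qshift_eigen_size p0 s0) => e.
exists ((size p).-1%:Z - (size s).-1%:Z).
by rewrite expfzDr // -exprnP -exprnN -e mulfK // expf_neq0.
Qed.

Hypothesis q_infinite : forall m : nat, (0 < m)%N -> q ^+ m != 1.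

Lemma q_expz_inj (k l : int) : q ^ k = q ^ l -> k = l.
Proof.
wlog lk : k l / l <= k.
  by move=> H; case: (leP l k) => [/H//|/ltW /H HH /esym/HH].
move=> e; have : q ^ (k - l) = 1.
  by rewrite expfzDr // e -expfzDr // subrr.
move: lk; rewrite -subr_ge0 => /gez0_abs <- => /eqP.
rewrite -exprnP; case: (posnP `|k - l|%N) => [/eqP|/q_infinite/negPf-> //].
by rewrite absz_eq0 subr_eq0 => /eqP.
Qed.

Lemma qshift_invariant f : qshift q f = f -> exists c, f = ofc c.
Proof.
have [p [s [s0 ->]]] := ratfun_frac f => e.
have [->|p0] := eqVneq p 0; first by exists 0; rewrite ofpoly0 mul0r rmorph0.
have sz : (size p).-1 = (size s).-1.
  have := qshift_eigen_size (c := 1) p0 s0; rewrite rmorph1 !mul1r => /(_ e).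
  by rewrite !exprnP => /q_expz_inj[].
pose c := lead_coef p / lead_coef s; exists c.
have ec : ofp p / ofp s - ofc c = ofp (p - c%:P * s) / ofp s.
  by rewrite ofpolyB ofpolyM mulrBl mulfK // ofpoly_eq0.
apply/eqP; rewrite -subr_eq0 ec; have [->|r0] := eqVneq (p - c%:P * s) 0.
  by rewrite ofpoly0 mul0r.
have := qshift_eigen_size (c := 1) r0 s0; rewrite rmorph1 !mul1r -ec qshiftB.
rewrite qshift_ofconst e => /(_ erefl); rewrite !exprnP => /q_expz_inj[] sr.
have szs : size (p - c%:P * s) = size s.
  by rewrite -(@prednK (size s)) ?size_poly_gt0 // sr prednK // size_poly_gt0.
have: (p - c%:P * s)`_(size s).-1 = 0.
  rewrite coefB coefCM -{1}sz -!/(lead_coef _) /c divfK ?subrr //.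
  by rewrite lead_coef_eq0.
by rewrite -szs => /eqP; rewrite -/(lead_coef _) lead_coef_eq0 (negPf r0).
Qed.

Lemma orbit_nonroot (p : {poly C}) x : x != 0 -> p != 0 ->
  exists k : nat, p.[q ^+ k * x] != 0.
Proof.
move=> x0 p0; pose s := [seq q ^+ k * x | k <- iota 0 (size p)].
have : ~~ all (root p) s.
  apply/negP => rs; have us : uniq s.
    rewrite map_inj_uniq ?iota_uniq // => i j /(mulIf x0).
    by rewrite !exprnP => /q_expz_inj[].
  by have := max_poly_roots p0 rs us; rewrite size_map size_iota ltnn.
by case/allPn => _ /mapP[k _ ->] pz; exists k.
Qed.

End QShift.

Section Order.
Variable R : realType.
Local Notation C := R[i].
Local Notation K := (ratfun R).
Local Notation ofp := (@ofpoly R).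
Local Notation ofc := (@ofconst R).

Definition ord_at (x : C) (f : K) : int :=
  (mup x \n_(repr f))%:Z - (mup x \d_(repr f))%:Z.

Lemma ord_at_frac x p s : p != 0 -> s != 0 ->
  ord_at x (ofp p / ofp s) = (mup x p)%:Z - (mup x s)%:Z.
Proof.
move=> p0 s0; rewrite /ord_at; set f := ofp p / ofp s.
have d0 : \d_(repr f) != 0 by exact: denom_ratioP.
have /frac_eq := ratfunE f => /(_ s0 d0) e.
have n0 : \n_(repr f) != 0.
  apply: contra_eq_neq e => ->; rewrite mul0r mulf_neq0 //.
move/(congr1 (mup x)): e; rewrite !mupM // => e.
apply/eqP; rewrite subr_eq addrAC eq_sym subr_eq -!PoszD; apply/eqP; congr Posz.
by rewrite e addnC.
Qed.

Lemma ord_at_mul x f g : f != 0 -> g != 0 -> ord_at x (f * g) = ord_at x f + ord_at x g.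
Proof.
have [p [s [s0 ->]]] := ratfun_frac f; have [p' [s' [s0' ->]]] := ratfun_frac g.
rewrite !mulf_eq0 !invr_eq0 !ofpoly_eq0 (negPf s0) (negPf s0') !orbF => p0 p0'.
rewrite mulf_div -!ofpolyM !ord_at_frac ?mulf_neq0 // !mupM // !PoszD; ring.
Qed.

Lemma ord_at_one x : ord_at x 1 = 0.
Proof.
by have := ord_at_mul x (oner_neq0 K) (oner_neq0 K); rewrite mulr1 => /eqP;
   rewrite -subr_eq subrr eq_sym => /eqP.
Qed.

Lemma ord_at_inv x f : f != 0 -> ord_at x f^-1 = - ord_at x f.
Proof.
move=> f0; have := ord_at_mul x (invr_neq0 f0) f0.
by rewrite mulVf // ord_at_one => /esym/eqP; rewrite addr_eq0 => /eqP.
Qed.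

Lemma ord_at_exp x f (k : nat) : f != 0 -> ord_at x (f ^+ k) = ord_at x f * k%:Z.
Proof.
move=> f0; elim: k => [|k IH]; first by rewrite expr0 ord_at_one mulr0.
by rewrite exprS ord_at_mul ?expf_neq0 // IH; ring.
Qed.

Lemma ord_at_expz x f (k : int) : f != 0 -> ord_at x (f ^ k) = ord_at x f * k.
Proof.
move=> f0; case: k => k; first exact: ord_at_exp.
by rewrite NegzE -exprnN ord_at_inv ?expf_neq0 // ord_at_exp // mulrN.
Qed.

Lemma ord_at_prod x (I : eqType) (s : seq I) (P : pred I) F : (forall i, P i -> F i != 0) ->
  ord_at x (\prod_(i <- s | P i) F i) = \sum_(i <- s | P i) ord_at x (F i).
Proof.
move=> F0; elim: s => [|i s IH]; first by rewrite !big_nil ord_at_one.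
rewrite !big_cons; case: ifP => // Pi; rewrite ord_at_mul ?IH ?F0 //.
by rewrite prodf_seq_neq0; apply/allP => j _; apply/implyP/F0.
Qed.

Lemma ord_at_ofpoly x p : p != 0 -> ord_at x (ofp p) = (mup x p)%:Z.
Proof.
move=> p0; have := ord_at_frac x p0 (oner_neq0 {poly C}).
rewrite ofpoly1 divr1 => ->; rewrite [X in _ - Posz X]mupNroot ?subr0 //.
by rewrite root1.
Qed.

Lemma ord_at_ofconst x c : c != 0 -> ord_at x (ofc c) = 0.
Proof.
move=> c0; rewrite /ofconst ord_at_ofpoly ?polyC_eq0 // mupNroot //.
by rewrite rootC.
Qed.

Lemma mup_scalep (q x : C) p : q != 0 -> p != 0 -> mup x (scalep q p) = mup (q * x) p.
Proof.
move=> q0 p0; have [m [s]] := multiplicity_XsubC p (q * x); rewrite p0 /= => sr ->.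
have s0 : s != 0 by apply: contraNneq sr => ->; rewrite root0.
have e : scalep q ('X - (q * x)%:P) = q%:P * ('X - x%:P).
  by rewrite /scalep comp_polyB comp_polyX comp_polyC mulrBr -mul_polyC polyCM.
have -> : scalep q (s * ('X - (q * x)%:P) ^+ m) =
          (q ^+ m)%:P * scalep q s * ('X - x%:P) ^+ m.
  rewrite /scalep comp_polyM rmorphXn /= -!/(scalep q _) e exprMn -polyC_exp.
  by ring.
rewrite mupMr; last first.
  rewrite rootM rootC expf_eq0 (negPf q0) andbF /=.
  by rewrite /root horner_scalep.
by rewrite mupMr // !mup_XsubCX !eqxx.
Qed.

Lemma ord_at_qshift (q x : C) f : q != 0 -> f != 0 ->
  ord_at x (qshift q f) = ord_at (q * x) f.
Proof.
move=> q0; have [p [s [s0 ->]]] := ratfun_frac f.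
rewrite !mulf_eq0 invr_eq0 !ofpoly_eq0 (negPf s0) orbF => p0.
by rewrite qshiftE // !ord_at_frac ?scalep_eq0 // !mup_scalep.
Qed.

Lemma monic_eq_mup (p s : {poly C}) : p \is monic -> s \is monic ->
  (forall x, mup x p = mup x s) -> p = s.
Proof.
move=> mp ms e.
have [r er] := closed_field_poly_normal p.
have [r' er'] := closed_field_poly_normal s.
rewrite (monicP mp) scale1r in er; rewrite (monicP ms) scale1r in er'.
rewrite er er'; apply: perm_big; apply/allP => x _ /=.
by rewrite -!mu_prod_XsubC -er -er' e.
Qed.

End Order.

Lemma clear_denominators (F : fieldType) (a b n n' d d' y y' : F) :
  d != 0 -> d' != 0 ->
  (a * (n / d) * y' - b * (n' / d') * y) * (d * d') =
  a * n * d' * y' - b * n' * d * y.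
Proof. by move=> d0 d0'; field; rewrite d0 d0'. Qed.

Section PolynomialSolutions.
Variable R : realType.
Local Notation C := R[i].
Local Notation K := (ratfun R).
Local Notation ofp := (@ofpoly R).
Local Notation ofc := (@ofconst R).
Variable q : C.
Hypothesis q0 : q != 0.
Hypothesis q_infinite : forall m : nat, (0 < m)%N -> q ^+ m != 1.

Lemma ratfun_coprime (f : K) :
  exists p s, [/\ s != 0, coprimep p s & f = ofp p / ofp s].
Proof.
have [p [s [s0 ->]]] := ratfun_frac f; set g := gcdp p s.
have g0 : g != 0 by rewrite gcdp_eq0 negb_and s0 orbT.
exists (p %/ g), (s %/ g); split.
- by rewrite divp_eq0 !negb_or s0 g0 /= -leqNgt leq_gcdpr.
- by apply: coprimep_div_gcd; rewrite s0 orbT.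
- have := divpK (dvdp_gcdl p s); have := divpK (dvdp_gcdr p s).
  rewrite -/g => {1}<- {1}<-.
  by rewrite !ofpolyM -mulf_div divff ?mulr1 // ofpoly_eq0.
Qed.

Lemma root_propagation (e : C) (y d : {poly C}) x : e != 0 ->
  (forall m : nat, (0 < m)%N -> e ^+ m != 1) -> d != 0 -> x != 0 ->
  (forall z, d.[z] = 0 -> y.[e * z] != 0 -> d.[e * z] = 0) ->
  d.[x] = 0 -> exists k, y.[e ^+ k.+1 * x] = 0.
Proof.
move=> e0 e_inf d0 x0 step dx.
have [k] := orbit_nonroot e0 e_inf x0 d0.
elim: k => [|k IH]; first by rewrite mul1r dx eqxx.
have [dk|/IH //] := eqVneq (d.[e ^+ k * x]) 0.
move=> dk1; exists k; apply/eqP; apply: contraNT dk1 => yk.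
by rewrite exprS -mulrA; apply/eqP/step; rewrite // mulrA -exprS.
Qed.

(* A nonzero pole of [f] propagates along its [q]-orbit in both directions until it
   meets a zero of [y], and the orbit contains at most one. A pole at 0 is excluded
   by the leading Laurent coefficient, as [a / b] is not a power of [q]. *)
Lemma qq_polynomial (y r : {poly C}) (f : K) (a b : C) : a != 0 -> b != 0 ->
  ~ in_qZ q (a / b) ->
  (forall x w (k : int), y.[x] = 0 -> y.[w] = 0 -> x = q ^ k * w -> k = 0) ->
  ofc a * f * qshift q (ofp y) - ofc b * qshift q f * ofp y = ofp r ->
  exists p, f = ofp p.
Proof.
move=> a0 b0 ab ygen; have [n [d [d0 nd ->]]] := ratfun_coprime f.
rewrite qshiftE // qshift_ofpoly // => e.
have {}e : a%:P * n * scalep q d * scalep q y - b%:P * scalep q n * d * y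
    = r * d * scalep q d.
  have D0 : ofp d != 0 by rewrite ofpoly_eq0.
  have S0 : ofp (scalep q d) != 0 by rewrite ofpoly_eq0 scalep_eq0.
  apply: (@ofpoly_inj R); rewrite [RHS]ofpolyM [ofp (r * d)]ofpolyM -e.
  rewrite -[RHS]mulrA clear_denominators //.
  by rewrite ofpolyB !ofpolyM.
have eh z : a * n.[z] * d.[q * z] * y.[q * z] - b * n.[q * z] * d.[z] * y.[z]
    = r.[z] * d.[z] * d.[q * z].
  by have := congr1 (fun p => p.[z]) e; rewrite !hornerE !horner_scalep.
have nroot z : d.[z] = 0 -> n.[z] != 0.
  move=> dz; apply: contraTneq nd => nz; rewrite coprimep_sym.
  apply/coprimepPn => //; exists ('X - z%:P).
  by rewrite dvdp_gcd !dvdp_XsubCl /root nz dz eqxx -size_poly_eq1 size_XsubC.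
have dx x : x != 0 -> d.[x] != 0.
  move=> x0; apply/eqP => dx.
  have qV0 : q^-1 != 0 by rewrite invr_eq0.
  have [|k yk] := root_propagation (y := y) q0 q_infinite d0 x0 _ dx.
    move=> z dz yz; have := eh z; rewrite dz !(mulr0, mul0r) subr0 => /eqP.
    by rewrite !mulf_eq0 (negPf a0) (negPf (nroot z dz)) (negPf yz) orbF => /eqP.
  have [|z dz yz|l yl] := root_propagation (y := y) qV0 _ d0 x0 _ dx.
  - by move=> m m0; rewrite exprVn invr_eq1 q_infinite.
  - have := eh (q^-1 * z); rewrite mulVKf // dz !(mulr0, mul0r) sub0r => /eqP.
    rewrite oppr_eq0 !mulf_eq0 (negPf b0) (negPf (nroot z dz)) (negPf yz) orbF.
    by move/eqP.
  have := ygen _ _ (k.+1%:Z + l.+1%:Z) yk yl; rewrite expfzDr // -!exprnP.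
  by rewrite exprVn !mulrA mulfK ?expf_neq0 // => /(_ erefl).
have d00 : d.[0] != 0.
  apply/eqP => d00.
  have y00 : y.[0] != 0.
    by apply/eqP => y00; have := ygen _ _ 1 y00 y00; rewrite mulr0 => /(_ erefl).
  have [m [s]] := multiplicity_XsubC d 0; rewrite d0 /= polyC0 subr0 => sr ed.
  have m0 : (0 < m)%N.
    rewrite lt0n; apply: contraNneq sr => m0.
    by rewrite m0 expr0 mulr1 in ed; rewrite -ed; apply/rootP.
  have eX : scalep q d = (q ^+ m)%:P * scalep q s * 'X^m.
    rewrite ed /scalep comp_polyM rmorphXn /= comp_polyX exprZn.
    by rewrite -[_ *: 'X^m]mul_polyC; ring.
  have Xm0 : 'X^m != 0 :> {poly C} by rewrite expf_neq0 ?polyX_eq0.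
  have : a%:P * n * ((q ^+ m)%:P * scalep q s) * scalep q y
         - b%:P * scalep q n * s * y = r * s * ((q ^+ m)%:P * scalep q s * 'X^m).
    apply: (mulIf Xm0); move: e; rewrite eX ed => e.
    by transitivity (r * (s * 'X^m) * ((q ^+ m)%:P * scalep q s * 'X^m));
       [rewrite -e|]; ring.
  move/(congr1 (fun p => p.[0])).
  rewrite !(hornerM, hornerD, hornerN, hornerC, hornerXn) !horner_scalep.
  rewrite !mulr0 expr0n eqn0Ngt m0 !mulr0 => /eqP.
  rewrite subr_eq0 => /eqP ee; apply: ab; exists (- m%:Z).
  have ne : n.[0] * s.[0] * y.[0] != 0.
    by rewrite !mulf_neq0 ?nroot.
  apply: (mulIf b0); apply: (mulIf ne); rewrite divfK //.
  rewrite -exprnN; apply: (mulfI (expf_neq0 m q0)).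
  transitivity (a * n.[0] * (q ^+ m * s.[0]) * y.[0]); first by ring.
  by rewrite ee; field; rewrite expf_neq0.
have /size_poly1P[c c0 ed] : size d == 1.
  apply/negPn/negP => /closed_rootP[z /rootP dz].
  by have [z0|/dx/eqP//] := eqVneq z 0; rewrite z0 in dz; rewrite dz eqxx in d00.
exists (c^-1 *: n); rewrite -mul_polyC ofpolyM ed -[ofp c%:P]/(ofc c).
by rewrite -[ofp _^-1%:P]/(ofc c^-1) fmorphV mulrC.
Qed.

End PolynomialSolutions.

(** * One-parameter subgroups, the Cartan matrix and the torus *)

Section Matrices.

Lemma exprZmx (S : comNzRingType) n c (M : 'M[S]_n) k :
  (c *: M) ^+ k = c ^+ k *: M ^+ k.
Proof.
elim: k => [|k IH]; first by rewrite !expr0 scale1r.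
by rewrite !exprS IH -[LHS]/((c *: M) *m _) -scalemxAl -scalemxAr scalerA.
Qed.

Lemma comm_expmx (S : comUnitRingType) n (M N : 'M[S]_n) :
  M *m N = N *m M -> M *m expmx N = expmx N *m M.
Proof.
move=> MN; rewrite /expmx mulmx_sumr mulmx_suml; apply: eq_bigr => k _.
rewrite -scalemxAr -scalemxAl; congr (_ *: _).
exact: (@commrX _ (M : 'M_n) N k MN).
Qed.

Lemma conj_expmx (S : comUnitRingType) n (h M N : 'M[S]_n) :
  h *m M = N *m h -> h *m expmx M = expmx N *m h.
Proof.
move=> hM; rewrite /expmx mulmx_sumr mulmx_suml; apply: eq_bigr => k _.
rewrite -scalemxAr -scalemxAl; congr (_ *: _).
elim: (nat_of_ord k) => [|j IH]; first by rewrite !expr0 [LHS]mulmx1 [RHS]mul1mx.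
by rewrite !exprS [LHS]mulmxA hM -mulmxA IH mulmxA.
Qed.

Lemma mat2M (S : comNzRingType) (a b c d a' b' c' d' : S) :
  mat2 a b c d *m mat2 a' b' c' d' =
  mat2 (a * a' + b * c') (a * b' + b * d') (c * a' + d * c') (c * b' + d * d').
Proof.
apply/matrixP => i j; rewrite !mxE big_ord_recl big_ord1 !mxE /=.
by case: (i == 0); case: (j == 0).
Qed.

Lemma mat2_id (S : comNzRingType) : mat2 1 0 0 1 = 1%:M :> 'M[S]_2.
Proof.
apply/matrixP => i j; rewrite !mxE -!val_eqE.
by case: i => [[|[|//]] ?]; case: j => [[|[|//]] ?].
Qed.

Lemma det_mat2 (S : comNzRingType) (a b c d : S) : \det (mat2 a b c d) = a * d - b * c.
Proof.
rewrite (expand_det_row _ 0) big_ord_recl big_ord1 /cofactor !det_mx11 !mxE /=.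
by rewrite /bump /= expr0 expr1; ring.
Qed.

End Matrices.

Section FirstOrder.
Variable R : realType.
Local Notation C := R[i].

Definition eq_order1 (p s : {poly C}) : Prop := p`_0 = s`_0 /\ p`_1 = s`_1.

Lemma coefM1 (p s : {poly C}) : (p * s)`_1 = p`_0 * s`_1 + p`_1 * s`_0.
Proof. by rewrite coefM big_ord_recl big_ord1. Qed.

Lemma coefM0 (p s : {poly C}) : (p * s)`_0 = p`_0 * s`_0.
Proof. by rewrite coefM big_ord1. Qed.

Lemma eq_order1_rel : ring_rel eq_order1.
Proof.
split=> //.
- by move=> p s [e0 e1]; split; rewrite !coefN ?e0 ?e1.
- by move=> p s p' s' [e0 e1] [e0' e1']; split; rewrite !coefD ?e0 ?e1 ?e0' ?e1'.
- move=> p s p' s' [e0 e1] [e0' e1'].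
  by split; rewrite ?coefM0 ?coefM1 ?e0 ?e1 ?e0' ?e1'.
Qed.

Definition exp_curve n (f : 'M[C]_n) : 'M[{poly C}]_n :=
  expmx ('X *: map_mx polyC f).

Lemma polyC_invfact k : (k`!%:R : {poly C})^-1 = (k`!%:R^-1)%:P.
Proof.
rewrite rmorphV ?rmorph_nat // unitfE pnatr_eq0 -lt0n; exact: fact_gt0.
Qed.

Lemma exp_curve_horner n (f : 'M[C]_n) y :
  map_mx (horner_eval y) (exp_curve f) = expmx (y *: f).
Proof.
apply/matrixP => i j; rewrite mxE.
have HE := morph_rel (horner_eval y).
apply: (rel_expmx HE) => [k|k l].
  by rewrite polyC_invfact /= /horner_eval hornerC.
by rewrite !mxE /= /horner_eval hornerM hornerX hornerC.
Qed.

Lemma exp_curve_order1 n (f : 'M[C]_n) :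
  mx_rel eq_order1 (exp_curve f) (tangent_point f).
Proof.
case: n f => [|n] f; first by move=> [].
move=> i j; rewrite /exp_curve /expmx !big_ord_recl /=.
rewrite -[bump 0 0]/1%N -[1`!]/1%N -[0`!]/1%N expr0 expr1 invr1 !scale1r.
rewrite addrA; set X := _ + 'X *: _; rewrite mxE.
have low : forall m, m = \sum_(i0 < n)
   ((bump 0 (bump 0 i0))`!%:R^-1 : {poly C}) *: ('X *: map_mx polyC f) ^+ bump 0 (bump 0 i0) ->
   (m i j)`_0 = 0 /\ (m i j)`_1 = 0.
  move=> m ->; rewrite summxE !coef_sum; split; apply: big1 => k _.
    by rewrite mxE exprZmx mxE exprS mulrCA -mulrA coefXM.
  by rewrite mxE exprZmx mxE !exprS mulrCA -!mulrA coefXM /= coefXM.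
by have [e0 e1] := low _ erefl; split; rewrite coefD ?e0 ?e1 addr0.
Qed.

Lemma expmx_zero n (f : 'M[C]_n) : expmx (0 *: f) = 1%:M.
Proof.
rewrite /expmx big_ord_recl /= big1 => [|k _].
  by rewrite fact0 invr1 scale1r expr0 addr0.
by rewrite exprZmx exprS mul0r !(scale0r, scaler0).
Qed.

Lemma mxapp_exp_curve1 n m (rho : 'M[{mpoly C[n * n]}]_m) (f : 'M[C]_n) :
  map_mx (fun p : {poly C} => p`_1) (mxapp polyC rho (exp_curve f)) = mxdiff rho f.
Proof.
apply/matrixP => i j; rewrite [RHS]mxE mxE.
by have [_ ->] := rel_mxapp (iota := polyC) (kappa := polyC) rho eq_order1_rel
  (fun c => conj erefl erefl) (exp_curve_order1 f) i j.
Qed.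

Lemma mxapp_exp_curve_horner n m (rho : 'M[{mpoly C[n * n]}]_m) (f : 'M[C]_n) y :
  map_mx (horner_eval y) (mxapp polyC rho (exp_curve f)) = mxapp id rho (expmx (y *: f)).
Proof.
rewrite -exp_curve_horner; apply: mxapp_map => c.
by rewrite /= /horner_eval hornerC.
Qed.

Lemma poly_eq_all (p s : {poly C}) : (forall z, p.[z] = s.[z]) -> p = s.
Proof. by move=> e; apply: (@poly_eq_off _ 1); rewrite ?oner_neq0. Qed.

End FirstOrder.

Section Structure.
Variables (R : realType) (n r : nat) (D : simple_group R n r).
Local Notation C := R[i].
Local Notation G := (sg_G D).
Local Notation Bp := (sg_Bp D).
Local Notation Bm := (sg_Bm D).
Local Notation H := (sg_H D).
Local Notation a := (sg_a D).
Local Notation sl2 i := (mxapp id (sg_sl2 D i)).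

Definition cor i (t : C) : 'M_n := sl2 i (mat2 t 0 0 t^-1).
Definition xe i (x : C) : 'M_n := expmx (x *: sg_e D i).
Definition xf i (x : C) : 'M_n := expmx (x *: sg_f D i).

Lemma G_alg : alg_group G. Proof. by case: (sg_simple D). Qed.
Lemma Bp_alg : alg_group Bp. Proof. by case: (sg_Bp_borel D) => [[]]. Qed.
Lemma Bm_alg : alg_group Bm. Proof. by case: (sg_Bm_borel D) => [[]]. Qed.
Lemma Bp_G x : Bp x -> G x. Proof. by case: (sg_Bp_borel D) => [[_ _ _ s] _]; exact: s. Qed.
Lemma Bm_G x : Bm x -> G x. Proof. by case: (sg_Bm_borel D) => [[_ _ _ s] _]; exact: s. Qed.
Lemma HE x : H x <-> Bp x /\ Bm x. Proof. by rewrite sg_H_def. Qed.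
Lemma H_G x : H x -> G x. Proof. by case/HE => /Bp_G. Qed.

Lemma alg_det m (X : set 'M[C]_m) x : alg_group X -> X x -> \det x = 1.
Proof. by case=> _ _; apply. Qed.

Lemma alg_unit m (X : set 'M[C]_m) x : alg_group X -> X x -> x \in unitmx.
Proof. by move=> aX Xx; rewrite unitmxE (alg_det aX Xx) unitr1. Qed.

Lemma G_unit x : G x -> x \in unitmx. Proof. exact: alg_unit G_alg. Qed.

Lemma SL2_mat2 (x y z w : C) : x * w - y * z = 1 -> SL2 (mat2 x y z w).
Proof. by move=> e; rewrite /SL2 /= det_mat2. Qed.

Lemma sl2_G i x : SL2 x -> G (sl2 i x).
Proof. by case: (sg_sl2_morph D i) => s _; exact: s. Qed.

Lemma sl2_M i x y : SL2 x -> SL2 y -> sl2 i (x *m y) = sl2 i x *m sl2 i y.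
Proof. by case: (sg_sl2_morph D i) => _ m; exact: m. Qed.

Lemma mx_idem_unit m (x : 'M[C]_m) : x \in unitmx -> x *m x = x -> x = 1%:M.
Proof. by move=> ux e; rewrite -(mulKmx ux x) e mulVmx. Qed.

Lemma sl2_1 i : sl2 i 1%:M = 1%:M.
Proof.
have S1 : SL2 (1%:M : 'M[C]_2) by rewrite /SL2 /= det1.
apply: mx_idem_unit; first exact/G_unit/sl2_G.
by rewrite -(sl2_M i S1 S1) mulmx1.
Qed.

Lemma diag_det (t : C) : t != 0 -> t * t^-1 - 0 * 0 = 1.
Proof. by move=> t0; rewrite divff // mulr0 subr0. Qed.

Lemma low_det (u : C) : 1 * 1 - 0 * u = 1.
Proof. by ring. Qed.

Lemma up_det (u : C) : 1 * 1 - u * 0 = 1.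
Proof. by ring. Qed.

Lemma sl2_eq i (x y z w x' y' z' w' : C) :
  x = x' -> y = y' -> z = z' -> w = w' ->
  sl2 i (mat2 x y z w) = sl2 i (mat2 x' y' z' w').
Proof. by move=> -> -> -> ->. Qed.

Lemma sl2_mat2M i (x y z w x' y' z' w' : C) :
  x * w - y * z = 1 -> x' * w' - y' * z' = 1 ->
  sl2 i (mat2 x y z w) *m sl2 i (mat2 x' y' z' w') =
  sl2 i (mat2 (x * x' + y * z') (x * y' + y * w') (z * x' + w * z') (z * y' + w * w')).
Proof. by move=> /SL2_mat2 s /SL2_mat2 s'; rewrite -(sl2_M i s s') mat2M. Qed.

Lemma cor_Bp i t : t != 0 -> Bp (cor i t). Proof. exact: sg_sl2_Bp. Qed.
Lemma cor_Bm i t : t != 0 -> Bm (cor i t). Proof. exact: sg_sl2_Bm. Qed.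
Lemma cor_H i t : t != 0 -> H (cor i t).
Proof. by move=> t0; apply/HE; split; [exact: cor_Bp|exact: cor_Bm]. Qed.

Lemma xe_mat2 i x : xe i x = sl2 i (mat2 1 x 0 1). Proof. by rewrite sg_sl2_e. Qed.
Lemma xf_mat2 i x : xf i x = sl2 i (mat2 1 0 x 1). Proof. by rewrite sg_sl2_f. Qed.

Lemma xe_Bp i x : Bp (xe i x).
Proof. by rewrite xe_mat2 -[X in mat2 _ _ _ X]invr1; apply: sg_sl2_Bp; rewrite oner_neq0. Qed.

Lemma xf_Bm i x : Bm (xf i x).
Proof. by rewrite xf_mat2 -[X in mat2 _ _ _ X]invr1; apply: sg_sl2_Bm; rewrite oner_neq0. Qed.

Lemma xe_G i x : G (xe i x). Proof. exact/Bp_G/xe_Bp. Qed.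
Lemma xf_G i x : G (xf i x). Proof. exact/Bm_G/xf_Bm. Qed.

Lemma xfD i x y : xf i x *m xf i y = xf i (x + y).
Proof.
by rewrite !xf_mat2 (sl2_mat2M i (low_det _) (low_det _)); apply: sl2_eq; ring.
Qed.

Lemma xf0 i : xf i 0 = 1%:M. Proof. exact: expmx_zero. Qed.

Lemma xfN i x : invmx (xf i x) = xf i (- x).
Proof. by rewrite -[RHS](mulKmx (G_unit (xf_G i x))) xfD subrr xf0 mulmx1. Qed.

Lemma H_f h i : H h -> h *m sg_f D i = ((sg_alpha D i h)^-1 *: sg_f D i) *m h.
Proof.
move=> Hh; have [_ /(_ h Hh) <-] := sg_f_weight D i.
by rewrite mulmxKV; [|apply/G_unit/H_G].
Qed.

Lemma H_xf h i x : H h -> h *m xf i x = xf i ((sg_alpha D i h)^-1 * x) *m h.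
Proof.
move=> Hh; apply: conj_expmx.
rewrite -scalemxAr (H_f _ Hh) -!scalemxAl scalerA.
by rewrite mulrC.
Qed.

Lemma cor_xf i j t x : t != 0 ->
  cor j t *m xf i x = xf i (t ^ (- a j i) * x) *m cor j t.
Proof.
by move=> t0; rewrite (H_xf _ _ (cor_H j t0)) (sg_cartan _ _ _ t0) invr_expz.
Qed.

Lemma ef_comm i j : i != j -> sg_e D i *m sg_f D j = sg_f D j *m sg_e D i.
Proof. by move=> ij; apply/eqP; rewrite -subr_eq0; apply/eqP; exact: (sg_ef D ij). Qed.

Lemma xe_f i j x : i != j -> xe i x *m sg_f D j = sg_f D j *m xe i x.
Proof.
move=> ij; apply/esym/comm_expmx.
by rewrite -scalemxAr -scalemxAl (ef_comm ij).
Qed.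

Lemma xe_xf i j x y : i != j -> xe i x *m xf j y = xf j y *m xe i x.
Proof.
by move=> ij; apply: comm_expmx; rewrite -scalemxAr -scalemxAl (xe_f _ ij).
Qed.

Lemma expmx_inj m (f g : 'M[C]_m) :
  (forall x, expmx (x *: f) = expmx (x *: g)) -> f = g.
Proof.
move=> e; have ec : exp_curve f = exp_curve g.
  apply/matrixP => i j; apply: poly_eq_all => x.
  have E (u : 'M_m) : (exp_curve u i j).[x] = expmx (x *: u) i j.
    by rewrite -exp_curve_horner mxE.
  by rewrite !E e.
apply/matrixP => i j.
have [_ ef] := exp_curve_order1 f i j; have [_ eg] := exp_curve_order1 g i j.
move: ef; rewrite ec eg !mxE !coefD !coefXM !coefC /=.
by move/addrI.
Qed.

Lemma two_infinite m : (0 < m)%N -> (2 : C) ^+ m != 1.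
Proof.
move=> m0; rewrite -natrX -[1]/(1%:R) eqr_nat.
by rewrite -[X in _ != X](expn0 2) eqn_exp2l // -lt0n.
Qed.

Lemma two_expz_inj (k l : int) : (2 : C) ^ k = 2 ^ l -> k = l.
Proof. by apply: q_expz_inj; [rewrite pnatr_eq0|exact: two_infinite]. Qed.

Lemma cartan_diag i : a i i = 2.
Proof.
pose t : C := 2; have t0 : t != 0 by rewrite pnatr_eq0.
have e x : xf i (t ^ (- a i i) * x) = xf i (t ^ (- 2%:Z) * x).
  apply: (can_inj (mulmxK (G_unit (H_G (cor_H i t0))))).
  apply: (etrans (esym (cor_xf i i x t0))); rewrite !xf_mat2 /cor (sl2_mat2M i (diag_det t0) (low_det _)).
  rewrite (sl2_mat2M i (low_det _) (diag_det t0)).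
  have -> : t ^ (- 2%:Z) = t ^- 2 by [].
  by apply: sl2_eq; field.
have /eqP : t ^ (- a i i) *: sg_f D i = t ^ (- 2%:Z) *: sg_f D i.
  by apply: expmx_inj => x; have := e x; rewrite /xf ![_ * x]mulrC -!scalerA.
rewrite -subr_eq0 -scalerBl scaler_eq0 subr_eq0.
have [/negPf-> _] := sg_f_weight D i; rewrite orbF => /eqP /two_expz_inj.
by move/oppr_inj.
Qed.

(* A function polynomial both in [s] and, after division by [s ^- k], in [s^-1]
   has no constant term in the second expression. *)
Lemma no_negative_weight (k : nat) (l p : {poly C}) : (0 < k)%N ->
  (forall s, s != 0 -> l.[s] = s ^- k * p.[s^-1]) -> p.[0] = 0.
Proof.
move=> k0 e; set N := size p.
have ep : \sum_(j < N) p`_j *: 'X^(N - j) = 'X^(N + k) * l.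
  apply: (@poly_eq_off _ 'X); first by rewrite polyX_eq0.
  move=> s; rewrite hornerX => s0; rewrite hornerM hornerXn e // horner_sum.
  rewrite exprD !mulrA mulfK ?expf_neq0 // horner_coef mulr_sumr.
  apply: eq_bigr => j _; rewrite hornerZ hornerXn mulrCA; congr (_ * _).
  by rewrite exprVn expfB.
rewrite horner_coef0; move/(congr1 (fun u : {poly C} => u`_N)): ep.
rewrite coefXnM -[X in (X < _)%N]addn0 ltn_add2l k0.
have [p0|] := eqVneq p 0; first by rewrite p0 coef0.
rewrite -size_poly_gt0 -/N => N0; rewrite coef_sum -(prednK N0) big_ord_recl.
rewrite subn0 coefZ coefXn eqxx mulr1 big1 ?addr0 // => j _.
rewrite coefZ coefXn; case: eqP => [/eqP|]; rewrite ?mulr0 //.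
by rewrite lift0 subSS => e1; have := leq_subr j N.-1; rewrite -(eqP e1) ltnn.
Qed.

End Structure.

Lemma unitmx_injr (F : fieldType) n m (M : 'M[F]_n) (X Y : 'M_(m, n)) :
  M \in unitmx -> X *m M = Y *m M -> X = Y.
Proof. by move=> uM /(congr1 (fun Z => Z *m invmx M)); rewrite !mulmxK. Qed.

Lemma conj_factorization (S : comNzRingType) n (X Y T E f : 'M[S]_n) c :
  Y *m X = 1%:M -> E *m f = f *m E -> T *m f = (c *: f) *m T ->
  X *m T *m E *m f = c *: (X *m f *m Y) *m (X *m T *m E).
Proof.
move=> YX Ef Tf; rewrite -scalemxAl -!mulmxA (mulmxA Y) YX mul1mx Ef.
by rewrite (mulmxA T) Tf -!scalemxAl -scalemxAr !mulmxA.
Qed.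

Section CartanAndTorus.
Variables (R : realType) (n r : nat) (D : simple_group R n r).
Local Notation C := R[i].
Local Notation H := (sg_H D).
Local Notation a := (sg_a D).
Local Notation sl2 i := (mxapp id (sg_sl2 D i)).

Lemma sl2_lower_upper i (s b : C) : s != 0 -> b != 0 ->
  sl2 i (mat2 s (- b) b^-1 0) =
  xf D i (b^-1 * s^-1) *m cor D i s *m xe D i (- (b * s^-1)).
Proof.
move=> s0 b0; rewrite xf_mat2 xe_mat2 /cor.
rewrite (sl2_mat2M D i (low_det _) (diag_det s0)) sl2_mat2M; last exact: up_det.
  by apply: sl2_eq; field; rewrite ?s0 ?b0.
by field; rewrite ?s0 ?b0.
Qed.

Lemma sl2_path_inv i (s b : C) : b != 0 ->
  sl2 i (mat2 0 b (- b^-1) s) *m sl2 i (mat2 s (- b) b^-1 0) = 1%:M.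
Proof.
move=> b0; rewrite sl2_mat2M; [|by field..].
rewrite -[RHS](sl2_1 D i) -mat2_id.
by apply: sl2_eq; field.
Qed.

Lemma sl2_path_unit i (s b : C) : b != 0 -> sl2 i (mat2 s (- b) b^-1 0) \in unitmx.
Proof. by move=> b0; apply/(G_unit (D := D))/sl2_G/SL2_mat2; field. Qed.

Lemma map_mat2_horner (s x y z w : {poly C}) u :
  map_mx (horner_eval u) (mat2 x y z w) = mat2 x.[u] y.[u] z.[u] w.[u].
Proof.
apply/matrixP => i j; rewrite !mxE /horner_eval.
by case: (i == 0); case: (j == 0).
Qed.

Lemma mxapp_horner m p (f : 'M[{mpoly C[m * m]}]_p) (g : 'M[{poly C}]_m) u :
  map_mx (horner_eval u) (mxapp polyC f g) = mxapp id f (map_mx (horner_eval u) g).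
Proof. by apply: mxapp_map => c; rewrite /= /horner_eval hornerC. Qed.

Lemma sl2_horner i (x y z w : {poly C}) u :
  map_mx (horner_eval u) (mxapp polyC (sg_sl2 D i) (mat2 x y z w)) =
  sl2 i (mat2 x.[u] y.[u] z.[u] w.[u]).
Proof. by rewrite mxapp_horner map_mat2_horner. Qed.

(* [f_j] is a highest weight vector of weight [- a i j] for the [i]-th SL(2). On
   the path [[[u, -1], [1, 0]]] its orbit is polynomial in [u], and for [u != 0] it
   is [u ^ (- a i j)] times a polynomial in [u^-1] with constant term [f_j]. *)
Lemma cartan_nonpos i j : i != j -> a i j <= 0.
Proof.
move=> ij; rewrite leNgt; apply/negP => a0.
have aE : a i j = `|a i j|%:Z by rewrite gtz0_abs.
set k := `|a i j|%N in aE; have k0 : (0 < k)%N by rewrite -ltz_nat -aE.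
pose L := mxapp polyC (sg_sl2 D i) (mat2 'X (- 1) 1 0) *m map_mx polyC (sg_f D j)
   *m mxapp polyC (sg_sl2 D i) (mat2 0 1 (- 1) 'X).
pose P := exp_curve (sg_f D i) *m map_mx polyC (sg_f D j) *m exp_curve (- sg_f D i).
have horner_const u : map_mx (horner_eval u) (map_mx polyC (sg_f D j)) = sg_f D j.
  by apply/matrixP => c d; rewrite !mxE /horner_eval hornerC.
have PE u : map_mx (horner_eval u) P = xf D i u *m sg_f D j *m xf D i (- u).
  rewrite !map_mxM horner_const !exp_curve_horner /xf.
  by rewrite scalerN -scaleNr.
have LE u : map_mx (horner_eval u) L = sl2 i (mat2 u (- 1) 1^-1 0) *m sg_f D j
   *m sl2 i (mat2 0 1 (- 1^-1) u).
  rewrite !map_mxM horner_const !sl2_horner.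
  have one_u : (1 : {poly C}).[u] = 1 by rewrite -polyC1 hornerC.
  rewrite (sl2_eq D i (x := 'X.[u]) (hornerX u) (hornerN 1 u) one_u (horner0 u)).
  rewrite (sl2_eq D i (x := 0.[u]) (horner0 u) one_u (hornerN 1 u) (hornerX u)).
  by rewrite one_u invr1.
have LP u : u != 0 -> map_mx (horner_eval u) L =
    u ^- k *: map_mx (horner_eval u^-1) P.
  move=> u0; have one0 : (1 : C) != 0 by rewrite oner_neq0.
  apply: (unitmx_injr (sl2_path_unit i u one0)).
  rewrite LE -[LHS]mulmxA (sl2_path_inv i u one0) mulmx1 PE.
  rewrite (sl2_lower_upper i u0 one0) invr1 !mul1r.
  apply: conj_factorization; last 2 first.
  - exact: (xe_f D _ ij).
  - by rewrite (H_f _ (cor_H D i u0)) (sg_cartan D _ _ u0) aE.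
  - by rewrite xfD addNr xf0.
have [/eqP f0 _] := sg_f_weight D j; apply: f0.
apply/matrixP => c d; rewrite [RHS]mxE; have := @no_negative_weight _ k (L c d) (P c d) k0.
have hP (M : 'M[{poly C}]_n) u : (M c d).[u] = map_mx (horner_eval u) M c d.
  by rewrite mxE.
rewrite (hP P 0) PE oppr0 xf0 mul1mx mulmx1; apply=> s s0.
by rewrite !hP (LP s s0) [LHS]mxE.
Qed.

Inductive coroot_gen : 'M[C]_n -> Prop :=
| coroot_gen1 : coroot_gen 1%:M
| coroot_genM i t x : t != 0 -> coroot_gen x -> coroot_gen (cor D i t *m x).

Lemma coroot_gen_mul x y : coroot_gen x -> coroot_gen y -> coroot_gen (x *m y).
Proof.
move=> gx gy; elim: gx => [|i t z t0 _ IH]; first by rewrite mul1mx.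
by rewrite -mulmxA; exact: coroot_genM.
Qed.

Definition diag_pm m (u : 'rV[C]_m) : 'M[C]_(m + m) :=
  diag_mx (row_mx u (\row_k (u 0 k)^-1)).

Lemma diag_pmM m (u v : 'rV[C]_m) :
  diag_pm u *m diag_pm v = diag_pm (\row_k (u 0 k * v 0 k)).
Proof.
rewrite /diag_pm mulmx_diag; congr diag_mx; apply/rowP => k; rewrite !mxE.
by case: splitP => l _; rewrite !mxE // invfM.
Qed.

Lemma diag_pm1 m : diag_pm (\row_k 1) = 1%:M :> 'M[C]_(m + m).
Proof.
rewrite -diag_const_mx; congr diag_mx; apply/rowP => k; rewrite !mxE.
by case: splitP => l _; rewrite !mxE // invr1.
Qed.

Definition coord_torus m (k : 'I_m) : 'M[{mpoly C[(1 + 1) * (1 + 1)]}]_(m + m) :=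
  diag_mx (row_mx
    (\row_j if j == k then 'X_(mxvec_index (lshift 1 ord0) (lshift 1 ord0)) else 1)
    (\row_j if j == k then 'X_(mxvec_index (rshift 1 ord0) (rshift 1 ord0)) else 1)).

Lemma mxapp_coord_torus m (k : 'I_m) (u : 'rV[C]_1) :
  mxapp id (coord_torus k) (diag_pm u) = diag_pm (\row_j if j == k then u 0 0 else 1).
Proof.
pose ev : {rmorphism {mpoly C[(1 + 1) * (1 + 1)]} -> C} :=
  mmap (idfun : C -> C) (fun k => mxvec (diag_pm u) 0 k).
have -> : mxapp id (coord_torus k) (diag_pm u) = map_mx ev (coord_torus k) by [].
have evX i j : ev 'X_(mxvec_index i j) = diag_pm u i j.
  by rewrite /ev /= mmapX mmap1U mxvecE.
have ul : diag_pm u (lshift 1 ord0) (lshift 1 ord0) = u 0 0.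
  by rewrite mxE row_mxEl eqxx mulr1n.
have ur : diag_pm u (rshift 1 ord0) (rshift 1 ord0) = (u 0 0)^-1.
  by rewrite mxE row_mxEr eqxx mulr1n mxE.
rewrite /coord_torus map_diag_mx map_row_mx /diag_pm.
apply: (congr1 (fun v => diag_mx v)); apply: (f_equal2 (fun v w => row_mx v w)).
  by apply/rowP => j; rewrite !mxE; case: (j == k); rewrite ?evX ?ul ?rmorph1.
apply/rowP => j; rewrite !mxE; case: (j == k); rewrite ?evX ?ur ?rmorph1 //.
by rewrite invr1.
Qed.

Lemma std_torusP m (u : 'rV[C]_m) : (forall k, u 0 k != 0) -> std_torus (diag_pm u).
Proof. by move=> u0; exists u. Qed.

Lemma mat2_diag_pm (t : C) : mat2 t 0 0 t^-1 = diag_pm (\row_(k < 1) t).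
Proof.
have split2 (P : 'I_(1 + 1) -> Prop) : P (lshift 1 ord0) -> P (rshift 1 ord0) ->
    forall i, P i.
  by move=> Pl Pr i; case: (split_ordP i) => k ->; rewrite ord1.
rewrite /diag_pm diag_mx_row; apply/matrixP.
apply: (split2); apply: (split2).
- by apply: etrans (esym (block_mxEul _ _ _ _ _ _)); rewrite !mxE.
- by apply: etrans (esym (block_mxEur _ _ _ _ _ _)); rewrite !mxE.
- by apply: etrans (esym (block_mxEdl _ _ _ _ _ _)); rewrite !mxE.
- by apply: etrans (esym (block_mxEdr _ _ _ _ _ _)); rewrite !mxE.
Qed.

Lemma coroot_gen_big (F : 'I_r -> 'M[C]_n) :
  (forall i, coroot_gen (F i)) -> coroot_gen (\big[mulmx/1%:M]_(i < r) F i).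
Proof. by move=> gF; apply: big_ind => *; [exact: coroot_gen1|exact: coroot_gen_mul|]. Qed.

(* A torus is generated by its coordinate cocharacters, which are products of
   coroots because the group is simply connected. *)
Lemma H_gen h : H h -> coroot_gen h.
Proof.
move=> Hh; have [[_ [f [g [fm gm _ fg]]]] _ _] := sg_H_max D.
have [fH fM] := fm.
have f1 : mxapp id f 1%:M = 1%:M.
  have T1 : std_torus (1%:M : 'M[C]_(r + r)).
    by rewrite -diag_pm1; apply: std_torusP => k; rewrite mxE oner_neq0.
  apply: mx_idem_unit; first exact: (G_unit (H_G (fH _ T1))).
  by rewrite -(fM _ _ T1 T1) mulmx1.
have gen1 (k : 'I_r) (s : C) : s != 0 ->
    coroot_gen (mxapp id f (diag_pm (\row_j if j == k then s else 1))).
  move=> s0; pose c := map_mx (precomp (coord_torus k)) f.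
  have cE x : mxapp id c x = mxapp id f (mxapp id (coord_torus k) x).
    apply/matrixP => i j; rewrite !mxE.
    exact: (mxeval_precomp (idfun : {rmorphism C -> C})).
  have emb0 (u : 'rV[C]_1) : (forall k, u 0 k != 0) ->
      std_torus (diag_pm (\row_j if j == k then u 0 0 else 1)).
    move=> u0; apply: std_torusP => j; rewrite mxE.
    by case: (j == k); [exact: u0|exact: oner_neq0].
  have cm : alg_morphism (@std_torus R 1) H c.
    split=> [_ [u [u0 ->]]|_ _ [u [u0 ->]] [v [v0 ->]]].
      rewrite cE -/(diag_pm u) mxapp_coord_torus; apply: fH; exact: emb0.
    rewrite !cE -/(diag_pm u) -/(diag_pm v) diag_pmM !mxapp_coord_torus.
    rewrite -(fM _ _ (emb0 _ u0) (emb0 _ v0)) diag_pmM.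
    apply: (congr1 (fun w => mxapp id f (diag_pm w))).
    by apply/rowP => j; rewrite !mxE; case: (j == k); rewrite ?mulr1.
  have [kk [/(_ s s0) ck _]] := sg_sc cm.
  have <- : mxapp id c (mat2 s 0 0 s^-1) =
      mxapp id f (diag_pm (\row_j if j == k then s else 1)).
    rewrite cE mat2_diag_pm mxapp_coord_torus.
    apply: (congr1 (fun w => mxapp id f (diag_pm w))).
    by apply/rowP => j; rewrite !mxE.
  rewrite ck; apply: coroot_gen_big => i.
  rewrite -invr_expz -/(cor D i (s ^ kk i)) -[cor _ _ _]mulmx1.
  by apply: coroot_genM; [exact: expfz_neq0|exact: coroot_gen1].
have genl (l : seq 'I_r) (u : 'rV[C]_r) : (forall k, u 0 k != 0) ->
    (forall k, k \notin l -> u 0 k = 1) -> coroot_gen (mxapp id f (diag_pm u)).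
  elim: l u => [|k l IH] u u0 u1.
    have -> : u = \row_k 1 by apply/rowP => k; rewrite mxE u1.
    by rewrite diag_pm1 f1; exact: coroot_gen1.
  pose e : 'rV[C]_r := \row_j if j == k then u 0 k else 1.
  pose v : 'rV[C]_r := \row_j if j == k then 1 else u 0 j.
  have e0 j : e 0 j != 0 by rewrite mxE; case: (j == k); [exact: u0|exact: oner_neq0].
  have v0 j : v 0 j != 0 by rewrite mxE; case: (j == k); [exact: oner_neq0|exact: u0].
  have -> : u = \row_j (e 0 j * v 0 j).
    apply/rowP => j; rewrite !mxE; case: (eqVneq j k) => [->|_].
      by rewrite mulr1.
    by rewrite mul1r.
  rewrite -diag_pmM (fM _ _ (std_torusP e0) (std_torusP v0)).
  apply: coroot_gen_mul; first exact: gen1.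
  apply: IH => // j jl; rewrite mxE; case: (eqVneq j k) => // jk.
  by rewrite u1 // inE negb_or jk.
rewrite -(fg h Hh); have [u [u0 ->]] := gm.1 h Hh.
apply: (genl (enum 'I_r)) => // k; by rewrite mem_enum.
Qed.

End CartanAndTorus.

(** * The action on the subspaces W_i *)

Section FirstOrderIdentities.
Variable R : realType.
Local Notation C := R[i].

Lemma coef1_linear_change (p s : {poly C}) (b c : C) :
  (forall y, p.[y] = b * s.[c * y]) -> p`_1 = b * c * s`_1.
Proof.
move=> e; have -> : p = b%:P * \poly_(k < size s) (s`_k * c ^+ k).
  apply: poly_eq_all => y; rewrite hornerM hornerC e horner_coef horner_poly.
  by congr (b * _); apply: eq_bigr => k _; rewrite exprMn mulrA.
rewrite coefCM coef_poly expr1 -mulrA; congr (b * _); rewrite mulrC.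
by case: ltnP => // h; rewrite nth_default // mulr0.
Qed.

Lemma coef1_moebius (p s : {poly C}) (x : C) :
  (forall y, 1 + x * y != 0 -> p.[y] = (1 + x * y) * s.[y / (1 + x * y)]) ->
  p`_1 = s`_1 + x * s`_0.
Proof.
move=> e; pose u : {poly C} := 1 + x%:P * 'X.
have uy y : u.[y] = 1 + x * y.
  by rewrite hornerD hornerM hornerX -polyC1 !hornerC.
have [N [m [eN sN]]] : exists N m, N = m.+2 /\ (size s <= N)%N.
  by exists (size s).+2, (size s); rewrite -addn2 leq_addr.
have u0 : u`_0 = 1 by rewrite -horner_coef0 uy mulr0 addr0.
have u1 : u`_1 = x.
  by rewrite /u coefD coef1 coefCM coefX add0r mulr1.
have uk k : (u ^+ k)`_0 = 1 /\ (u ^+ k)`_1 = k%:R * x.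
  elim: k => [|k [IH0 IH1]]; first by rewrite expr0 !coef1 mul0r.
  rewrite exprS coefM0 coefM1 u0 u1 IH0 IH1 mulr1; split=> //.
  by rewrite mul1r mulr1 -natr1 mulrDl mul1r.
have ep : u ^+ N * p = u * \sum_(k < N) s`_k *: ('X^k * u ^+ (N - k)).
  apply: (@poly_eq_off _ u).
    by apply: contra_eq_neq u0 => ->; rewrite coef0 eq_sym oner_neq0.
  move=> y uy0; have h := uy0; rewrite uy in h.
  rewrite (hornerM (u ^+ N)) (hornerM u) (horner_exp u) (e y h) -uy mulrCA; congr (_ * _).
  rewrite horner_sum [s.[_]](@horner_coef_wide _ N) // mulr_sumr.
  apply: eq_bigr => k _.
  rewrite hornerZ hornerM hornerXn horner_exp mulrCA; congr (_ * _).
  by rewrite expr_div_n mulrCA expfB.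
have [uN0 uN1] := uk N.
have := congr1 (fun v : {poly C} => v`_1) ep.
rewrite !coefM1 uN0 uN1 u0 u1 mul1r !coef_sum.
have p0 : p`_0 = s`_0.
  have := e 0; rewrite mulr0 addr0 mul1r mul0r !horner_coef0; apply.
  exact: oner_neq0.
have -> : \sum_(k < N) (s`_k *: ('X^k * u ^+ (N - k)))`_0 = s`_0.
  rewrite eN big_ord_recl big1 => [|k _].
    by rewrite addr0 coefZ expr0 mul1r subn0 (uk _).1 mulr1.
  by rewrite coefZ coefM0 coefXn mul0r mulr0.
have -> : \sum_(k < N) (s`_k *: ('X^k * u ^+ (N - k)))`_1 = s`_0 * (N%:R * x) + s`_1.
  rewrite eN !big_ord_recl big1 => [|k _].
    rewrite addr0 !coefZ expr0 mul1r subn0 (uk _).2 coefM1 !coefXn (uk _).1.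
    by rewrite mul0r add0r mul1r mulr1.
  by rewrite coefZ coefM1 !coefXn !mul0r addr0 mulr0.
rewrite p0 => h; apply: (addrI (N%:R * x * s`_0)).
by rewrite [LHS]addrC h; ring.
Qed.

End FirstOrderIdentities.

Lemma horner_entry (S : comNzRingType) m n (M : 'M[{poly S}]_(m, n)) u i j :
  (M i j).[u] = map_mx (horner_eval u) M i j.
Proof. by rewrite mxE. Qed.

Lemma mulmx_eigenvector (S : comNzRingType) m (X Y Z : 'M[S]_m) (v : 'cV_m) c :
  Z *m v = v -> Y *m v = c *: v -> X *m Y *m Z *m v = c *: (X *m v).
Proof. by move=> Zv Yv; rewrite -mulmxA Zv -mulmxA Yv -scalemxAr. Qed.

Lemma triangular_mul (S : comNzRingType) m (A B : 'M[S]_m) (v f : 'cV_m) x w y x' w' y' :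
  A *m v = x *: v -> A *m f = w *: v + y *: f ->
  B *m v = x' *: v -> B *m f = w' *: v + y' *: f ->
  (A *m B) *m v = (x * x') *: v /\
  (A *m B) *m f = (x * w' + w * y') *: v + (y * y') *: f.
Proof.
move=> Av Af Bv Bf; rewrite -!mulmxA Bv Bf mulmxDr -!scalemxAr Av Af; split.
  by rewrite scalerA mulrC.
by rewrite scalerDr !scalerA addrA -scalerDl [w' * x]mulrC [y' * w]mulrC [y' * y]mulrC.
Qed.

Lemma triangular1 (S : comNzRingType) m (v f : 'cV[S]_m) :
  1%:M *m v = 1 *: v /\ 1%:M *m f = 0 *: v + 1 *: f.
Proof. by rewrite !mul1mx !scale1r scale0r add0r. Qed.

Lemma dual_coords (S : comNzRingType) m (L : 'M[S]_(2, m)) (v f : 'cV_m) b c :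
  L *m v = delta_mx 0 0 -> L *m f = delta_mx 1 0 ->
  (L *m (b *: v + c *: f)) 0 0 = b /\ (L *m (b *: v + c *: f)) 1 0 = c.
Proof.
move=> Lv Lf; rewrite mulmxDr -!scalemxAr Lv Lf !mxE /=.
by rewrite !mulr1 !mulr0 addr0 add0r.
Qed.

Lemma dual_basis_indep (S : comNzRingType) m (L : 'M[S]_(2, m)) (v f : 'cV_m) b c :
  L *m v = delta_mx 0 0 -> L *m f = delta_mx 1 0 ->
  b *: v + c *: f = 0 -> b = 0 /\ c = 0.
Proof.
move=> Lv Lf e; have := dual_coords b c Lv Lf.
by rewrite e mulmx0 !mxE => -[<- <-].
Qed.

Section FundamentalAction.
Variables (R : realType) (n r : nat) (D : simple_group R n r).
Variable V : forall i : 'I_r, fund_rep D i.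
Local Notation C := R[i].
Local Notation G := (sg_G D).
Local Notation Bp := (sg_Bp D).
Local Notation H := (sg_H D).
Local Notation a := (sg_a D).
Local Notation sl2 i := (mxapp id (sg_sl2 D i)).
Local Notation rho i := (fr_rho (V i)).
Local Notation nu i := (fr_nu (V i)).
Local Notation fnu i := (fr_fnu (V i)).

Lemma xe0 i : xe D i 0 = 1%:M. Proof. exact: expmx_zero. Qed.

Lemma cor_mat2 i t : cor D i t = sl2 i (mat2 t 0 0 t^-1). Proof. by []. Qed.

(* [b] acts on the basis [nu], [f nu] of [W_i] by the matrix [[x, w], [0, y]]. *)
Definition acts (S : comNzRingType) (iota : C -> S) i (b : 'M[S]_n) (x w y : S) : Prop :=
  mxapp iota (rho i) b *m map_mx iota (nu i) = x *: map_mx iota (nu i) /\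
  mxapp iota (rho i) b *m map_mx iota (fnu i) =
    w *: map_mx iota (nu i) + y *: map_mx iota (fnu i).

Lemma actsE i b x w y : acts id i b x w y <->
  mxapp id (rho i) b *m nu i = x *: nu i /\
  mxapp id (rho i) b *m fnu i = w *: nu i + y *: fnu i.
Proof. by rewrite /acts !map_mx_id. Qed.

Definition nu_curve i : 'cV[{poly C}]_(fr_dim (V i)) :=
  mxapp polyC (rho i) (exp_curve (sg_f D i)) *m map_mx polyC (nu i).

Lemma nu_curve_horner i y k : (nu_curve i k 0).[y] = (mxapp id (rho i) (xf D i y) *m nu i) k 0.
Proof.
rewrite horner_entry.
rewrite /nu_curve map_mxM mxapp_exp_curve_horner.
have -> : map_mx (horner_eval y) (map_mx polyC (nu i)) = nu i.
  by apply/matrixP => c d; rewrite !mxE /horner_eval hornerC.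
by [].
Qed.

Lemma nu_cor i j t : t != 0 ->
  mxapp id (rho i) (cor D j t) *m nu i = (if j == i then t else 1) *: nu i.
Proof. exact: fr_nu_wt. Qed.

#[local] Opaque cor xe xf mxapp mxdiff.

Lemma rho1 i : mxapp id (rho i) 1%:M = 1%:M. Proof. exact: fr_rho1. Qed.

Lemma rhoM i x y : G x -> G y ->
  mxapp id (rho i) (x *m y) = mxapp id (rho i) x *m mxapp id (rho i) y.
Proof. exact: fr_rhoM. Qed.

Lemma nu_curve_coef0 i k : (nu_curve i k 0)`_0 = nu i k 0.
Proof. by rewrite -horner_coef0 nu_curve_horner xf0 rho1 mul1mx. Qed.

Lemma nu_curve_coef1 i k : (nu_curve i k 0)`_1 = fnu i k 0.
Proof.
rewrite /nu_curve mxE coef_sum /fr_fnu -mxapp_exp_curve1 [RHS]mxE.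
apply: eq_bigr => l _; rewrite [X in _ = X * _]mxE.
by rewrite [X in _ * X]mxE coefMC.
Qed.

Lemma action_linear_change i (M : 'M[C]_(fr_dim (V i))) (b c : C) :
  (forall y, M *m (mxapp id (rho i) (xf D i y) *m nu i) =
     b *: (mxapp id (rho i) (xf D i (c * y)) *m nu i)) ->
  M *m nu i = b *: nu i /\ M *m fnu i = (b * c) *: fnu i.
Proof.
move=> e; split.
  have := e 0; rewrite mulr0 xf0 rho1 mul1mx; exact.
apply/matrixP => k l; rewrite ord1 {l} [RHS]mxE -nu_curve_coef1.
pose p : {poly C} := \sum_l (M k l)%:P * nu_curve i l 0.
have -> : (M *m fnu i) k 0 = p`_1.
  rewrite mxE coef_sum; apply: eq_bigr => l _.
  by rewrite coefCM nu_curve_coef1.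
apply: coef1_linear_change => y; rewrite nu_curve_horner.
have := congr1 (fun u : 'cV_(fr_dim (V i)) => u k 0) (e y).
rewrite /= [X in _ = X -> _]mxE => <-; rewrite horner_sum [RHS]mxE.
by apply: eq_bigr => l _; rewrite hornerM hornerC nu_curve_horner.
Qed.

Lemma action_moebius i (M : 'M[C]_(fr_dim (V i))) (x : C) :
  (forall y, 1 + x * y != 0 -> M *m (mxapp id (rho i) (xf D i y) *m nu i) =
     (1 + x * y) *: (mxapp id (rho i) (xf D i (y / (1 + x * y))) *m nu i)) ->
  M *m fnu i = x *: nu i + fnu i.
Proof.
move=> e; apply/matrixP => k l; rewrite ord1 {l} [RHS]mxE [X in _ = X + _]mxE.
rewrite -nu_curve_coef1 -nu_curve_coef0 addrC.
pose p : {poly C} := \sum_l (M k l)%:P * nu_curve i l 0.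
have -> : (M *m fnu i) k 0 = p`_1.
  rewrite mxE coef_sum; apply: eq_bigr => l _.
  by rewrite coefCM nu_curve_coef1.
apply: coef1_moebius => y y0; rewrite nu_curve_horner.
have := congr1 (fun u : 'cV_(fr_dim (V i)) => u k 0) (e y y0).
rewrite /= [X in _ = X -> _]mxE => <-; rewrite horner_sum [RHS]mxE.
by apply: eq_bigr => l _; rewrite hornerM hornerC nu_curve_horner.
Qed.

Lemma derived_commutator (X : set 'M[C]_n) x y : X x -> X y ->
  derived X (x *m y *m invmx x *m invmx y).
Proof. by move=> Xx Xy S _; apply. Qed.

Lemma two_neq0 : (2 : C) != 0. Proof. by rewrite pnatr_eq0. Qed.

Lemma xeD i x y : xe D i x *m xe D i y = xe D i (x + y).
Proof.
by rewrite !xe_mat2 (sl2_mat2M D i (up_det _) (up_det _)); apply: sl2_eq; ring.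
Qed.

Lemma xeN i x : invmx (xe D i x) = xe D i (- x).
Proof.
rewrite -[RHS](mulKmx (G_unit (xe_G D i x))) xeD subrr xe0.
by rewrite mulmx1.
Qed.

Lemma cor_xe i t x : t != 0 -> cor D i t *m xe D i x = xe D i (t ^+ 2 * x) *m cor D i t.
Proof.
move=> t0; rewrite !xe_mat2 !cor_mat2 (sl2_mat2M D i (diag_det t0) (up_det _)).
by rewrite (sl2_mat2M D i (up_det _) (diag_det t0)); apply: sl2_eq; field.
Qed.

Lemma xe_Np i x : Np D (xe D i x).
Proof.
have e : x = 2 ^+ 2 * (x / 3) - x / 3 by field.
have -> : xe D i x = cor D i 2 *m xe D i (x / 3) *m invmx (cor D i 2)
    *m invmx (xe D i (x / 3)).
  rewrite (cor_xe i _ two_neq0) mulmxK; last exact/G_unit/H_G/cor_H/two_neq0.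
  by rewrite xeN xeD -e.
exact: derived_commutator (cor_Bp D i two_neq0) (xe_Bp D i _).
Qed.

Lemma nu_xe i j x : mxapp id (rho i) (xe D j x) *m nu i = nu i.
Proof. exact: (fr_nu_Np (V i) (xe_Np j x)). Qed.

Lemma xf_Nm i x : Nm D (xf D i x).
Proof.
have two0 := two_neq0.
have e : x = 2 ^ (- a i i) * (x * (- (4 / 3))) - x * (- (4 / 3)).
  rewrite cartan_diag -[2 ^ (- 2)]/((2 ^+ 2)^-1).
  by field.
have -> : xf D i x = cor D i 2 *m xf D i (x * (- (4 / 3))) *m invmx (cor D i 2)
    *m invmx (xf D i (x * (- (4 / 3)))).
  rewrite (cor_xf D i i _ two_neq0) mulmxK; last exact/G_unit/H_G/cor_H/two_neq0.
  by rewrite xfN xfD -e.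
exact: derived_commutator (cor_Bm D i two_neq0) (xf_Bm D i _).
Qed.

(* The first order in [y] of
   [e^(x e) e^(y f) = e^(y / u f) u^h e^(x / u e)], where [u = 1 + x y]. *)
Lemma xe_fnu i x : mxapp id (rho i) (xe D i x) *m fnu i = x *: nu i + fnu i.
Proof.
apply: action_moebius => y; set u := 1 + x * y => u0.
rewrite [LHS]mulmxA -(rhoM i (xe_G D i x) (xf_G D i y)).
have -> : xe D i x *m xf D i y = xf D i (y / u) *m cor D i u *m xe D i (x / u).
  rewrite !xf_mat2 !xe_mat2 !cor_mat2 (sl2_mat2M D i (up_det _) (low_det _)).
  rewrite (sl2_mat2M D i (low_det _) (diag_det u0)) sl2_mat2M; last exact: up_det.
    by apply: sl2_eq; rewrite /u; field.
  by field.
have cG : G (cor D i u) by exact/H_G/cor_H.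
have fcG : G (xf D i (y / u) *m cor D i u).
  by have [_ [_ m _] _] := G_alg D; apply: m; [exact: xf_G|].
rewrite (rhoM i fcG (xe_G D i _)) (rhoM i (xf_G D i _) cG).
apply: mulmx_eigenvector; first exact: nu_xe.
by have := nu_cor i i u0; rewrite eqxx.
Qed.

Lemma nu_fnu_indep i (b c : C) : b *: nu i + c *: fnu i = 0 -> b = 0 /\ c = 0.
Proof.
move=> e; have := congr1 (fun u => mxapp id (rho i) (xe D i 1) *m u) e.
rewrite mulmxDr -!scalemxAr xe_fnu nu_xe mulmx0.
rewrite scale1r scalerDr addrCA e addr0 => /eqP; rewrite scaler_eq0.
rewrite (negPf (fr_nu0 (V i))) orbF => /eqP c0; split=> //.
move: e; rewrite c0 scale0r addr0 => /eqP; rewrite scaler_eq0.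
by rewrite (negPf (fr_nu0 (V i))) orbF => /eqP.
Qed.

Lemma W_coords i : exists L : 'M[C]_(2, fr_dim (V i)),
  L *m nu i = delta_mx 0 0 /\ L *m fnu i = delta_mx 1 0.
Proof.
pose E : 'M[C]_(1 + 1, fr_dim (V i)) := col_mx (nu i)^T (fnu i)^T.
have fE : row_free E.
  rewrite -kermx_eq0; apply/rowV0P => v /sub_kermxP.
  rewrite -[v]hsubmxK mul_row_col => /(congr1 trmx).
  rewrite raddfD /= !trmx_mul !trmxK trmx0.
  rewrite [(lsubmx v)^T]mx11_scalar [(rsubmx v)^T]mx11_scalar !mul_mx_scalar.
  case/nu_fnu_indep; rewrite !mxE => e1 e2.
  apply/rowP => j; rewrite [RHS]mxE mxE.
  by case: (splitP j) => k _; rewrite mxE (ord1 k) ?e1 ?e2.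
have EL := mulmxVp fE; exists (pinvmx E)^T.
have nuE (u : 'I_2) : ((pinvmx E)^T *m nu i) u 0 = (E *m pinvmx E) (lshift 1 0) u.
  by rewrite -[nu i]trmxK -trmx_mul [LHS]mxE /E mul_col_mx col_mxEu.
have fnuE (u : 'I_2) : ((pinvmx E)^T *m fnu i) u 0 = (E *m pinvmx E) (rshift 1 0) u.
  by rewrite -[fnu i]trmxK -trmx_mul [LHS]mxE /E mul_col_mx col_mxEd.
by split; apply/colP => u; rewrite ?nuE ?fnuE EL !mxE eqxx andbT eq_sym.
Qed.

Lemma acts_mul i b b' x w y x' w' y' : G b -> G b' ->
  acts id i b x w y -> acts id i b' x' w' y' ->
  acts id i (b *m b') (x * x') (x * w' + w * y') (y * y').
Proof.
move=> Gb Gb' [b1 b2] [b1' b2']; rewrite /acts (rhoM i Gb Gb').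
exact: triangular_mul b1 b2 b1' b2'.
Qed.

Lemma acts_uniq i b x w y x' w' y' :
  acts id i b x w y -> acts id i b x' w' y' -> [/\ x = x', w = w' & y = y'].
Proof.
move=> /actsE[h1 h2] /actsE[e1 e2]; rewrite h1 in e1; rewrite h2 in e2.
have [|w0 y0] := @nu_fnu_indep i (w - w') (y - y').
  by rewrite !scalerBl addrACA e2 -opprD subrr.
have [|x0 _] := @nu_fnu_indep i (x - x') 0.
  by rewrite scalerBl e1 subrr scale0r addr0.
by split; apply/eqP; rewrite -subr_eq0; apply/eqP.
Qed.

Lemma acts_cor i j t : t != 0 ->
  acts id i (cor D j t) (if j == i then t else 1) 0
    ((if j == i then t else 1) * t ^ (- a j i)).
Proof.
move=> t0; apply/actsE; rewrite scale0r add0r; apply: action_linear_change => y.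
have cG : G (cor D j t) by exact/H_G/cor_H.
rewrite [LHS]mulmxA -(rhoM i cG (xf_G D i y)) (cor_xf D i j y t0).
rewrite (rhoM i (xf_G D i _) cG) -[mxapp id (rho i) (xf D i _) *m _]mulmx1.
by apply: mulmx_eigenvector; [rewrite mul1mx|exact: nu_cor].
Qed.

Lemma acts_xe i j x : acts id i (xe D j x) 1 (if j == i then x else 0) 1.
Proof.
apply/actsE; case: (eqVneq j i) => [->|ji].
  by rewrite !scale1r xe_fnu nu_xe.
rewrite scale0r add0r; rewrite -{2}[1](mul1r 1); apply: action_linear_change => y.
rewrite [LHS]mulmxA -(rhoM i (xe_G D j x) (xf_G D i y)) (xe_xf D x y ji).
rewrite (rhoM i (xf_G D i _) (xe_G D j x)) -[mxapp id (rho i) (xf D i _) *m _]mulmx1.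
rewrite mul1r; apply: mulmx_eigenvector; first by rewrite mul1mx.
by rewrite scale1r; exact: nu_xe.
Qed.

Lemma acts1 i : acts id i 1%:M 1 0 1.
Proof. by apply/actsE; rewrite rho1 !mul1mx !scale1r scale0r add0r. Qed.

Definition char_weight (S : fieldType) (chi : 'I_r -> S) i : S := chi i * \prod_(j < r) chi j ^ (- a j i).

Lemma acts_H h : H h -> exists2 chi : 'I_r -> C, (forall i, chi i != 0) &
  forall i, acts id i h (chi i) 0 (char_weight chi i).
Proof.
move=> /H_gen; elim=> [|j t x t0 gx [chi chi0 IH]].
  exists (fun=> 1) => i; first exact: oner_neq0.
  rewrite /char_weight big1 => [|j _]; last by rewrite exp1rz.
  by rewrite mulr1; exact: acts1.
have Gx : G x.
  elim: gx {IH} => [|k u z u0 _ IH]; first by have [_ []] := G_alg D.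
  by have [_ [_ m _] _] := G_alg D; apply: m IH; exact/H_G/cor_H.
exists (fun i => (if j == i then t else 1) * chi i) => i.
  by rewrite mulf_neq0 //; case: (j == i); rewrite ?t0 ?oner_neq0.
have := acts_mul (H_G (cor_H D j t0)) Gx (acts_cor i j t0) (IH i).
rewrite mulr0 mul0r addr0 /char_weight.
have -> : \prod_k ((if j == k then t else 1) * chi k) ^ (- a k i) =
    t ^ (- a j i) * \prod_k chi k ^ (- a k i).
  under eq_bigr do rewrite expfzMl.
  rewrite big_split /= (bigD1 j) //= eqxx big1 ?mulr1 // => k.
  by rewrite eq_sym => /negPf->; rewrite exp1rz.
by rewrite mulrACA.
Qed.

Lemma Bp1 : Bp 1%:M. Proof. by have [_ []] := Bp_alg D. Qed.
Lemma BpM x y : Bp x -> Bp y -> Bp (x *m y).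
Proof. by have [_ [_ m _] _] := Bp_alg D; exact: m. Qed.
Lemma BpV x : Bp x -> Bp (invmx x).
Proof. by have [_ [_ _ v] _] := Bp_alg D; exact: v. Qed.

Lemma acts_Bp_triangular i b : Bp b -> exists x w y, acts id i b x w y.
Proof.
move=> Bb; have [h [u [Hh Nu eb]]] := sg_Bp_dec Bb.
have Bh : Bp h by case/HE: Hh.
have Bu : Bp u.
  have -> : u = invmx h *m b by rewrite eb (mulKmx (G_unit (Bp_G Bh))).
  exact: BpM (BpV Bh) Bb.
have [chi _ /(_ i)/actsE[hnu _]] := acts_H Hh.
have [w [y hf]] := fr_W_Bp (V i) Bb; exists (chi i), w, y; apply/actsE; split; last exact hf.
rewrite {1}eb (rhoM i (Bp_G Bh) (Bp_G Bu)) -[LHS]mulmxA.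
by rewrite (fr_nu_Np (V i) Nu).
Qed.

Lemma acts_inv i b x w y : Bp b -> acts id i b x w y ->
  exists w', acts id i (invmx b) x^-1 w' y^-1 /\ x != 0 /\ y != 0.
Proof.
move=> Bb bx; have [x' [w' [y' bx']]] := acts_Bp_triangular i (BpV Bb).
have := acts_mul (Bp_G Bb) (Bp_G (BpV Bb)) bx bx'.
rewrite (mulmxV (G_unit (Bp_G Bb))).
move=> /(acts_uniq (acts1 i))[ex _ ey].
have x0 : x != 0 by apply: contra_eq_neq ex => ->; rewrite mul0r oner_neq0.
have y0 : y != 0 by apply: contra_eq_neq ey => ->; rewrite mul0r oner_neq0.
have -> : x^-1 = x' by rewrite -[RHS](mulKf x0) -ex mulr1.
have -> : y^-1 = y' by rewrite -[RHS](mulKf y0) -ey mulr1.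
by exists w'.
Qed.

Lemma acts_Np u : Np D u -> forall i, exists w, acts id i u 1 w 1.
Proof.
move=> Nu i; pose S : set 'M[C]_n := fun b => Bp b /\ exists w, acts id i b 1 w 1.
suff [] : S u by [].
apply: Nu; first split.
- by split; [exact: Bp1|exists 0; exact: acts1].
- move=> b c [Bb [w bw]] [Bc [w' cw]]; split; first exact: BpM.
  by have := acts_mul (Bp_G Bb) (Bp_G Bc) bw cw; rewrite !mulr1; exists (1 * w' + w).
- move=> b [Bb [w bw]]; split; first exact: BpV.
  by have [w' [bw' _]] := acts_inv Bb bw; rewrite invr1 in bw'; exists w'.
move=> b c Bb Bc; have [x [w [y bx]]] := acts_Bp_triangular i Bb.
have [x' [w' [y' cx]]] := acts_Bp_triangular i Bc.
have [wb [bV [x0 y0]]] := acts_inv Bb bx.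
have [wc [cV [x0' y0']]] := acts_inv Bc cx.
split; first exact: BpM (BpM (BpM Bb Bc) (BpV Bb)) (BpV Bc).
have bc := acts_mul (Bp_G Bb) (Bp_G Bc) bx cx.
have bcb := acts_mul (Bp_G (BpM Bb Bc)) (Bp_G (BpV Bb)) bc bV.
have := acts_mul (Bp_G (BpM (BpM Bb Bc) (BpV Bb))) (Bp_G (BpV Bc)) bcb cV.
rewrite [x * x']mulrC mulfK // mulfV // [y * y']mulrC mulfK // mulfV //.
by eexists; eassumption.
Qed.

Lemma acts_Bp b : Bp b -> exists2 chi : 'I_r -> C, (forall i, chi i != 0) &
  forall i, exists w, acts id i b (chi i) w (char_weight chi i).
Proof.
move=> Bb; have [h [u [Hh Nu eb]]] := sg_Bp_dec Bb.
have Bh : Bp h by case/HE: Hh.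
have Bu : Bp u.
  have -> : u = invmx h *m b by rewrite eb (mulKmx (G_unit (Bp_G Bh))).
  exact: BpM (BpV Bh) Bb.
have [chi chi0 ch] := acts_H Hh; exists chi => // i.
have [w uw] := acts_Np Nu i.
have := acts_mul (Bp_G Bh) (Bp_G Bu) (ch i) uw; rewrite -eb !mulr1.
by eexists; eassumption.
Qed.

End FundamentalAction.

Section GenericPoints.
Variables (R : realType) (n r : nat) (D : simple_group R n r).
Variable V : forall i : 'I_r, fund_rep D i.
Local Notation C := R[i].
Local Notation K := (ratfun R).
Local Notation ofc := (@ofconst R).
Local Notation G := (sg_G D).
Local Notation Bp := (sg_Bp D).
Local Notation Bm := (sg_Bm D).
Local Notation a := (sg_a D).
Local Notation rho i := (fr_rho (V i)).
Local Notation nu i := (fr_nu (V i)).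
Local Notation fnu i := (fr_fnu (V i)).

Lemma points_mul (X : set 'M[C]_n) g h :
  alg_group X -> points X g -> points X h -> points X (g *m h).
Proof.
move=> [cX [_ XM _] _] Xg Xh; apply: points_ae.
move: (ae_and (ae_spec g) (ae_spec h)); apply: ae_sub => z [[x gx] [y hy]].
exists (x *m y); first exact: specM.
by apply: XM; [exact: points_spec cX Xg gx|exact: points_spec cX Xh hy].
Qed.

Lemma points1 (X : set 'M[C]_n) : alg_group X -> points X 1%:M.
Proof.
move=> [_ [X1 _ _] _]; apply: points_ae; apply: ae_true => z.
by exists 1%:M; first exact: spec1.
Qed.

Lemma points_inv (X : set 'M[C]_n) g :
  alg_group X -> points X g -> points X (invmx g).
Proof.
move=> aX Xg; have [cX [_ _ XV] dX] := aX; apply: points_ae.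
move: (ae_spec g); apply: ae_sub => z [x gx].
have Xx := points_spec cX Xg gx; exists (invmx x); last exact: XV.
by apply: spec_invmx => //; rewrite dX // oner_neq0.
Qed.

Lemma points_det (X : set 'M[C]_n) g : alg_group X -> points X g -> \det g = 1.
Proof.
move=> aX Xg; have [cX _ dX] := aX; apply: ae_eq.
move: (ae_spec g); apply: ae_sub => z [x gx]; exists 1.
  rewrite -(dX x (points_spec cX Xg gx)); exact (rel_det (evalat_rel z) gx).
exact: rel1 (evalat_rel z).
Qed.

Lemma points_unit (X : set 'M[C]_n) g : alg_group X -> points X g -> g \in unitmx.
Proof. by move=> aX Xg; rewrite unitmxE (points_det aX Xg) unitr1. Qed.

Lemma points_prod (X : set 'M[C]_n) (s : seq 'I_r) (F : 'I_r -> 'M[K]_n) :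
  alg_group X -> (forall i, points X (F i)) ->
  points X (\big[mulmx/1%:M]_(i <- s) F i).
Proof.
move=> aX XF; elim: s => [|i s IH]; first by rewrite big_nil; exact: points1.
by rewrite big_cons; exact (points_mul aX (XF i) IH).
Qed.

Lemma points_qshift (q : C) (X : set 'M[C]_n) g : q != 0 ->
  points X g -> points X (map_mx (qshift q) g).
Proof.
move=> q0 Xg p pX.
have <- := mxeval_map (phi := qshift_morph q0) (iota := ofc) (kappa := ofc) p g
   (fun c => qshift_ofconst q0 c).
by rewrite (Xg p pX); exact: (rmorph0 (qshift_morph q0)).
Qed.

Lemma Bp_points_G g : points Bp g -> points G g.
Proof. by apply: points_sub => x; exact: Bp_G. Qed.

Lemma spec_mat2 z x y u v x' y' u' v' : evalat z x x' -> evalat z y y' ->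
  evalat z u u' -> evalat z v v' -> @spec R z _ _ (mat2 x y u v) (mat2 x' y' u' v').
Proof. exact: mx_rel_mat2. Qed.

Lemma evalat0 z : @evalat R z 0 0. Proof. exact (rel0 (evalat_rel z)). Qed.
Lemma evalat1 z : @evalat R z 1 1. Proof. exact (rel1 (evalat_rel z)). Qed.

Lemma spec_coroot z i t t' : evalat z t t' -> t' != 0 ->
  spec z (coroot_val D i t) (cor D i t').
Proof.
move=> tt t0; apply: spec_mxapp.
apply: spec_mat2 => //; [exact: evalat0|exact: evalat0|exact: evalatV].
Qed.

Lemma spec_exp_e z i t t' : evalat z t t' -> spec z (exp_e D i t) (xe D i t').
Proof. by move=> tt; apply: spec_expmx; apply: specZ => //; exact: spec_map. Qed.

Lemma points_coroot_H i t : t != 0 -> points (sg_H D) (coroot_val D i t).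
Proof.
move=> /ae_evalat_neq0 h; apply: points_ae; move: h; apply: ae_sub => z [c c0 tc].
by exists (cor D i c); [exact: spec_coroot|exact: cor_H].
Qed.

Lemma points_coroot_Bp i t : t != 0 -> points Bp (coroot_val D i t).
Proof. by move/(points_coroot_H i); apply: points_sub => x /HE[]. Qed.

Lemma points_exp_e_Bp i t : points Bp (exp_e D i t).
Proof.
apply: points_ae; move: (ae_evalat t); apply: ae_sub => z [c tc].
by exists (xe D i c); [exact: spec_exp_e|exact: xe_Bp].
Qed.

Local Notation actsK := (acts V ofc).

Definition spec_acts z i b x w y : Prop := exists b' x' w' y',
  [/\ spec z b b', evalat z x x', evalat z w w', evalat z y y' &
      acts V id i b' x' w' y'].

Lemma acts_generic i b x w y : ae (fun z => spec_acts z i b x w y) ->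
  actsK i b x w y.
Proof.
move=> h; split; apply: ae_mx_eq; move: h; apply: ae_sub => z.
  move=> [b' [x' [w' [y' [bb xx _ _ /actsE[e _]]]]]].
  exists (x' *: nu i); last by apply: specZ => //; exact: spec_map.
  by rewrite -e; apply: specM; [exact: spec_mxapp|exact: spec_map].
move=> [b' [x' [w' [y' [bb _ ww yy /actsE[_ e]]]]]].
exists (w' *: nu i + y' *: fnu i).
  by rewrite -e; apply: specM; [exact: spec_mxapp|exact: spec_map].
by apply: specD; apply: specZ => //; exact: spec_map.
Qed.

Lemma rhoMK i g h : points G g -> points G h ->
  mxapp ofc (rho i) (g *m h) = mxapp ofc (rho i) g *m mxapp ofc (rho i) h.
Proof.
move=> Gg Gh; have [cG _ _] := G_alg D; apply: ae_mx_eq.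
move: (ae_and (ae_spec g) (ae_spec h)); apply: ae_sub => z [[x gx] [y hy]].
exists (mxapp id (rho i) (x *m y)); first by apply: spec_mxapp; exact: specM.
rewrite (rhoM V i (points_spec cG Gg gx) (points_spec cG Gh hy)).
by apply: specM; exact: spec_mxapp.
Qed.

Lemma rho1K i : mxapp ofc (rho i) 1%:M = 1%:M.
Proof.
apply: ae_mx_eq; apply: ae_true => z; exists 1%:M; last exact: spec1.
by rewrite -(rho1 V i); apply: spec_mxapp; exact: spec1.
Qed.

Lemma actsK_mul i b b' x w y x' w' y' : points G b -> points G b' ->
  actsK i b x w y -> actsK i b' x' w' y' ->
  actsK i (b *m b') (x * x') (x * w' + w * y') (y * y').
Proof.
move=> Gb Gb' [b1 b2] [b1' b2']; rewrite /acts (rhoMK i Gb Gb').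
exact: triangular_mul b1 b2 b1' b2'.
Qed.

Lemma nu_fnu_indepK i (b c : K) :
  b *: map_mx ofc (nu i) + c *: map_mx ofc (fnu i) = 0 -> b = 0 /\ c = 0.
Proof.
have [L [Lnu Lfnu]] := W_coords V i; apply: (@dual_basis_indep _ _ (map_mx ofc L)).
  by rewrite -map_mxM Lnu map_delta_mx.
by rewrite -map_mxM Lfnu map_delta_mx.
Qed.

Lemma actsK_uniq i b x w y x' w' y' :
  actsK i b x w y -> actsK i b x' w' y' -> [/\ x = x', w = w' & y = y'].
Proof.
move=> [h1 h2] [e1 e2]; rewrite h1 in e1; rewrite h2 in e2.
have [|w0 y0] := @nu_fnu_indepK i (w - w') (y - y').
  by rewrite !scalerBl addrACA e2 -opprD subrr.
have [|x0 _] := @nu_fnu_indepK i (x - x') 0.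
  by rewrite scalerBl e1 subrr scale0r addr0.
by split; apply/eqP; rewrite -subr_eq0; apply/eqP.
Qed.

Lemma actsK1 i : actsK i 1%:M 1 0 1.
Proof. by rewrite /acts rho1K; exact: triangular1. Qed.

Lemma actsK_coroot i j t : t != 0 ->
  actsK i (coroot_val D j t) (if j == i then t else 1) 0
    ((if j == i then t else 1) * t ^ (- a j i)).
Proof.
move=> /ae_evalat_neq0 h; apply: acts_generic; move: h; apply: ae_sub => z [c c0 tc].
have xc : evalat z (if j == i then t else 1) (if j == i then c else 1).
  by case: (j == i) => //; exact: evalat1.
exists (cor D j c), (if j == i then c else 1), 0,
   ((if j == i then c else 1) * c ^ (- a j i)); split=> //.
- exact: spec_coroot.
- exact: evalat0.
- exact (relM (evalat_rel z) xc (evalat_expz _ c0 tc)).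
- exact: acts_cor.
Qed.

Lemma actsK_exp_e i j t : actsK i (exp_e D j t) 1 (if j == i then t else 0) 1.
Proof.
apply: acts_generic; move: (ae_evalat t); apply: ae_sub => z [c tc].
exists (xe D j c), 1, (if j == i then c else 0), 1; split.
- exact: spec_exp_e.
- exact: evalat1.
- by case: (j == i) => //; exact: evalat0.
- exact: evalat1.
- exact: acts_xe.
Qed.

Lemma actsK_Bp v : points Bp v -> exists2 chi : 'I_r -> K, (forall i, chi i != 0) &
  forall i, exists w, actsK i v (chi i) w (char_weight D chi i) /\
    (points Bm v -> w = 0).
Proof.
move=> Bv; have [cB _ _] := Bp_alg D; have [cBm _ _] := Bm_alg D.
have coords i : exists x w y : K, forall z v' x' w' y', spec z v v' ->
    acts V id i v' x' w' y' -> [/\ evalat z x x', evalat z w w' & evalat z y y'].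
  have [L [Lnu Lfnu]] := W_coords V i.
  pose M := mxapp ofc (rho i) v.
  exists ((map_mx ofc L *m (M *m map_mx ofc (nu i))) 0 0),
    ((map_mx ofc L *m (M *m map_mx ofc (fnu i))) 0 0),
    ((map_mx ofc L *m (M *m map_mx ofc (fnu i))) 1 0).
  move=> z v' x' w' y' vv /actsE[e1 e2].
  have E (u : 'cV[C]_(fr_dim (V i))) k : evalat z
      ((map_mx ofc L *m (M *m map_mx ofc u)) k 0)
      ((L *m (mxapp id (rho i) v' *m u)) k 0).
    apply: (specM (spec_map z L) (specM (spec_mxapp _ vv) (spec_map z u))).
  have := E (fnu i) 0; have := E (fnu i) 1; have := E (nu i) 0.
  rewrite e2 e1; have [-> ->] := dual_coords w' y' Lnu Lfnu.
  have [] := dual_coords x' 0 Lnu Lfnu; rewrite scale0r addr0 => -> _.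
  by move=> E1 E3 E2; split; [exact E1|exact E2|exact E3].
have [chi chiP] := fin_all_exists coords.
have specB : ae (fun z => exists v' chi', [/\ spec z v v', Bp v', forall i, chi' i != 0,
    forall i, evalat z (chi i) (chi' i) &
    forall i, exists w', acts V id i v' (chi' i) w' (char_weight D chi' i)]).
  move: (ae_spec v); apply: ae_sub => z [v' vv].
  have Bv' := points_spec cB Bv vv; have [chi' chi0 cP] := acts_Bp V Bv'.
  exists v', chi'; split=> // i; have [w' vw] := cP i.
  by have [w [y /(_ _ _ _ _ _ vv vw)[]]] := chiP i.
exists chi => i.
  apply/eqP => c0; have [z [v' [chi' [_ _ /(_ i)/eqP c'0 /(_ i) cE _]]]] := ae_exists specB.
  by apply: c'0; rewrite c0 in cE; exact: evalat_uniq cE (evalat0 z).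
have [w [y wP]] := chiP i; exists w.
split.
  apply: acts_generic; move: specB; apply: ae_sub => z [v' [chi' [vv Bv' chi0 cE cP]]].
  have [w' vw] := cP i; have [_ ww _] := wP _ _ _ _ _ vv vw.
  exists v', (chi' i), w', (char_weight D chi' i); split=> //.
  apply: (relM (evalat_rel z)) => //; apply: (rel_prod (evalat_rel z)) => j _.
  exact: evalat_expz.
move=> Bmv; apply: ae_eq; move: specB; apply: ae_sub => z [v' [chi' [vv Bv' chi0 cE cP]]].
have Hv : sg_H D v' by apply/HE; split=> //; exact: points_spec cBm Bmv vv.
have [chi2 _ /(_ i) h2] := acts_H V Hv.
by have [_ ww _] := wP _ _ _ _ _ vv h2; exists 0; last exact: evalat0.
Qed.

End GenericPoints.

Lemma big_mulmx_rcons (S : comNzRingType) n (I : Type) (s : seq I) k (F : I -> 'M[S]_n) :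
  \big[mulmx/1%:M]_(i <- rcons s k) F i = (\big[mulmx/1%:M]_(i <- s) F i) *m F k.
Proof. by rewrite -cats1 big_cat big_seq1. Qed.

Lemma mulmx_twist (S : comNzRingType) n (T X X' Z Z' : 'M[S]_n) :
  T *m X = X' *m T -> T *m Z = Z' *m T -> T *m (X *m Z) = X' *m Z' *m T.
Proof. by move=> e e'; rewrite mulmxA e -!mulmxA e'. Qed.

Lemma mulmx_twist2 (S : comNzRingType) n (T1 T2 X X' X'' : 'M[S]_n) :
  T2 *m X = X' *m T2 -> T1 *m X' = X'' *m T1 -> T1 *m T2 *m X = X'' *m (T1 *m T2).
Proof. by move=> e e'; rewrite -mulmxA e mulmxA e' mulmxA. Qed.

Lemma mulmx_factor_twist (S : comNzRingType) n (X X' T E W W' : 'M[S]_n) :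
  X' *m X = 1%:M -> E *m W = W *m E -> T *m W = W' *m T ->
  X *m T *m E *m W = X *m W' *m X' *m (X *m T *m E).
Proof.
move=> XX EW TW; rewrite -!mulmxA (mulmxA X') XX mul1mx EW.
by rewrite (mulmxA T) TW !mulmxA.
Qed.

(** * The Bruhat cell of the normal form *)

Lemma mulmx1_invmx (F : fieldType) n (A B : 'M[F]_n) : A *m B = 1%:M -> invmx A = B.
Proof.
by move=> e; have [uA _] := mulmx1_unit e; rewrite -[LHS]mulmx1 -e (mulKmx uA).
Qed.

Lemma cell_step (F : fieldType) n (B E E' P M S U1 U2 : 'M[F]_n) :
  B *m E = E' *m B -> B = U1 *m S *m U2 -> P \in unitmx ->
  B *m (E *m P *m M) = (E' *m U1) *m (S *m P) *m (invmx P *m U2 *m P *m M).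
Proof.
move=> BE eB uP; rewrite !mulmxA BE eB.
by rewrite -!mulmxA (mulmxA P (invmx P)) (mulmxV uP) mul1mx.
Qed.

Section OperCell.
Variables (R : realType) (n r : nat) (D : simple_group R n r).
Local Notation C := R[i].
Local Notation K := (ratfun R).
Local Notation ofc := (@ofconst R).
Local Notation a := (sg_a D).
Local Notation sl2 i := (mxapp id (sg_sl2 D i)).

Lemma mxeval_conj (A B : 'M[C]_n) (p : {mpoly C[n * n]}) :
  exists p', forall x, mxeval id x p' = mxeval id (A *m x *m B) p.
Proof.
pose f := map_mx (@mpolyC (n * n) C) A *m mxcoord C n *m map_mx (@mpolyC (n * n) C) B.
exists (precomp f p) => x.
have -> : mxeval id x (precomp f p) = mxeval idfun x (precomp f p) by [].
rewrite mxeval_precomp /f !mxapp_mul !mxapp_const mxapp_coord.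
by rewrite !map_mx_id.
Qed.

Lemma zclosure_conj (X Y : set 'M[C]_n) A B :
  (forall x, X x -> Y (A *m x *m B)) ->
  forall x, zclosure X x -> zclosure Y (A *m x *m B).
Proof.
move=> XY x Xx p pY; have [p' p'E] := mxeval_conj A B p.
by rewrite -p'E; apply: Xx => y Xy; rewrite p'E; exact/pY/XY.
Qed.

Lemma zclosure_mul (X : set 'M[C]_n) : (forall x y, X x -> X y -> X (x *m y)) ->
  forall x y, zclosure X x -> zclosure X y -> zclosure X (x *m y).
Proof.
move=> XM x y cx cy p pX.
have [p' p'E] := mxeval_conj x 1%:M p; rewrite -[x *m y]mulmx1 -p'E; apply: cy => u Xu.
have [p'' p''E] := mxeval_conj 1%:M u p.
rewrite p'E mulmx1 -[x]mul1mx -p''E; apply: cx => v Xv.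
by rewrite p''E mul1mx; apply/pX/XM.
Qed.

#[local] Opaque cor xe xf mxapp.

Inductive low_word (s : seq 'I_r) : 'M[C]_n -> Prop :=
| low_word1 : low_word s 1%:M
| low_wordM i t x : i \in s -> low_word s x -> low_word s (xf D i t *m x).

Lemma low_word_mul s x y : low_word s x -> low_word s y -> low_word s (x *m y).
Proof.
move=> wx wy; elim: wx => [|i t z si _ IH]; first by rewrite mul1mx.
by rewrite -mulmxA; exact: low_wordM.
Qed.

Lemma low_word_xf s i t : i \in s -> low_word s (xf D i t).
Proof. by move=> si; rewrite -[xf _ _ _]mulmx1; apply: low_wordM => //; exact: low_word1. Qed.

Lemma low_word_subset s s' x : {subset s <= s'} -> low_word s x -> low_word s' x.
Proof.
move=> ss; elim=> [|i t z si _ IH]; first exact: low_word1.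
by apply: low_wordM => //; exact: ss.
Qed.

Lemma low_word_Nm s x : low_word s x -> Nm D x.
Proof.
elim=> [|i t z _ _ IH] S SG SS; first by case: SG.
have [_ SM _] := SG; apply: SM; last exact: IH.
exact: xf_Nm.
Qed.

Lemma low_word_conj_xe s k x w : k \notin s -> low_word s w ->
  xe D k x *m w = w *m xe D k x.
Proof.
move=> ks; elim=> [|i t z si _ IH]; first by rewrite mulmx1 mul1mx.
have ki : k != i by apply: contraNneq ks => ->.
exact (mulmx_twist (xe_xf D x t ki) IH).
Qed.

Lemma low_word_conj_cor s k t w : t != 0 -> low_word s w ->
  exists2 w', low_word s w' & cor D k t *m w = w' *m cor D k t.
Proof.
move=> t0; elim=> [|i u z si _ [w' sw' e]].
  by exists 1%:M; [exact: low_word1|rewrite mulmx1 mul1mx].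
exists (xf D i (t ^ (- a k i) * u) *m w'); first exact: low_wordM.
exact (mulmx_twist (cor_xf D i k u t0) e).
Qed.

Lemma low_word_path s k (u b : C) w : u != 0 -> b != 0 -> k \notin s -> low_word s w ->
  low_word (k :: s) (sl2 k (mat2 u (- b) b^-1 0) *m w *m sl2 k (mat2 0 b (- b^-1) u)).
Proof.
move=> u0 b0 ks sw; have inv := sl2_path_inv D k u b0.
have [w' sw' e] := low_word_conj_cor k u0 sw.
have uP := sl2_path_unit D k u b0.
have -> : sl2 k (mat2 0 b (- b^-1) u) = invmx (sl2 k (mat2 u (- b) b^-1 0)).
  by apply: (unitmx_injr uP); rewrite inv (mulVmx uP).
set X := xf D k (b^-1 * u^-1).
have -> : sl2 k (mat2 u (- b) b^-1 0) *m w =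
    X *m w' *m invmx X *m sl2 k (mat2 u (- b) b^-1 0).
  rewrite (sl2_lower_upper D k u0 b0); apply: mulmx_factor_twist e.
    exact: mulVmx (G_unit (xf_G D k _)).
  exact: low_word_conj_xe ks sw.
rewrite (mulmxK uP) xfN.
have kk : k \in k :: s by rewrite inE eqxx.
apply: low_word_mul; last exact: low_word_xf.
apply: low_wordM => //; apply: low_word_subset sw' => j js.
by rewrite inE js orbT.
Qed.

(* The big cell [u != 0] is dense, and [u = 0] gives a lift of the reflection. *)
Lemma low_word_reflection s k (b : C) w : b != 0 -> k \notin s ->
  zclosure (low_word s) w ->
  zclosure (low_word (k :: s))
    (sl2 k (mat2 0 (- b) b^-1 0) *m w *m sl2 k (mat2 0 b (- b^-1) 0)).
Proof.
move=> b0 ks cw p pv.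
pose A := mxapp polyC (sg_sl2 D k) (mat2 'X (- b)%:P (b^-1)%:P 0).
pose B := mxapp polyC (sg_sl2 D k) (mat2 0 b%:P (- b^-1)%:P 'X).
pose Q := mxeval polyC (A *m map_mx polyC w *m B) p.
have QE u : Q.[u] =
    mxeval id (sl2 k (mat2 u (- b) b^-1 0) *m w *m sl2 k (mat2 0 b (- b^-1) u)) p.
  have hc (c : C) : horner_eval u c%:P = c by rewrite /horner_eval hornerC.
  have -> : Q.[u] = horner_eval u Q by [].
  rewrite /Q (mxeval_map (kappa := id) p _ hc) !map_mxM /A /B !sl2_horner.
  rewrite !hornerC hornerX.
  have -> : map_mx (horner_eval u) (map_mx polyC w) = w by
    apply/matrixP => i j; rewrite !mxE; exact: hc.
  by [].  
rewrite -QE; have -> : Q = 0; last exact: horner0.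
apply: (@poly_eq_off _ 'X); first by rewrite polyX_eq0.
move=> u; rewrite hornerX horner0 => u0; rewrite QE.
apply: (zclosure_conj _ cw) pv => x sx; exact: low_word_path.
Qed.

Definition exp_f i (t : K) : 'M[K]_n := expmx (t *: map_mx ofc (sg_f D i)).

Lemma spec_exp_f z i t t' : evalat z t t' -> spec z (exp_f i t) (xf D i t').
Proof. by move=> tt; apply: spec_expmx; apply: specZ => //; exact: spec_map. Qed.

Lemma points_low_word_mul s g h : points (low_word s) g -> points (low_word s) h ->
  points (low_word s) (g *m h).
Proof.
move=> sg sh; apply: points_closureP.
move: (ae_and (ae_spec g) (ae_spec h)); apply: ae_sub => z [[x gx] [y hy]].
exists (x *m y); first exact: specM.
apply: zclosure_mul; first exact: low_word_mul.
  exact: points_zclosure sg gx.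
exact: points_zclosure sh hy.
Qed.

Lemma points_low_word_exp_f s i t : i \in s -> points (low_word s) (exp_f i t).
Proof.
move=> si; apply: points_ae; move: (ae_evalat t); apply: ae_sub => z [c tc].
by exists (xf D i c); [exact: spec_exp_f|exact: low_word_xf].
Qed.

Lemma points_low_word1 s : points (low_word s) 1%:M.
Proof.
apply: points_ae; apply: ae_true => z.
by exists 1%:M; [exact: spec1|exact: low_word1].
Qed.

Lemma points_low_word_subset s s' g : {subset s <= s'} ->
  points (low_word s) g -> points (low_word s') g.
Proof. by move=> ss; apply: points_sub => x; exact: low_word_subset. Qed.

Definition reflection_lift i (l : K) : 'M[K]_n := coroot_val D i l *m s_lift D i.

Lemma spec_reflection z i l c : evalat z l c -> c != 0 ->
  spec z (reflection_lift i l) (sl2 i (mat2 0 c (- c^-1) 0)).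
Proof.
move=> lc c0; have s1 : (0 : C) * 0 - 1 * -1 = 1 by ring.
have -> : sl2 i (mat2 0 c (- c^-1) 0) = cor D i c *m sl2 i (mat2 0 1 (-1) 0).
  rewrite cor_mat2 (sl2_mat2M D i (diag_det c0) s1); apply: sl2_eq; ring.
apply: specM; first exact: spec_coroot.
have e0 := evalat0 z; have e1 := evalat1 z.
exact (spec_mxapp _ (spec_mat2 e0 e1 (relN (evalat_rel z) e1) e0)).
Qed.

Lemma reflection_inv i (c : C) : c != 0 ->
  invmx (sl2 i (mat2 0 c (- c^-1) 0)) = sl2 i (mat2 0 (- c) c^-1 0).
Proof.
by move=> c0; apply: mulmx1_invmx; exact: (sl2_path_inv D i 0 c0).
Qed.

Lemma points_reflection_conj s k l w : l != 0 -> k \notin s -> points (low_word s) w ->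
  points (low_word (k :: s)) (invmx (reflection_lift k l) *m w *m reflection_lift k l).
Proof.
move=> l0 ks sw; apply: points_closureP.
move: (ae_and (ae_evalat_neq0 l0) (ae_spec w)); apply: ae_sub => z [[c c0 lc] [x wx]].
have sR := spec_reflection k lc c0.
have det1 : \det (sl2 k (mat2 0 c (- c^-1) 0)) != 0.
  rewrite (alg_det (G_alg D)) ?oner_neq0 //; apply/sl2_G/SL2_mat2.
  by rewrite mulr0 sub0r mulrN opprK divff.
have sI := spec_invmx sR det1; rewrite (reflection_inv k c0) in sI.
exists (sl2 k (mat2 0 (- c) c^-1 0) *m x *m sl2 k (mat2 0 c (- c^-1) 0)).
  exact (specM (specM sI wx) sR).
exact: low_word_reflection c0 ks (points_zclosure sw wx).
Qed.

Lemma bruhat_sl2 i g l : g != 0 -> l != 0 ->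
  coroot_val D i g *m exp_e D i (l / g) =
  exp_f i (g * l)^-1 *m reflection_lift i l *m exp_f i (g / l).
Proof.
move=> g0 l0; apply: ae_mx_eq.
move: (ae_and (ae_evalat_neq0 g0) (ae_evalat_neq0 l0)).
apply: ae_sub => z [[c c0 gc] [d d0 ld]].
exists (cor D i c *m xe D i (d / c)).
  apply: specM; first exact: spec_coroot.
  by apply: spec_exp_e; exact: evalat_div.
have -> : cor D i c *m xe D i (d / c) =
    xf D i (c * d)^-1 *m sl2 i (mat2 0 d (- d^-1) 0) *m xf D i (c / d).
  have dd : 0 * 0 - d * - d^-1 = 1 by rewrite mulr0 sub0r mulrN opprK divff.
  rewrite xe_mat2 cor_mat2 !xf_mat2 (sl2_mat2M D i (diag_det c0) (up_det _)).
  rewrite (sl2_mat2M D i (low_det _) dd) sl2_mat2M; last exact: low_det.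
    by apply: sl2_eq; field; rewrite ?c0 ?d0.
  by field; rewrite ?c0 ?d0.
apply: specM; last by apply: spec_exp_f; exact: evalat_div.
apply: specM; last exact: spec_reflection.
apply: spec_exp_f; apply: evalatV; first by rewrite mulf_neq0.
exact (relM (evalat_rel z) gc ld).
Qed.

Lemma cartan_factor_exp_f i j g u t : i != j -> g != 0 ->
  (coroot_val D j g *m exp_e D j u) *m exp_f i t =
  exp_f i (g ^ (- a j i) * t) *m (coroot_val D j g *m exp_e D j u).
Proof.
move=> ij g0; apply: ae_mx_eq.
move: (ae_and (ae_evalat_neq0 g0) (ae_and (ae_evalat u) (ae_evalat t))).
apply: ae_sub => z [[c c0 gc] [[d ud] [e te]]].
have s1 : spec z (coroot_val D j g *m exp_e D j u) (cor D j c *m xe D j d).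
  by apply: specM; [exact: spec_coroot|exact: spec_exp_e].
have s2 : spec z (exp_f i (g ^ (- a j i) * t)) (xf D i (c ^ (- a j i) * e)).
  apply: spec_exp_f; exact (relM (evalat_rel z) (evalat_expz _ c0 gc) te).
exists (cor D j c *m xe D j d *m xf D i e); first exact (specM s1 (spec_exp_f i te)).
have -> : cor D j c *m xe D j d *m xf D i e =
    xf D i (c ^ (- a j i) * e) *m (cor D j c *m xe D j d).
  have ji : j != i by rewrite eq_sym.
  exact (mulmx_twist2 (xe_xf D d e ji) (cor_xf D i j e c0)).
exact (specM s2 s1).
Qed.

(* Each factor is [n_k P_k m_k] with [n_k], [m_k] in the [k]-th lower root subgroup.
   The earlier factors, being in [B_+], commute with [n_k] up to a rescaling since
   [e_j] commutes with [f_k]; and [P_k] conjugates words in the earlier lower root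
   subgroups into [N_-]. *)
Lemma cell_of_prefix (g l : 'I_r -> K) (s : seq 'I_r) :
  (forall i, g i != 0) -> (forall i, l i != 0) -> uniq s ->
  exists u1 u2, [/\ points (low_word s) u1, points (low_word s) u2 &
    \big[mulmx/1%:M]_(i <- s) (coroot_val D i (g i) *m exp_e D i (l i / g i)) =
    u1 *m (\big[mulmx/1%:M]_(i <- s) reflection_lift i (l i)) *m u2].
Proof.
move=> g0 l0; elim/last_ind: s => [|s k IH] => [_|].
  exists 1%:M, 1%:M; split; try exact: points_low_word1.
  by rewrite !big_nil !mulmx1.
rewrite rcons_uniq => /andP[ks /IH[u1 [u2 [pu1 pu2 e]]]].
have commute t : exists t',
    \big[mulmx/1%:M]_(i <- s) (coroot_val D i (g i) *m exp_e D i (l i / g i))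
      *m exp_f k t =
    exp_f k t' *m
    \big[mulmx/1%:M]_(i <- s) (coroot_val D i (g i) *m exp_e D i (l i / g i)).
  elim: (s) ks {IH pu1 pu2 e} => [|j s' IHs].
    by exists t; rewrite !big_nil mulmx1 mul1mx.
  rewrite inE negb_or => /andP[kj /IHs[t' et']].
  exists (g j ^ (- a j k) * t'); rewrite !big_cons.
  exact (mulmx_twist2 et' (cartan_factor_exp_f _ _ kj (g0 j))).
have [t et] := commute (g k * l k)^-1.
have sub : {subset s <= rcons s k} by move=> i si; rewrite mem_rcons inE si orbT.
have kk : k \in rcons s k by rewrite mem_rcons inE eqxx.
pose P := reflection_lift k (l k).
have uP : P \in unitmx.
  apply: (points_unit (G_alg D)); apply: points_ae.
  move: (ae_evalat_neq0 (l0 k)); apply: ae_sub => z [c c0 lc].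
  exists (sl2 k (mat2 0 c (- c^-1) 0)); first exact: spec_reflection.
  apply/sl2_G/SL2_mat2.
  by rewrite mulr0 sub0r mulrN opprK divff.
exists (exp_f k t *m u1), (invmx P *m u2 *m P *m exp_f k (g k / l k)); split.
- apply: points_low_word_mul; first exact: points_low_word_exp_f.
  exact: points_low_word_subset pu1.
- apply: points_low_word_mul; last exact: points_low_word_exp_f.
  apply: (points_low_word_subset (s := k :: s)) => [i|].
    by rewrite mem_rcons.
  exact (points_reflection_conj (l0 k) ks pu2).
rewrite [LHS]big_mulmx_rcons [X in _ *m X *m _]big_mulmx_rcons.
apply: (etrans (congr1 (mulmx _) (bruhat_sl2 k (g0 k) (l0 k)))).
exact (cell_step _ et e uP).
Qed.

End OperCell.

(** * From opers to the QQ-system and back *)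

Lemma index_enum_ord_split r (i : 'I_r) :
  index_enum 'I_r = [seq j : 'I_r <- index_enum 'I_r | (j < i)%N] ++
                    i :: [seq j : 'I_r <- index_enum 'I_r | (i < j)%N].
Proof.
have -> : index_enum 'I_r = enum 'I_r by rewrite enumT.
have fE (P : pred nat) : map val [seq j : 'I_r <- enum 'I_r | P j] =
    [seq k <- iota 0 r | P k] by rewrite -val_enum_ord filter_map.
apply: (inj_map val_inj); rewrite map_cat map_cons.
rewrite (fE (fun k => (k < i)%N)) (fE (fun k => (i < k)%N)) val_enum_ord.
have {1}-> : iota 0 r = iota 0 i ++ (i : nat) :: iota i.+1 (r - i.+1).
  by rewrite -{1}(subnKC (ltn_ord i)) addSnnS iotaD.
have -> : iota 0 r = iota 0 i ++ (i : nat) :: iota i.+1 (r - i.+1).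
  by rewrite -{1}(subnKC (ltn_ord i)) addSnnS iotaD.
rewrite !filter_cat /= ltnn.
have lo : [seq k <- iota 0 i | (k < i)%N] = iota 0 i.
  by apply/all_filterP/allP => k; rewrite mem_iota.
have lo' : [seq k <- iota 0 i | (i < k)%N] = [::].
  rewrite -(filter_pred0 (iota 0 i)); apply: eq_in_filter => k.
  by rewrite mem_iota /= => /ltnW; rewrite leqNgt => /negPf.
have hi : [seq k <- iota i.+1 (r - i.+1) | (i < k)%N] = iota i.+1 (r - i.+1).
  by apply/all_filterP/allP => k; rewrite mem_iota => /andP[].
have hi' : [seq k <- iota i.+1 (r - i.+1) | (k < i)%N] = [::].
  rewrite -(filter_pred0 (iota i.+1 (r - i.+1))); apply: eq_in_filter => k.
  by rewrite mem_iota => /andP[/ltnW]; rewrite leqNgt => /negPf.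
by rewrite lo lo' hi hi' cats0.
Qed.

Section WeightProducts.
Variables (r : nat) (a : 'M[int]_r) (F : fieldType).

Definition above (f : 'I_r -> F) (i : 'I_r) : F :=
  \prod_(j < r | (i < j)%N) f j ^ (- a j i).
Definition below (f : 'I_r -> F) (i : 'I_r) : F :=
  \prod_(j < r | (j < i)%N) f j ^ (- a j i).

Lemma aboveM f g i : above (fun j => f j * g j) i = above f i * above g i.
Proof. by rewrite -big_split; apply: eq_bigr => j _; rewrite expfzMl. Qed.
Lemma belowM f g i : below (fun j => f j * g j) i = below f i * below g i.
Proof. by rewrite -big_split; apply: eq_bigr => j _; rewrite expfzMl. Qed.

Lemma aboveV f i : above (fun j => (f j)^-1) i = (above f i)^-1.
Proof. by rewrite -prodfV; apply: eq_bigr => j _; rewrite exprz_inv invr_expz. Qed.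

Lemma eq_above f g i : f =1 g -> above f i = above g i.
Proof. by move=> fg; apply: eq_bigr => j _; rewrite fg. Qed.
Lemma eq_below f g i : f =1 g -> below f i = below g i.
Proof. by move=> fg; apply: eq_bigr => j _; rewrite fg. Qed.

Lemma above_neq0 f i : (forall j, f j != 0) -> above f i != 0.
Proof. by move=> f0; apply/prodf_neq0 => j _; exact: expfz_neq0. Qed.
Lemma below_neq0 f i : (forall j, f j != 0) -> below f i != 0.
Proof. by move=> f0; apply/prodf_neq0 => j _; exact: expfz_neq0. Qed.

Lemma prod_ord_split (f : 'I_r -> F) (i : 'I_r) :
  \prod_(j < r) f j =
  f i * (\prod_(j < r | (i < j)%N) f j) * (\prod_(j < r | (j < i)%N) f j).
Proof.
rewrite {1}(index_enum_ord_split i) big_cat big_cons !big_filter /=.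
by rewrite mulrC.
Qed.

End WeightProducts.

Section FieldIdentities.
Variable F : fieldType.

Lemma qq_of_triangular (l z y y' w w' p p' m pz mz : F) :
  [/\ z != 0, y != 0, p != 0, m != 0 & pz != 0] ->
  l * (pz * p' * p^-1) = (y' * z) * (- w / (y * (y^-1 * p * m)))
     + (w' * (z^-1 * pz * mz)) * (y^-1 * p * m)^-1 ->
  (z / pz) * (- w) * y' - (z^-1 * mz) * (- w') * y = l * p' * m.
Proof.
move=> [z0 y0 p0 m0 pz0] e.
have -> : l * p' * m = (l * (pz * p' * p^-1)) * (p * m / pz) by field; rewrite pz0.
by rewrite e; field; rewrite z0 y0 p0 m0 pz0.
Qed.

Lemma triangular_of_qq (l z y y' w w' p p' m pz mz : F) :
  [/\ z != 0, y != 0, p != 0, m != 0 & pz != 0] ->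
  (z / pz) * (- w) * y' - (z^-1 * mz) * (- w') * y = l * p' * m ->
  l * (pz * p' * p^-1) = (y' * z) * (- w / (y * (y^-1 * p * m)))
     + (w' * (z^-1 * pz * mz)) * (y^-1 * p * m)^-1.
Proof.
move=> [z0 y0 p0 m0 pz0] e.
have -> : l * (pz * p' * p^-1) = (l * p' * m) * (pz / (p * m)).
  by field; rewrite p0 m0.
by rewrite -e; field; rewrite z0 y0 p0 m0 pz0.
Qed.

End FieldIdentities.

Lemma triangular_inv (F : fieldType) m (A B : 'M[F]_m) (v f : 'cV_m) x w y :
  B *m A = 1%:M -> x != 0 -> y != 0 ->
  A *m v = x *: v -> A *m f = w *: v + y *: f ->
  B *m v = x^-1 *: v /\ B *m f = (- w / (x * y)) *: v + y^-1 *: f.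
Proof.
move=> BA x0 y0 Av Af.
have Bv : B *m v = x^-1 *: v.
  have : B *m (A *m v) = v by rewrite mulmxA BA mul1mx.
  by rewrite Av -scalemxAr => {2}<-; rewrite scalerA mulVf ?scale1r.
split=> //; have : B *m (A *m f) = f by rewrite mulmxA BA mul1mx.
rewrite Af mulmxDr -!scalemxAr Bv => {2}<-.
rewrite scalerDr !scalerA mulVf // scale1r addrA -scalerDl.
have -> : - w / (x * y) + y^-1 * w / x = 0 by field; rewrite x0 y0.
by rewrite scale0r add0r.
Qed.

Section CartanActions.
Variables (R : realType) (n r : nat) (D : simple_group R n r).
Variable V : forall i : 'I_r, fund_rep D i.
Local Notation C := R[i].
Local Notation K := (ratfun R).
Local Notation ofp := (@ofpoly R).
Local Notation ofc := (@ofconst R).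
Local Notation G := (sg_G D).
Local Notation Bp := (sg_Bp D).
Local Notation a := (sg_a D).
Local Notation actsK := (acts V ofc).
Local Notation cw := (char_weight D).

Lemma char_weight_split (F : fieldType) (f : 'I_r -> F) i : f i != 0 ->
  cw f i = (f i)^-1 * above a f i * below a f i.
Proof.
move=> f0; rewrite /char_weight (prod_ord_split _ i) cartan_diag !mulrA.
congr (_ * _ * _); rewrite -[f i ^ (- 2)]/((f i ^+ 2)^-1) expr2 invfM mulrA.
by rewrite divff // mul1r.
Qed.

Lemma char_weight_neq0 (F : fieldType) (f : 'I_r -> F) i :
  (forall j, f j != 0) -> cw f i != 0.
Proof.
by move=> f0; rewrite mulf_neq0 //; apply/prodf_neq0 => j _; exact: expfz_neq0.
Qed.

Lemma actsK_eq i b x w y x' w' y' : actsK i b x w y ->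
  x = x' -> w = w' -> y = y' -> actsK i b x' w' y'.
Proof. by move=> ? <- <- <-. Qed.

Lemma actsK_prod_diag i (s : seq 'I_r) (F : 'I_r -> 'M[K]_n) x y :
  (forall j, points G (F j)) ->
  (forall j, j \in s -> actsK i (F j) (x j) 0 (y j)) ->
  actsK i (\big[mulmx/1%:M]_(j <- s) F j) (\prod_(j <- s) x j) 0 (\prod_(j <- s) y j).
Proof.
move=> GF; elim: s => [|j s IH] Fxy; first by rewrite !big_nil; exact: actsK1.
rewrite !big_cons.
have Fj := Fxy j (mem_head j s).
have Fs := IH (fun k ks => Fxy k (mem_behead (s := j :: s) ks)).
have := actsK_mul (GF j) (points_prod s (G_alg D) GF) Fj Fs.
by rewrite mulr0 mul0r addr0.
Qed.

Lemma actsK_prod_fix i (s : seq 'I_r) (F : 'I_r -> 'M[K]_n) y :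
  (forall j, points G (F j)) ->
  (forall j, j \in s -> actsK i (F j) 1 0 (y j)) ->
  actsK i (\big[mulmx/1%:M]_(j <- s) F j) 1 0 (\prod_(j <- s) y j).
Proof.
move=> GF Fy; have := actsK_prod_diag (x := fun=> 1) GF Fy.
by rewrite big1_eq.
Qed.

Lemma actsK_prod_unip i (s : seq 'I_r) (F : 'I_r -> 'M[K]_n) w :
  (forall j, points G (F j)) -> (forall j, actsK i (F j) 1 (w j) 1) ->
  actsK i (\big[mulmx/1%:M]_(j <- s) F j) 1 (\sum_(j <- s) w j) 1.
Proof.
move=> GF Fw; elim: s => [|j s IH]; first by rewrite !big_nil; exact: actsK1.
rewrite !big_cons.
have := actsK_mul (GF j) (points_prod s (G_alg D) GF) (Fw j) IH.
by rewrite !mulr1 !mul1r addrC.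
Qed.

Lemma points_coroot_G j t : t != 0 -> points G (coroot_val D j t).
Proof. by move=> t0; exact/(Bp_points_G (D := D))/points_coroot_Bp. Qed.

Lemma points_exp_e_G j t : points G (exp_e D j t).
Proof. exact/(Bp_points_G (D := D))/points_exp_e_Bp. Qed.

Lemma actsK_torus i (t : 'I_r -> K) : (forall j, t j != 0) ->
  actsK i (\big[mulmx/1%:M]_(j < r) coroot_val D j (t j)) (t i) 0 (cw t i).
Proof.
move=> t0; have GF j := points_coroot_G j (t0 j).
have := actsK_prod_diag (s := index_enum 'I_r) GF (fun j _ => actsK_coroot V i j (t0 j)).
have px : \prod_j (if j == i then t j else 1) = t i.
  by rewrite -big_mkcond big_pred1_eq.
by rewrite big_split /= px.
Qed.

Lemma factor_acts i j (g l : K) : g != 0 ->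
  actsK i (coroot_val D j g *m exp_e D j (l / g))
    (if j == i then g else 1) (if j == i then l else 0)
    ((if j == i then g else 1) * g ^ (- a j i)).
Proof.
move=> g0; have := actsK_mul (points_coroot_G j g0) (points_exp_e_G j (l / g))
  (actsK_coroot V i j g0) (actsK_exp_e V i j (l / g)).
rewrite !mulr1 addr0; case: (j == i); last by rewrite mulr0.
by rewrite [g * (l / g)]mulrC (divfK g0).
Qed.

Lemma points_factor_G j (g l : K) : g != 0 ->
  points G (coroot_val D j g *m exp_e D j (l / g)).
Proof. by move=> g0; exact: (points_mul (G_alg D) (points_coroot_G j g0) (points_exp_e_G j _)). Qed.

Lemma points_factor_Bp j (g l : K) : g != 0 ->
  points Bp (coroot_val D j g *m exp_e D j (l / g)).
Proof.
move=> g0; exact (points_mul (Bp_alg D) (points_coroot_Bp (D := D) j g0) (points_exp_e_Bp (D := D) j (l / g))).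
Qed.

Variable Lambda : 'I_r -> {poly C}.
Local Notation A g := (normal_form D Lambda g).

Lemma normal_form_Bp g : (forall j, g j != 0) -> points Bp (A g).
Proof. by move=> g0; apply: (points_prod _ (Bp_alg D)) => j; exact: points_factor_Bp. Qed.

Lemma actsK_normal_form i g : (forall j, g j != 0) ->
  actsK i (A g) (g i) (ofp (Lambda i) * above a g i) (cw g i).
Proof.
move=> g0; rewrite /normal_form.
set F := fun j : 'I_r => coroot_val D j (g j) *m exp_e D j (ofp (Lambda j) / g j).
have GF j : points G (F j) by exact: points_factor_G.
have Fi : actsK i (F i) (g i) (ofp (Lambda i)) (g i * g i ^ (- a i i)).
  by have := factor_acts i i (ofp (Lambda i)) (g0 i); rewrite eqxx.
have Fj j : j != i -> actsK i (F j) 1 0 (g j ^ (- a j i)).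
  by move=> /negPf ji; have := factor_acts i j (ofp (Lambda j)) (g0 j); rewrite ji mul1r.
pose lo := [seq j : 'I_r <- index_enum 'I_r | (j < i)%N].
pose hi := [seq j : 'I_r <- index_enum 'I_r | (i < j)%N].
have Flo : actsK i (\big[mulmx/1%:M]_(j <- lo) F j) 1 0 (below a g i).
  have -> : below a g i = \prod_(j <- lo) g j ^ (- a j i) by rewrite big_filter.
  apply: (actsK_prod_fix (s := lo) (y := fun j => g j ^ (- a j i)) GF) => j.
  rewrite mem_filter => /andP[ji _]; apply: Fj.
  by rewrite -val_eqE neq_ltn ji.
have Fhi : actsK i (\big[mulmx/1%:M]_(j <- hi) F j) 1 0 (above a g i).
  have -> : above a g i = \prod_(j <- hi) g j ^ (- a j i) by rewrite big_filter.
  apply: (actsK_prod_fix (s := hi) (y := fun j => g j ^ (- a j i)) GF) => j.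
  rewrite mem_filter => /andP[ji _]; apply: Fj.
  by rewrite -val_eqE neq_ltn ji orbT.
have eF : \big[mulmx/1%:M]_(j < r) F j =
   \big[mulmx/1%:M]_(j <- lo) F j *m (F i *m \big[mulmx/1%:M]_(j <- hi) F j).
  by rewrite {1}(index_enum_ord_split i) big_cat big_cons.
rewrite eF.
have GFhi := points_prod hi (G_alg D) GF.
have e1 := actsK_mul (GF i) GFhi Fi Fhi.
have e2 := actsK_mul (points_prod lo (G_alg D) GF) (points_mul (G_alg D) (GF i) GFhi) Flo e1.
apply: (actsK_eq e2); first by rewrite mulr1 mul1r.
  by rewrite mulr0 add0r mul0r addr0 mul1r.
have -> : cw g i = g i * (g i ^ (- a i i) * above a g i * below a g i).
  exact: congr1 (prod_ord_split _ i).
by rewrite mulrC !mulrA.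
Qed.

End CartanActions.

Lemma linear_agree (S : comNzRingType) m (M N : 'M[S]_m) (v f : 'cV_m) x y :
  M *m v = N *m v -> M *m f = N *m f ->
  M *m (x *: v + y *: f) = N *m (x *: v + y *: f).
Proof. by move=> e1 e2; rewrite !mulmxDr -!scalemxAr e1 e2. Qed.

Lemma vector_first (S : comNzRingType) m (v f : 'cV[S]_m) : v = 1 *: v + 0 *: f.
Proof. by rewrite scale1r scale0r addr0. Qed.

Lemma vector_second (S : comNzRingType) m (v f : 'cV[S]_m) : f = 0 *: v + 1 *: f.
Proof. by rewrite scale1r scale0r add0r. Qed.

Section PluckerCondition.
Variables (R : realType) (n r : nat) (D : simple_group R n r).
Variable V : forall i : 'I_r, fund_rep D i.
Local Notation C := R[i].
Local Notation K := (ratfun R).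
Local Notation ofp := (@ofpoly R).
Local Notation ofc := (@ofconst R).
Local Notation G := (sg_G D).
Local Notation Bp := (sg_Bp D).
Local Notation a := (sg_a D).
Local Notation rho i := (fr_rho (V i)).
Local Notation actsK := (acts V ofc).
Local Notation cw := (char_weight D).
Variables (q : C) (Lambda : 'I_r -> {poly C}) (zeta : 'I_r -> C).
Hypothesis q0 : q != 0.
Hypothesis q_infinite : forall m : nat, (0 < m)%N -> q ^+ m != 1.
Hypothesis zeta0 : forall i, zeta i != 0.
Hypothesis Lambda_monic : forall i, Lambda i \is monic.
Local Notation qs := (qshift q).
Local Notation A g := (normal_form D Lambda g).
Local Notation Z := (twist D zeta).
Local Notation zetaK := (fun j => ofc (zeta j) : K).

Lemma zetaK_neq0 j : ofc (zeta j) != 0.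
Proof. by rewrite /ofconst ofpoly_eq0 polyC_eq0. Qed.

Lemma actsK_shift i b x w y : actsK i b x w y ->
  actsK i (map_mx qs b) (qs x) (qs w) (qs y).
Proof.
move=> [b1 b2]; have qc := qshift_ofconst q0.
have rE : mxapp ofc (rho i) (map_mx qs b) = map_mx qs (mxapp ofc (rho i) b).
  by rewrite (mxapp_map (phi := qshift_morph q0) (kappa := ofc) (rho i) b qc).
have cE (u : 'cV[C]_(fr_dim (V i))) : map_mx qs (map_mx ofc u) = map_mx ofc u.
  by apply/matrixP => k l; rewrite !mxE; exact: qc.
have M := map_mxM (qshift_morph q0).
split; rewrite rE -{1}cE.
  have := congr1 (map_mx (qshift_morph q0)) b1.
  by rewrite M map_mxZ /= !cE.
have := congr1 (map_mx (qshift_morph q0)) b2.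
by rewrite M map_mxD !map_mxZ /= !cE.
Qed.

Lemma actsK_inv i b x w y : points G b -> x != 0 -> y != 0 -> actsK i b x w y ->
  actsK i (invmx b) x^-1 (- w / (x * y)) y^-1.
Proof.
move=> Gb x0 y0 [b1 b2]; have e := rhoMK V i (points_inv (G_alg D) Gb) Gb.
rewrite (mulVmx (points_unit (G_alg D) Gb)) rho1K in e.
exact (triangular_inv (esym e) x0 y0 b1 b2).
Qed.

Lemma points_twist : points G Z.
Proof. by apply: (points_prod _ (G_alg D)) => j; apply/points_coroot_G/zetaK_neq0. Qed.

Lemma actsK_twist i : actsK i Z (ofc (zeta i)) 0 (cw zetaK i).
Proof. exact: (actsK_torus V i zetaK_neq0). Qed.

Lemma actsK_twisted i v x w y : points G v -> x != 0 -> y != 0 -> actsK i v x w y ->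
  actsK i (map_mx qs v *m Z *m invmx v) (qs x * ofc (zeta i) / x)
    (qs x * ofc (zeta i) * (- w / (x * y)) + qs w * cw zetaK i / y)
    (qs y * cw zetaK i / y).
Proof.
move=> Gv x0 y0 vx; have Gsv := points_qshift q0 Gv.
have e1 := actsK_mul Gsv points_twist (actsK_shift vx) (actsK_twist i).
have e2 := actsK_mul (points_mul (G_alg D) Gsv points_twist)
  (points_inv (G_alg D) Gv) e1 (actsK_inv Gv x0 y0 vx).
by apply: (actsK_eq e2) => //; rewrite mulr0 add0r.
Qed.

Definition plucker_entry g i := ofp (Lambda i) * above a g i.

Lemma miura_pluckerP g : (forall j, g j != 0) ->
  miura_plucker q zeta V (A g) <->
  exists2 v, points Bp v & forall i,
    actsK i (map_mx qs v *m Z *m invmx v) (g i) (plucker_entry g i) (cw g i).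
Proof.
move=> g0; have Ag i := actsK_normal_form V Lambda i g0.
split=> -[v Bv vP]; (exists v; first exact Bv) => i.
  have [e1 e2] := Ag i.
  have W1 : W_space (V := V i) (map_mx ofc (fr_nu (V i))).
    by exists 1, 0; exact: vector_first.
  have W2 : W_space (V := V i) (map_mx ofc (fr_fnu (V i))).
    by exists 0, 1; exact: vector_second.
  split; first exact (etrans (esym (vP i _ W1)) e1).
  exact (etrans (esym (vP i _ W2)) e2).
move=> w [x [y ->]]; have [e1 e2] := Ag i; have [h1 h2] := vP i.
exact (linear_agree _ _ (etrans e1 (esym h1)) (etrans e2 (esym h2))).
Qed.

Lemma cartan_of_neq0 y i : (forall j, y j != 0) -> cartan_of q zeta y i != 0.
Proof.
move=> y0; apply: mulf_neq0; last exact: invr_neq0.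
by apply: mulf_neq0; [exact: zetaK_neq0|rewrite (qshift_eq0 q0)].
Qed.

Lemma above_cartan_of (y : 'I_r -> K) i : above a (cartan_of q zeta y) i =
  above a zetaK i * above a (fun j => qs (y j)) i * (above a y i)^-1.
Proof. by rewrite -aboveV -!aboveM. Qed.

Lemma qshift_above (y : 'I_r -> K) i : qs (above a y i) = above a (fun j => qs (y j)) i.
Proof. by rewrite /above (qshift_prod q0); apply: eq_bigr => j _; exact: qshiftXz. Qed.

Definition qq_equation (y : 'I_r -> K) (m : 'I_r -> K) i : Prop :=
  ofc (xi_tilde D zeta i) * m i * qs (y i) - ofc (xi D zeta i) * qs (m i) * y i
  = ofp (Lambda i) * above a (fun j => qs (y j)) i * below a y i.

Lemma xi_tildeE i : ofc (xi_tilde D zeta i) = ofc (zeta i) / above a zetaK i.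
Proof.
rewrite /xi_tilde rmorphM /above -prodfV rmorph_prod; congr (_ * _).
by apply: eq_bigr => j _; rewrite invr_expz opprK fmorphXz.
Qed.

Lemma xiE i : ofc (xi D zeta i) = (ofc (zeta i))^-1 * below a zetaK i.
Proof.
rewrite /xi rmorphM fmorphV /below rmorph_prod; congr (_ * _).
by apply: eq_bigr => j _; rewrite fmorphXz.
Qed.

Lemma plucker_entry_cartan_of (y : 'I_r -> K) i : plucker_entry (cartan_of q zeta y) i =
  ofp (Lambda i) * (above a zetaK i * above a (fun j => qs (y j)) i * (above a y i)^-1).
Proof. by rewrite /plucker_entry above_cartan_of. Qed.

Lemma qq_nondeg (y : 'I_r -> K) i : (forall j, y j != 0) ->
  [/\ ofc (zeta i) != 0, y i != 0, above a y i != 0, below a y i != 0 &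
      above a zetaK i != 0].
Proof.
move=> y0; split=> //; [exact: zetaK_neq0|exact: above_neq0|exact: below_neq0|].
by apply: above_neq0 => j; exact: zetaK_neq0.
Qed.

(* The entry of [v(qz) Z v(z)^-1] on [W_i] is the one of the oper iff the entries
   [- m i] of [v] solve the QQ-system. *)
Lemma qq_equationP (y m : 'I_r -> K) i : (forall j, y j != 0) ->
  qq_equation y m i <->
  plucker_entry (cartan_of q zeta y) i =
    qs (y i) * ofc (zeta i) * (- - m i / (y i * cw y i)) +
    qs (- m i) * cw zetaK i / cw y i.
Proof.
move=> y0; rewrite plucker_entry_cartan_of (char_weight_split D (y0 i)).
rewrite (char_weight_split D (zetaK_neq0 i)) /qq_equation xi_tildeE xiE.
have qN : qs (- m i) = - qs (m i) by exact: (rmorphN (qshift_morph q0)).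
have nd := qq_nondeg i y0; split=> e.
  rewrite qN; apply: (triangular_of_qq (p' := above a (fun j => qs (y j)) i) nd).
  by rewrite !opprK; exact e.
rewrite qN in e.
have := qq_of_triangular nd e; rewrite !opprK; exact.
Qed.

End PluckerCondition.

Lemma clear_constants (F : fieldType) (s t m m' y y' c l u w p p' : F) :
  u != 0 -> w != 0 ->
  s * m * (c * y') - t * m' * (c * y) = l * (u * p') * (w * p) ->
  s * (c / (u * w) * m) * y' - t * (c / (u * w) * m') * y = l * p' * p.
Proof.
move=> u0 w0 e; have -> : l * p' * p = l * (u * p') * (w * p) / (u * w).
  by field; rewrite u0 w0.
by rewrite -e; field; rewrite u0 w0.
Qed.

Section Zeros.
Variable R : realType.
Local Notation C := R[i].
Local Notation K := (ratfun R).
Local Notation ofp := (@ofpoly R).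

Lemma is_zeroE (f : K) x : is_zero f x <-> evalat x f 0.
Proof.
split=> [[p [s [sx px ->]]]|[p [s [sx /esym/eqP px ->]]]].
  by exists p, s; rewrite px mul0r.
exists p, s; split=> //; move: px; rewrite mulf_eq0 invr_eq0 (negPf sx) orbF.
by move/eqP.
Qed.

Lemma is_zero_ofpoly (p : {poly C}) x : is_zero (ofp p) x <-> root p x.
Proof.
split=> [/is_zeroE h|/rootP px]; last by apply/is_zeroE; rewrite -px; exact: evalat_ofpoly.
by apply/rootP; exact: evalat_uniq (evalat_ofpoly x p) h.
Qed.

Lemma zero_or_pole_ofpoly (p : {poly C}) x : p != 0 ->
  zero_or_pole (ofp p) x <-> root p x.
Proof.
move=> p0; split=> [[/is_zero_ofpoly //|/is_zeroE h]|/is_zero_ofpoly]; last by left.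
have := relM (evalat_rel x) (evalat_ofpoly x p) h.
rewrite mulr0 divff ?ofpoly_eq0 // => h1; have := evalat_uniq h1 (evalat1 x).
by move/eqP; rewrite eq_sym oner_eq0.
Qed.

Lemma q_distinct_shift (q x w : C) : q != 0 -> q_distinct q x (q * w) -> q_distinct q x w.
Proof.
move=> q0 h k l; have e : q ^ l = q ^ (l - 1) * q.
  by rewrite -[X in _ * X]expr1z -expfzDr // subrK.
by rewrite e -mulrA; exact: h.
Qed.

Lemma not_q_distinct_diag (q x : C) : ~ q_distinct q x x.
Proof. by move=> /(_ 0 0); rewrite eqxx. Qed.

End Zeros.

Section OperConstruction.
Variables (R : realType) (n r : nat) (D : simple_group R n r).
Variable V : forall i : 'I_r, fund_rep D i.
Local Notation C := R[i].
Local Notation K := (ratfun R).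
Local Notation ofp := (@ofpoly R).
Local Notation ofc := (@ofconst R).
Local Notation Bp := (sg_Bp D).
Local Notation a := (sg_a D).
Local Notation actsK := (acts V ofc).
Local Notation cw := (char_weight D).
Variables (q : C) (Lambda : 'I_r -> {poly C}) (zeta : 'I_r -> C).
Hypothesis q0 : q != 0.
Hypothesis q_infinite : forall m : nat, (0 < m)%N -> q ^+ m != 1.
Hypothesis zeta0 : forall i, zeta i != 0.
Hypothesis Lambda_monic : forall i, Lambda i \is monic.
Hypothesis zeta_gen : zeta_generic D q zeta.
Local Notation qs := (qshift q).
Local Notation A g := (normal_form D Lambda g).
Local Notation zetaK := (fun j => ofc (zeta j) : K).

Lemma char_weightM (F : fieldType) (f g : 'I_r -> F) i :
  cw (fun j => f j * g j) i = cw f i * cw g i.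
Proof.
rewrite /char_weight mulrACA -big_split; congr (_ * _).
by apply: eq_bigr => j _; rewrite expfzMl.
Qed.

Lemma char_weightV (F : fieldType) (f : 'I_r -> F) i :
  cw (fun j => (f j)^-1) i = (cw f i)^-1.
Proof.
rewrite /char_weight invfM -prodfV; congr (_ * _).
by apply: eq_bigr => j _; rewrite exprz_inv invr_expz.
Qed.

Lemma eq_char_weight (F : fieldType) (f g : 'I_r -> F) i : f =1 g -> cw f i = cw g i.
Proof.
by move=> fg; rewrite /char_weight fg; congr (_ * _); apply: eq_bigr => j _; rewrite fg.
Qed.

Lemma qshift_char_weight (f : 'I_r -> K) i : qs (cw f i) = cw (fun j => qs (f j)) i.
Proof.
rewrite /char_weight (qshiftM q0) (qshift_prod q0); congr (_ * _).
by apply: eq_bigr => j _; exact: qshiftXz.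
Qed.

Lemma char_weight_cartan_of (y : 'I_r -> K) i :
  cw (cartan_of q zeta y) i = qs (cw y i) * cw zetaK i / cw y i.
Proof.
rewrite qshift_char_weight -char_weightV mulrAC -!char_weightM.
by apply: eq_char_weight => j; rewrite /cartan_of [ofc _ * _]mulrC mulrAC.
Qed.

Lemma gauge1 (B : 'M[K]_n) : gauge q 1%:M B = B.
Proof.
by rewrite /gauge (map_mx1 (qshift_morph q0)) mul1mx invmx1 mulmx1.
Qed.

Lemma oper_iso_refl O : oper_iso D q O O.
Proof.
have p1 := @points1 R n.
exists 1%:M; split; first exact (p1 _ (G_alg D)).
- by rewrite gauge1.
- by exists 1%:M; [exact (p1 _ (Bm_alg D))|rewrite mul1mx mulmx1].
- by exists 1%:M; [exact (p1 _ (Bp_alg D))|rewrite mul1mx mulmx1].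
Qed.

Lemma Lambda_neq0 i : ofp (Lambda i) != 0.
Proof. by rewrite ofpoly_eq0 monic_neq0. Qed.

Lemma normal_oper_miura g : (forall j, g j != 0) ->
  miura_oper D q Lambda (normal_oper D Lambda g).
Proof.
move=> g0; have Bg := normal_form_Bp (D := D) Lambda g0.
have p1 := @points1 R n.
split=> /=.
- exact (Bp_points_G Bg).
- exact (p1 _ (G_alg D)).
- exact (p1 _ (G_alg D)).
- exists 1%:M; first exact (p1 _ (Bm_alg D)).
  rewrite mulmx1 invmx1 gauge1.
  have [u1 [u2 [pu1 pu2 e]]] := cell_of_prefix D g0 Lambda_neq0 (index_enum_uniq 'I_r).
  exists u1, u2; split; last exact e.
    by apply: points_sub pu1 => x; exact: low_word_Nm.
  by apply: points_sub pu2 => x; exact: low_word_Nm.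
- by rewrite invmx1 gauge1.
Qed.

Lemma miura_plucker_of_qq (y m : 'I_r -> K) : (forall j, y j != 0) ->
  (forall i, qq_equation D q Lambda zeta y m i) ->
  miura_plucker q zeta V (A (cartan_of q zeta y)).
Proof.
move=> y0 qq; have g0 j := cartan_of_neq0 q0 zeta0 j y0.
apply/(miura_pluckerP V q Lambda zeta g0).
pose T := \big[mulmx/1%:M]_(j < r) coroot_val D j (y j).
pose U := \big[mulmx/1%:M]_(j < r) exp_e D j (- m j / y j).
have BT : points Bp T by apply: (points_prod _ (Bp_alg D)) => j; exact: points_coroot_Bp.
have BU : points Bp U by apply: (points_prod _ (Bp_alg D)) => j; exact: points_exp_e_Bp.
have GT := Bp_points_G BT; have GU := Bp_points_G BU.
exists (T *m U) => [|i]; first exact (points_mul (Bp_alg D) BT BU).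
have aT : actsK i T (y i) 0 (cw y i) := actsK_torus V i y0.
have aU : actsK i U 1 (- m i / y i) 1.
  have := actsK_prod_unip (V := V) (index_enum 'I_r) (F := fun j => exp_e D j (- m j / y j))
    (fun j => points_exp_e_G (D := D) j _) (fun j => actsK_exp_e V i j _).
  by rewrite -big_mkcond big_pred1_eq.
have aTU := actsK_mul GT GU aT aU.
have aV : actsK i (T *m U) (y i) (- m i) (cw y i).
  apply: (actsK_eq aTU); rewrite ?mulr1 //.
  by rewrite addr0 mulrC (divfK (y0 i)).
have c0 := char_weight_neq0 D i y0.
have := actsK_twisted q0 zeta0 (points_mul (G_alg D) GT GU) (y0 i) c0 aV.
move=> e; apply: (actsK_eq e).
- by rewrite /cartan_of [ofc _ * _]mulrC.
- by apply/esym/(qq_equationP D Lambda q0 zeta0 m i y0); exact: qq.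
- by rewrite char_weight_cartan_of.
Qed.

Lemma xi_ratio i : xi_tilde D zeta i / xi D zeta i = \prod_(j < r) zeta j ^ a j i.
Proof.
rewrite (prod_ord_split _ i) cartan_diag /xi_tilde /xi invfM invrK mulrACA.
rewrite -[zeta i ^ 2]/(zeta i ^+ 2) expr2 -!mulrA; congr (_ * (_ * (_ * _))).
by rewrite -prodfV; apply: eq_bigr => j _; rewrite invr_expz opprK.
Qed.

Lemma xi_neq0 i : xi D zeta i != 0.
Proof.
rewrite /xi mulf_neq0 ?invr_eq0 //; apply/prodf_neq0 => j _; exact: expfz_neq0.
Qed.

Lemma xi_tilde_neq0 i : xi_tilde D zeta i != 0.
Proof. by rewrite /xi_tilde mulf_neq0 //; apply/prodf_neq0 => j _; exact: expfz_neq0. Qed.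

Lemma xi_generic i : ~ in_qZ q (xi_tilde D zeta i / xi D zeta i).
Proof. by rewrite xi_ratio; exact: zeta_gen. Qed.

End OperConstruction.

Lemma ratio_invariant (F : fieldType) (z x y x' y' : F) :
  z != 0 -> x != 0 -> y != 0 -> y' != 0 ->
  z * y' / y = x' * z / x -> x' / y' = x / y.
Proof.
move=> z0 x0 y0 y0' e; have -> : x' = (x' * z / x) * (x / z) by field; rewrite x0 z0.
by rewrite -e; field; rewrite z0 y0 y0'.
Qed.

Section Bijection.
Variables (R : realType) (n r : nat) (D : simple_group R n r).
Variable V : forall i : 'I_r, fund_rep D i.
Local Notation C := R[i].
Local Notation K := (ratfun R).
Local Notation ofp := (@ofpoly R).
Local Notation ofc := (@ofconst R).
Local Notation a := (sg_a D).
Local Notation actsK := (acts V ofc).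
Local Notation cw := (char_weight D).
Variables (q : C) (Lambda : 'I_r -> {poly C}) (zeta : 'I_r -> C).
Hypothesis q0 : q != 0.
Hypothesis q_infinite : forall m : nat, (0 < m)%N -> q ^+ m != 1.
Hypothesis zeta0 : forall i, zeta i != 0.
Hypothesis Lambda_monic : forall i, Lambda i \is monic.
Hypothesis zeta_gen : zeta_generic D q zeta.
Local Notation qs := (qshift q).
Local Notation A g := (normal_form D Lambda g).
Local Notation zetaK := (fun j => ofc (zeta j) : K).

Lemma evalat_expz_weak z (f : K) c (k : int) : (k = 0) \/ (c != 0) ->
  evalat z f c -> evalat z (f ^ k) (c ^ k) /\ c ^ k != 0.
Proof.
move=> [->|c0] fc; first by rewrite !expr0z oner_neq0; split=> //; exact: evalat1.
by split; [exact: evalat_expz|exact: expfz_neq0].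
Qed.

Lemma evalat_prod_neq0 z (P : pred 'I_r) (f : 'I_r -> K) :
  (forall j, P j -> exists2 c, c != 0 & evalat z (f j) c) ->
  exists2 c, c != 0 & evalat z (\prod_(j < r | P j) f j) c.
Proof.
move=> h; apply: (big_ind (fun x => exists2 c, c != 0 & evalat z x c)) => [|x y [c c0 xc] [d d0 yd]|j /h //].
  by exists 1; [exact: oner_neq0|exact: evalat1].
exists (c * d); first by rewrite mulf_neq0.
exact (relM (evalat_rel z) xc yd).
Qed.

Lemma rho_fun_zero (Q : 'I_r -> {poly C}) i w :
  is_zero (rho_fun D q Lambda zeta (fun j => ofp (Q j)) i) w ->
  root (Lambda i) w \/ exists j, [/\ j != i, a j i != 0 &
    root (Q j) (q * w) \/ root (Q j) w].
Proof.
move=> /is_zeroE z0.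
have [Lw|Lw] := boolP (root (Lambda i) w); first by left.
right; have [/existsP[j /and3P[ji aji /orP h]]|] := boolP
    [exists j, [&& j != i, a j i != 0 & root (Q j) (q * w) || root (Q j) w]].
  by exists j.
rewrite negb_exists => /forallP nr.
have nrj j : j != i -> a j i = 0 \/ (~~ root (Q j) (q * w) /\ ~~ root (Q j) w).
  move=> ji; have := nr j; rewrite ji /= negb_and negbK negb_or.
  by case/orP => [/eqP|/andP]; [left|right].
have ne (j : 'I_r) : (i < j)%N || (j < i)%N -> j != i by rewrite -val_eqE neq_ltn orbC.
have [c c0 cE] : exists2 c, c != 0 & evalat w
    (\prod_(j < r | (i < j)%N) (ofc (zeta j) * qs (ofp (Q j))) ^ (- a j i)) c.
  apply: evalat_prod_neq0 => j ij.
  have e := relM (evalat_rel w) (evalat_ofconst w (zeta j))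
    (evalat_qshift q0 (evalat_ofpoly (q * w) (Q j))).
  have ji : j != i by rewrite ne // ij.
  have [|e1 e2] := @evalat_expz_weak _ _ _ (- a j i) _ e.
    have [->|[h _]] := nrj j ji; first by left; rewrite oppr0.
    by right; rewrite mulf_neq0.
  by exists ((zeta j * (Q j).[q * w]) ^ (- a j i)).
have [d d0 dE] : exists2 c, c != 0 & evalat w
    (\prod_(j < r | (j < i)%N) (ofp (Q j)) ^ (- a j i)) c.
  apply: evalat_prod_neq0 => j ij.
  have ji : j != i by rewrite ne // ij orbT.
  have [|e1 e2] := @evalat_expz_weak _ _ _ (- a j i) _ (evalat_ofpoly w (Q j)).
    have [->|[_ h]] := nrj j ji; first by left; rewrite oppr0.
    by right.
  by exists ((Q j).[w] ^ (- a j i)).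
have e := relM (evalat_rel w) (relM (evalat_rel w) (evalat_ofpoly w (Lambda i)) cE) dE.
have := evalat_uniq z0 e => /esym/eqP.
by rewrite !mulf_eq0 (negPf c0) (negPf d0) !orbF -[_ == 0]/(root _ _) (negPf Lw).
Qed.

Lemma neighbor i : (1 < r)%N -> exists2 j, j != i & a j i != 0.
Proof.
move=> r1; have [/existsP[j /andP[ji aji]]|] :=
    boolP [exists j, (j != i) && (a j i != 0)]; first by exists j.
rewrite negb_exists => /forallP h.
have J0 : finset.setC (finset.set1 i) != finset.set0.
  by rewrite -card_gt0 cardsC1 card_ord -subn1 subn_gt0.
have /(congr1 (fun J : {set 'I_r} => i \in J)) : finset.setC (finset.set1 i) = finset.setT.
  apply: (sg_indecomposable (s := D) J0) => j k.
  rewrite !finset.in_setC !finset.in_set1 negbK => ji /eqP->; apply/eqP.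
  by have := h j; rewrite ji /= negbK.
by rewrite finset.in_setC finset.in_set1 finset.in_setT eqxx.
Qed.

Lemma solution_oper Q : nondegenerate_solution D q Lambda zeta Q ->
  nondegenerate_ZMP_oper q Lambda zeta V (oper_of D q Lambda zeta Q).
Proof.
move=> [qq mon _ dist dist1]; set y := fun j : 'I_r => ofp (Q.1 j).
have y0 j : y j != 0 by rewrite ofpoly_eq0 monic_neq0.
have g0 j := cartan_of_neq0 q0 zeta0 j y0.
have Q0 j : Q.1 j != 0 by rewrite monic_neq0.
exists y; split.
- exact: normal_oper_miura.
- exact: y0.
- exact: oper_iso_refl.
- have qqE i : qq_equation D q Lambda zeta y (fun j => ofp (Q.2 j)) i by exact (qq i).
  exact (miura_plucker_of_qq V q0 zeta0 y0 qqE).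
split=> [_ i j k ij aik ajk x /(zero_or_pole_ofpoly _ (Q0 i)) rx|i].
  have [d1 d2] := dist i j k ij aik ajk x rx; split=> // w.
  by move/(zero_or_pole_ofpoly _ (Q0 j)); exact: d1.
split=> [|x w /is_zero_ofpoly rx]; first by exists (Q.1 i).
have aii : a i i != 0 by rewrite cartan_diag.
move/rho_fun_zero => [Lw|[j [ji aji]]].
  have [r1|r1] := leqP r 1; last first.
    have [j ji aji] := neighbor i r1; rewrite eq_sym in ji.
    by have [_] := dist i j i ji aii aji x rx; apply.
  by apply: (dist1 _ i) => //; apply/eqP; rewrite eqn_leq r1 (leq_ltn_trans _ (ltn_ord i)).
rewrite eq_sym in ji; have [d1 _] := dist i j i ji aii aji x rx.
by case=> /d1 //; exact: q_distinct_shift.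
Qed.

Lemma rational_poly_power (k : int) (p : {poly C}) : 0 <= k ->
  exists s, ofp p ^ k = ofp s.
Proof.
by case: k => // k _; exists (p ^+ k); rewrite rmorphXn.
Qed.

Lemma poly_prod (P : pred 'I_r) (f : 'I_r -> K) :
  (forall j, P j -> exists s, f j = ofp s) -> exists s, \prod_(j < r | P j) f j = ofp s.
Proof.
move=> h; apply: (big_ind (fun x => exists s, x = ofp s)) => [|x y [s ->] [t ->]|j /h //].
  by exists 1; rewrite ofpoly1.
by exists (s * t); rewrite ofpolyM.
Qed.

Lemma qq_rhs_poly (Q : 'I_r -> {poly C}) i : exists s,
  ofp (Lambda i) * above a (fun j => qs (ofp (Q j))) i * below a (fun j => ofp (Q j)) i
  = ofp s.
Proof.
have na j : j != i -> 0 <= - a j i by move=> ji; rewrite oppr_ge0; exact: cartan_nonpos.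
have [s1 e1] : exists s, above a (fun j => qs (ofp (Q j))) i = ofp s.
  apply: poly_prod => j ij; rewrite (qshift_ofpoly q0); apply: rational_poly_power.
  by apply: na; rewrite -val_eqE neq_ltn ij orbT.
have [s2 e2] : exists s, below a (fun j => ofp (Q j)) i = ofp s.
  apply: poly_prod => j ij; apply: rational_poly_power.
  by apply: na; rewrite -val_eqE neq_ltn ij.
by exists (Lambda i * s1 * s2); rewrite e1 e2 !ofpolyM.
Qed.

Lemma twisted_qq (y : 'I_r -> K) : (forall j, y j != 0) ->
  miura_plucker q zeta V (A (cartan_of q zeta y)) ->
  exists chi : 'I_r -> K, exists c : 'I_r -> C, [/\ forall j, c j != 0,
    forall j, chi j = ofc (c j) * y j &
    forall i, exists m, qq_equation D q Lambda zeta chi (fun=> m) i].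
Proof.
move=> y0; have g0 j := cartan_of_neq0 q0 zeta0 j y0.
move/(miura_pluckerP V q Lambda zeta g0) => [v Bv vP].
have [chi chi0 chiP] := actsK_Bp V Bv; exists chi.
have tw i : exists w, [/\ actsK i v (chi i) w (cw chi i),
    cartan_of q zeta y i = qs (chi i) * ofc (zeta i) / chi i &
    plucker_entry D Lambda (cartan_of q zeta y) i =
      qs (chi i) * ofc (zeta i) * (- w / (chi i * cw chi i)) +
      qs w * cw zetaK i / cw chi i].
  have [w [vw _]] := chiP i; exists w.
  have := actsK_twisted q0 zeta0 (Bp_points_G Bv) (chi0 i) (char_weight_neq0 D i chi0) vw.
  by move=> /(actsK_uniq (vP i))[].
have cst j : exists c, c != 0 /\ chi j = ofc c * y j.
  have [w [_ e _]] := tw j.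
  have inv : qs (chi j / y j) = chi j / y j.
    rewrite (qshiftM q0) (qshiftV q0); move: e; rewrite /cartan_of.
    have y1 : qs (y j) != 0 by rewrite (qshift_eq0 q0).
    exact (ratio_invariant (zetaK_neq0 zeta0 j) (chi0 j) (y0 j) y1).
  have [c ec] := qshift_invariant q0 q_infinite inv; exists c.
  have e' : chi j = ofc c * y j by rewrite -ec divfK.
  split=> //; apply: contraNneq (chi0 j) => c0.
  by rewrite e' c0 rmorph0 mul0r.
have [c cP] := fin_all_exists cst; exists c; split=> [j|j|i].
- by have [] := cP j.
- by have [] := cP j.
have [w [_ _ e]] := tw i; exists (- w).
apply/(qq_equationP D Lambda q0 zeta0 _ i chi0); rewrite !opprK -e.
apply: (congr1 (fun u => ofp (Lambda i) * u)); apply: eq_above => j.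
have [w' [_ -> _]] := tw j.
by rewrite /cartan_of [ofc _ * _]mulrC.
Qed.

End Bijection.

Lemma cancel_constant (F : fieldType) (z c x y : F) : c != 0 ->
  z * (c * x) / (c * y) = z * x / y.
Proof. by move=> c0; rewrite mulrCA -mulf_div divff // mul1r. Qed.

Lemma ord_subsingleton r (i j : 'I_r) : (r <= 1)%N -> i = j.
Proof. by case: r i j => [[]|[i j _|]] //; rewrite !ord1. Qed.

Section Surjectivity.
Variables (R : realType) (n r : nat) (D : simple_group R n r).
Variable V : forall i : 'I_r, fund_rep D i.
Local Notation C := R[i].
Local Notation K := (ratfun R).
Local Notation ofp := (@ofpoly R).
Local Notation ofc := (@ofconst R).
Local Notation a := (sg_a D).
Variables (q : C) (Lambda : 'I_r -> {poly C}) (zeta : 'I_r -> C).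
Hypothesis q0 : q != 0.
Hypothesis q_infinite : forall m : nat, (0 < m)%N -> q ^+ m != 1.
Hypothesis zeta0 : forall i, zeta i != 0.
Hypothesis zeta_gen : zeta_generic D q zeta.
Local Notation qs := (qshift q).

Lemma qq_equation_ext (y y' : 'I_r -> K) m m' i : y =1 y' -> m i = m' i ->
  qq_equation D q Lambda zeta y m i -> qq_equation D q Lambda zeta y' m' i.
Proof.
move=> ey em; rewrite /qq_equation -em -(ey i).
have -> : above a (fun j => qs (y j)) i = above a (fun j => qs (y' j)) i.
  by apply: eq_above => j; rewrite ey.
by have -> : below a y i = below a y' i by exact: eq_below.
Qed.

Lemma qq_equation_scale (y chi : 'I_r -> K) c m i : (forall j, c j != 0) ->
  (forall j, chi j = ofc (c j) * y j) -> qq_equation D q Lambda zeta chi m i ->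
  exists m', qq_equation D q Lambda zeta y (fun=> m') i.
Proof.
move=> c0 chiE; pose cK : 'I_r -> K := fun j => ofc (c j).
have cK0 j : cK j != 0 by rewrite /cK /ofconst ofpoly_eq0 polyC_eq0.
have qc j : qs (cK j) = cK j by exact: qshift_ofconst.
rewrite /qq_equation chiE (qshiftM q0) (qc i).
have -> : above a (fun j => qs (chi j)) i = above a cK i * above a (fun j => qs (y j)) i.
  by rewrite -aboveM; apply: eq_above => j; rewrite chiE (qshiftM q0) (qc j).
have -> : below a chi i = below a cK i * below a y i.
  by rewrite -belowM; apply: eq_below => j; rewrite chiE.
have u0 := above_neq0 a i cK0; have w0 := below_neq0 a i cK0.
move=> /(clear_constants u0 w0) e.
exists (cK i / (above a cK i * below a cK i) * m i).
have kE : qs (cK i / (above a cK i * below a cK i)) = cK i / (above a cK i * below a cK i).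
  rewrite (qshiftM q0) (qshiftV q0) (qshiftM q0) (qc i); congr (_ / (_ * _)).
    exact (etrans (qshift_above D q0 cK i) (eq_above a i qc)).
  by rewrite /below (qshift_prod q0); apply: eq_bigr => j _; rewrite (qshiftXz q0) (qc j).
by rewrite (qshiftM q0) kE.
Qed.

Lemma oper_solution O y : nondegenerate_ZMP q Lambda zeta V O y -> q_generic q y ->
  exists Q, nondegenerate_solution D q Lambda zeta Q /\
    oper_iso D q O (oper_of D q Lambda zeta Q).
Proof.
move=> [_ y0 iso mp [Hnd nd]] gen.
have [p pE] := fin_all_exists (fun i => (nd i).1).
have p0 i : p i != 0 by rewrite -(@ofpoly_eq0 R) -pE.
have l0 i : lead_coef (p i) != 0 by rewrite lead_coef_eq0.
pose Qp i := (lead_coef (p i))^-1 *: p i.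
have Qmon i : Qp i \is monic by rewrite monicE lead_coefZ mulVf.
have Q0 i : Qp i != 0 by rewrite monic_neq0.
have rQ i x : root (Qp i) x = root (p i) x by rewrite rootZ // invr_eq0.
pose yQ i := ofp (Qp i).
have yQ0 i : yQ i != 0 by rewrite ofpoly_eq0.
have yE i : y i = ofc (lead_coef (p i)) * yQ i.
  rewrite pE /yQ /Qp -mul_polyC ofpolyM -/(ofc _) fmorphV mulVKf //.
  by rewrite /ofconst ofpoly_eq0 polyC_eq0.
have cE i : cartan_of q zeta y i = cartan_of q zeta yQ i.
  rewrite /cartan_of yE (qshiftM q0) (qshift_ofconst q0).
  by apply: cancel_constant; rewrite /ofconst ofpoly_eq0 polyC_eq0.
have nfE : normal_form D Lambda (cartan_of q zeta y) =
    normal_form D Lambda (cartan_of q zeta yQ).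
  by apply: eq_bigr => i _; rewrite cE.
have mp' : miura_plucker q zeta V (normal_form D Lambda (cartan_of q zeta yQ)).
  by rewrite -nfE.
have [chi [c [c0 chiE qq]]] := twisted_qq q0 q_infinite zeta0 yQ0 mp'.
have sol i : exists P : {poly C}, qq_equation D q Lambda zeta yQ (fun=> ofp P) i.
  have [m qm] := qq i; have [m' qm'] := qq_equation_scale c0 chiE qm.
  have [s sE] := qq_rhs_poly D Lambda q0 Qp i.
  have e := qm'; rewrite /qq_equation sE in e.
  have gen' x w (k : int) : (Qp i).[x] = 0 -> (Qp i).[w] = 0 -> x = q ^ k * w -> k = 0.
    move=> /rootP rx /rootP rw; apply: (gen i); rewrite pE.
      by apply/is_zero_ofpoly; rewrite -rQ.
    by apply/is_zero_ofpoly; rewrite -rQ.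
  have [P PE] := qq_polynomial q0 q_infinite (xi_tilde_neq0 D zeta0 i)
    (xi_neq0 D zeta0 i) (xi_generic zeta_gen (i := i)) gen' e.
  by exists P; rewrite -PE.
have [P PP] := fin_all_exists sol.
pose Q : qq_data R r := ([ffun i => Qp i], [ffun i => P i]).
have Q1 i : Q.1 i = Qp i by rewrite ffunE.
have Q2 i : Q.2 i = P i by rewrite ffunE.
exists Q; split; last first.
  have eO : oper_of D q Lambda zeta Q = normal_oper D Lambda (cartan_of q zeta y).
    rewrite /oper_of /normal_oper; apply: (congr1 (fun B => QConn B 1%:M 1%:M)).
    apply: eq_bigr => i _; rewrite cE.
    by rewrite /cartan_of Q1.
  by rewrite eO.
have zpl i x : root (Q.1 i) x -> zero_or_pole (y i) x.
  by rewrite Q1 rQ => rx; left; rewrite pE; apply/is_zero_ofpoly.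
split.
- move=> i.
  have e1 : yQ =1 (fun j => ofp (Q.1 j)) by move=> j; rewrite Q1.
  have e2 : ofp (P i) = ofp (Q.2 i) by rewrite Q2.
  exact (@qq_equation_ext yQ _ (fun=> ofp (P i)) (fun j => ofp (Q.2 j)) i e1 e2 (PP i)).
- by move=> i; rewrite Q1.
- exact: zeta_gen.
- move=> i j k ij aik ajk x /zpl zx.
  have r1 : (1 < r)%N.
    by rewrite ltnNge; apply: contra ij => r1; rewrite (ord_subsingleton i j r1).
  have [h1 h2] := Hnd r1 i j k ij aik ajk x zx; split; last exact h2.
  by move=> w /zpl; exact (h1 w).
- move=> r1 i x w; rewrite Q1 rQ => rx Lw; apply: (nd i).2.
    by rewrite pE; apply/is_zero_ofpoly.
  have noj (P' : rel nat) (j : 'I_r) : (forall k, ~~ P' k k) -> P' i j -> false.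
    move=> irr; have -> : j = i by apply: ord_subsingleton; rewrite r1.
    by rewrite (negPf (irr i)).
  rewrite /rho_fun big1 => [|j]; last by move/(noj ltn j (fun k => negbT (ltnn k))).
  rewrite mulr1 big1 => [|j]; last by move/(noj gtn j (fun k => negbT (ltnn k))).
  by rewrite mulr1; apply/is_zero_ofpoly.
Qed.

End Surjectivity.

(** * Injectivity *)

Lemma gauge_relation (F : fieldType) (l g p p' x x' b : F) :
  l != 0 -> g != 0 -> p != 0 -> x != 0 ->
  l * (p' / p * g) * (x^-1 * p * b) = x' * (l * g) -> p' * b = x * x'.
Proof.
move=> l0 g0 p0 x0 e.
have -> : p' * b = l * (p' / p * g) * (x^-1 * p * b) * (x / (l * g)).
  by field; rewrite l0 g0 p0 x0.
by rewrite e; field; rewrite l0 g0.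
Qed.

Lemma invariant_ratio (F : fieldType) (z x x' y y' w w' : F) :
  z != 0 -> y != 0 -> y' != 0 -> w != 0 -> w' != 0 ->
  z * w' / w * x = x' * (z * y' / y) -> x' * y' / w' = x * y / w.
Proof.
move=> z0 y0 y0' w0 w0' e.
have -> : x' * y' / w' = x' * (z * y' / y) * (y / (z * w')).
  by field; rewrite z0 y0 w0'.
by rewrite -e; field; rewrite z0 w0 w0'.
Qed.

Lemma eigen_of_difference (F : fieldType) (s t x x' w w' y y' : F) :
  t != 0 -> y != 0 -> y' != 0 -> s * x * y' - t * x' * y = s * w * y' - t * w' * y ->
  (x' - w') / y' = s / t * ((x - w) / y).
Proof.
move=> t0 y0 y0' e.
have -> : (x' - w') / y' =
    (s * (x - w) * y' - ((s * x * y' - t * x' * y) - (s * w * y' - t * w' * y)))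
     / (t * y * y') by field; rewrite t0 y0 y0'.
by rewrite e subrr subr0; field; rewrite t0 y0 y0'.
Qed.

Section Injectivity.
Variables (R : realType) (n r : nat) (D : simple_group R n r).
Variable V : forall i : 'I_r, fund_rep D i.
Local Notation C := R[i].
Local Notation K := (ratfun R).
Local Notation ofp := (@ofpoly R).
Local Notation ofc := (@ofconst R).
Local Notation a := (sg_a D).
Local Notation actsK := (acts V ofc).
Local Notation cw := (char_weight D).
Variables (q : C) (Lambda : 'I_r -> {poly C}) (zeta : 'I_r -> C).
Hypothesis q0 : q != 0.
Hypothesis q_infinite : forall m : nat, (0 < m)%N -> q ^+ m != 1.
Hypothesis zeta0 : forall i, zeta i != 0.
Hypothesis Lambda_monic : forall i, Lambda i \is monic.
Hypothesis zeta_gen : zeta_generic D q zeta.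
Local Notation qs := (qshift q).

Lemma iso_torus_weights (y y' : 'I_r -> K) :
  (forall j, y j != 0) -> (forall j, y' j != 0) ->
  oper_iso D q (normal_oper D Lambda (cartan_of q zeta y))
    (normal_oper D Lambda (cartan_of q zeta y')) ->
  exists chi : 'I_r -> K, [/\ forall j, chi j != 0,
    forall j, cartan_of q zeta y' j * chi j = qs (chi j) * cartan_of q zeta y j &
    forall j, above a (fun k => qs (chi k)) j * below a chi j = chi j * qs (chi j)].
Proof.
move=> y0 y0' [g [Gg /= eA [b Bb eb] [b' Bb' eb']]].
have g0 j := cartan_of_neq0 q0 zeta0 j y0.
have g0' j := cartan_of_neq0 q0 zeta0 j y0'.
have Bmg : points (sg_Bm D) g.
  have <- : invmx b = g.
    by apply: mulmx1_invmx; apply: mulmx1C; rewrite -{1}[g]mulmx1 -eb.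
  exact (points_inv (Bm_alg D) Bb).
have Bpg : points (sg_Bp D) g.
  have <- : invmx b' = g.
    by apply: mulmx1_invmx; apply: mulmx1C; rewrite -{1}[g]mulmx1 -eb'.
  exact (points_inv (Bp_alg D) Bb').
have [chi chi0 chiP] := actsK_Bp V Bpg; exists chi.
have gP i : actsK i g (chi i) 0 (cw chi i).
  by have [w [gw /(_ Bmg) w0]] := chiP i; rewrite w0 in gw.
have eA' : normal_form D Lambda (cartan_of q zeta y') *m g =
    map_mx qs g *m normal_form D Lambda (cartan_of q zeta y).
  by rewrite eA /gauge (mulmxKV (points_unit (G_alg D) Gg)).
have GA := Bp_points_G (normal_form_Bp (D := D) Lambda g0).
have GA' := Bp_points_G (normal_form_Bp (D := D) Lambda g0').
have qs0 : qs 0 = 0 :> K by exact: (rmorph0 (qshift_morph q0)).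
have rel i : cartan_of q zeta y' i * chi i = qs (chi i) * cartan_of q zeta y i /\
    ofp (Lambda i) * above a (cartan_of q zeta y') i * cw chi i =
    qs (chi i) * (ofp (Lambda i) * above a (cartan_of q zeta y) i).
  have e1 := actsK_mul GA' Gg (actsK_normal_form V Lambda i g0') (gP i).
  have e2 := actsK_mul (points_qshift q0 Gg) GA (actsK_shift q0 (gP i))
    (actsK_normal_form V Lambda i g0).
  rewrite eA' in e1; have [ex ew _] := actsK_uniq e1 e2; split; first exact ex.
  by move: ew; rewrite qs0 mulr0 mul0r add0r addr0.
have qchi0 j : qs (chi j) != 0 by rewrite (qshift_eq0 q0).
split=> // [j|j]; first by have [] := rel j.
have [_ e] := rel j; rewrite (char_weight_split D (chi0 j)) in e.
have eG : above a (cartan_of q zeta y') j =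
    above a (fun k => qs (chi k)) j / above a chi j * above a (cartan_of q zeta y) j.
  rewrite -aboveV -!aboveM; apply: eq_above => k.
  by rewrite mulrAC -(rel k).1 (mulfK (chi0 k)).
rewrite eG in e.
exact (gauge_relation (Lambda_neq0 Lambda_monic j) (above_neq0 a j g0)
  (above_neq0 a j chi0) (chi0 j) e).
Qed.

Lemma order_descent (m : 'I_r -> C -> int) x :
  (forall i, m i x + m i (q * x) =
    \sum_(j < r | (i < j)%N) m j (q * x) * - a j i +
    \sum_(j < r | (j < i)%N) m j x * - a j i) ->
  (forall j, m j (q * x) = 0) -> forall i, m i x = 0.
Proof.
move=> h mq i; have [k] := ubnP (nat_of_ord i); elim: k i => // k IH i.
rewrite ltnS => ik; have := h i; rewrite mq addr0 => ->.
rewrite big1 => [|j _]; last by rewrite mq mul0r.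
rewrite big1 ?addr0 // => j ji; rewrite IH ?mul0r //.
exact: leq_trans ji ik.
Qed.

(* At a zero of [Q i] the neighbours of [i] do not vanish, so that the two sides of
   the Cartan relation would have opposite signs. *)
Lemma order_at0 (Q Q' : 'I_r -> {poly C}) :
  (forall i j, i != j -> a j i != 0 -> root (Q i) 0 -> ~~ root (Q j) 0) ->
  (forall i j, i != j -> a j i != 0 -> root (Q' i) 0 -> ~~ root (Q' j) 0) ->
  (forall i, ((mup 0 (Q' i))%:Z - (mup 0 (Q i))%:Z) *+ 2 =
     \sum_(j < r | j != i) ((mup 0 (Q' j))%:Z - (mup 0 (Q j))%:Z) * - a j i) ->
  forall i, mup 0 (Q' i) = mup 0 (Q i).
Proof.
move=> sep sep' h.
have mroot (p : {poly C}) : (0 < mup 0 p)%N -> root p 0.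
  by apply: contraTT => /mupNroot ->.
suff ge (P P' : 'I_r -> {poly C}) :
    (forall i j, i != j -> a j i != 0 -> root (P i) 0 -> ~~ root (P j) 0) ->
    (forall i, ((mup 0 (P' i))%:Z - (mup 0 (P i))%:Z) *+ 2 =
     \sum_(j < r | j != i) ((mup 0 (P' j))%:Z - (mup 0 (P j))%:Z) * - a j i) ->
    forall i, (mup 0 (P i) <= mup 0 (P' i))%N.
  move=> i; apply/eqP; rewrite eqn_leq (ge Q Q' sep h) andbT.
  apply: (ge Q' Q sep') => k.
  rewrite -opprB mulNrn h -sumrN; apply: eq_bigr => j _.
  by rewrite -mulNr opprB.
move=> {}sep {}h i; rewrite leqNgt; apply/negP => lt.
have ri := mroot _ (leq_ltn_trans (leq0n _) lt).
have : ((mup 0 (P' i))%:Z - (mup 0 (P i))%:Z) *+ 2 < 0.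
  by rewrite pmulrn_llt0 // subr_lt0 ltz_nat.
rewrite h ltNge sumr_ge0 // => j ji; have [->|aji] := eqVneq (a j i) 0.
  by rewrite oppr0 mulr0.
rewrite eq_sym in ji; have := sep i j ji aji ri => /mupNroot ->.
rewrite subr0 mulr_ge0 // oppr_ge0; apply: cartan_nonpos; by rewrite eq_sym.
Qed.

Lemma qq_minus_unique (y m m' : 'I_r -> K) i : y i != 0 ->
  qq_equation D q Lambda zeta y m i -> qq_equation D q Lambda zeta y m' i ->
  m i = m' i.
Proof.
move=> yi0; rewrite /qq_equation => e1 e2; apply/eqP; rewrite -subr_eq0.
apply/negPn/negP => d0; apply: (xi_generic zeta_gen (i := i)).
have f0 : (m i - m' i) / y i != 0 by exact (mulf_neq0 d0 (invr_neq0 yi0)).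
apply: (qshift_eigen q0 f0).
have x0 : ofc (xi D zeta i) != 0 by rewrite /ofconst ofpoly_eq0 polyC_eq0 xi_neq0.
have y1 : qs (y i) != 0 by rewrite (qshift_eq0 q0).
have -> : qs ((m i - m' i) / y i) = (qs (m i) - qs (m' i)) / qs (y i).
  by rewrite (qshiftM q0) (qshiftV q0) (qshiftB q0).
have -> : ofc (xi_tilde D zeta i / xi D zeta i) = ofc (xi_tilde D zeta i) / ofc (xi D zeta i).
  by rewrite rmorphM fmorphV.
exact (eigen_of_difference x0 yi0 y1 (etrans e1 (esym e2))).
Qed.

Lemma solution_injective Q Q' :
  nondegenerate_solution D q Lambda zeta Q ->
  nondegenerate_solution D q Lambda zeta Q' ->
  oper_iso D q (oper_of D q Lambda zeta Q) (oper_of D q Lambda zeta Q') -> Q = Q'.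
Proof.
move=> [qq mon _ dist _] [qq' mon' _ dist' _] iso.
have Q0 j : Q.1 j != 0 by rewrite monic_neq0.
have Q0' j : Q'.1 j != 0 by rewrite monic_neq0.
pose y j := ofp (Q.1 j); pose y' j := ofp (Q'.1 j).
have y0 j : y j != 0 by rewrite ofpoly_eq0.
have y0' j : y' j != 0 by rewrite ofpoly_eq0.
have [chi [chi0 rel1 rel2]] := iso_torus_weights y0 y0' iso.
have mE j x : ord_at x (chi j) = (mup x (Q'.1 j))%:Z - (mup x (Q.1 j))%:Z.
  have inv : qs (chi j * y j / y' j) = chi j * y j / y' j.
    rewrite !(qshiftM q0) (qshiftV q0).
    have ys : qs (y j) != 0 by rewrite (qshift_eq0 q0); exact (y0 j).
    have ys' : qs (y' j) != 0 by rewrite (qshift_eq0 q0); exact (y0' j).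
    exact (invariant_ratio (zetaK_neq0 zeta0 j) (y0 j) ys (y0' j) ys' (rel1 j)).
  have [c ec] := qshift_invariant q0 q_infinite inv.
  have e : chi j = ofc c * (y' j / y j).
    by rewrite -ec mulrA (divfK (y0' j)) (mulfK (y0 j)).
  have c0 : c != 0.
    by apply: contraNneq (chi0 j) => c0; rewrite e c0 rmorph0 mul0r.
  have cK0 : ofc c != 0 by rewrite /ofconst ofpoly_eq0 polyC_eq0.
  rewrite e (ord_at_mul x cK0 (mulf_neq0 (y0' j) (invr_neq0 (y0 j)))).
  by rewrite (ord_at_ofconst x c0) (ord_at_frac x (Q0' j) (Q0 j)) add0r.
pose m j x := ord_at x (chi j).
have qchi0 j : qs (chi j) != 0 by rewrite (qshift_eq0 q0).
have mrel i x : m i x + m i (q * x) =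
    \sum_(j < r | (i < j)%N) m j (q * x) * - a j i +
    \sum_(j < r | (j < i)%N) m j x * - a j i.
  have := congr1 (ord_at x) (rel2 i).
  rewrite (ord_at_mul x (above_neq0 a i qchi0) (below_neq0 a i chi0)).
  rewrite (ord_at_mul x (chi0 i) (qchi0 i)) (ord_at_qshift x q0 (chi0 i)) => <-.
  rewrite /above /below !ord_at_prod => [|j _|j _].
  - congr (_ + _); apply: eq_bigr => j _; last by rewrite (ord_at_expz x _ (chi0 j)).
    by rewrite (ord_at_expz x _ (qchi0 j)) (ord_at_qshift x q0 (chi0 j)).
  - exact (expfz_neq0 _ (chi0 j)).
  - exact (expfz_neq0 _ (qchi0 j)).
have sep (P : qq_data R r) : (forall i j k, i != j -> a i k != 0 -> a j k != 0 ->
      forall x, root (P.1 i) x ->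
        (forall w, root (P.1 j) w -> q_distinct q x w) /\
        (forall w, root (Lambda k) w -> q_distinct q x w)) ->
    forall i j, i != j -> a j i != 0 -> root (P.1 i) 0 -> ~~ root (P.1 j) 0.
  move=> dP i j ij aji ri; apply/negP => rj.
  have aii : a i i != 0 by rewrite cartan_diag.
  have [h _] := dP i j i ij aii aji 0 ri.
  exact: not_q_distinct_diag (h 0 rj).
have mup_eq i x : mup x (Q'.1 i) = mup x (Q.1 i).
  have [->|x0] := eqVneq x 0.
    apply: order_at0 (sep _ dist) (sep _ dist') _ i => j.
    rewrite -mE mulr2n; have := mrel j 0; rewrite mulr0 => ->.
    rewrite [RHS](bigID (fun k : 'I_r => (j < k)%N)) /=; congr (_ + _).
      apply: eq_big => [k|k _]; last by rewrite -mE.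
      by rewrite -val_eqE neq_ltn; case: ltngtP.
    apply: eq_big => [k|k _]; last by rewrite -mE.
    by rewrite -val_eqE neq_ltn; case: ltngtP.
  pose P := \prod_j (Q.1 j * Q'.1 j).
  have P0 : P != 0 by apply/prodf_neq0 => j _; rewrite mulf_neq0.
  have [k Pk] := orbit_nonroot q0 q_infinite x0 P0.
  have mk j : m j (q ^+ k * x) = 0.
    rewrite /m mE; have [n1 n2] : ~~ root (Q.1 j) (q ^+ k * x) /\ ~~ root (Q'.1 j) (q ^+ k * x).
      apply/andP; rewrite -negb_or -rootM; apply: contraNN Pk => rj.
      by rewrite /P (bigD1 j) //= hornerM (rootP rj) mul0r.
    by rewrite !mupNroot.
  have m0 : forall l, (l <= k)%N -> forall j, m j (q ^+ (k - l) * x) = 0.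
    elim=> [|l IH] lk j; first by rewrite subn0 mk.
    apply: order_descent => {j} [j|j]; first exact: mrel.
    by rewrite mulrA -exprS subnSK // IH // ltnW.
  have := m0 k (leqnn k) i; rewrite subnn mul1r /m mE.
  by move/eqP; rewrite subr_eq0 => /eqP[].
have e1 : Q.1 = Q'.1.
  by apply/ffunP => j; apply: monic_eq_mup => // x; rewrite mup_eq.
have e2 : Q.2 = Q'.2.
  apply/ffunP => j; apply: (@ofpoly_inj R).
  have qq1 : qq_equation D q Lambda zeta y (fun j => ofp (Q.2 j)) j by exact (qq j).
  have qq2 : qq_equation D q Lambda zeta y (fun j => ofp (Q'.2 j)) j.
    by rewrite /y e1; exact (qq' j).
  exact (qq_minus_unique (y0 j) qq1 qq2).
by rewrite (surjective_pairing Q) (surjective_pairing Q') e1 e2.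
Qed.

End Injectivity.

Theorem theorem6p1 (R : realType) (n r : nat) (D : simple_group R n r)
    (V : forall i : 'I_r, fund_rep D i)
    (q : R[i]) (zeta : 'I_r -> R[i]) (Lambda : 'I_r -> {poly R[i]}) :
  q != 0 -> (forall m : nat, (0 < m)%N -> q ^+ m != 1) ->
  (forall i, zeta i != 0) -> zeta_generic D q zeta ->
  (forall i, Lambda i \is monic) ->
  [/\ forall Q, nondegenerate_solution D q Lambda zeta Q ->
        nondegenerate_ZMP_oper q Lambda zeta V (oper_of D q Lambda zeta Q),
      forall Q Q', nondegenerate_solution D q Lambda zeta Q ->
        nondegenerate_solution D q Lambda zeta Q' ->
        oper_iso D q (oper_of D q Lambda zeta Q) (oper_of D q Lambda zeta Q') ->
        Q = Q'
    & forall O y, nondegenerate_ZMP q Lambda zeta V O y -> q_generic q y ->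
        exists Q, nondegenerate_solution D q Lambda zeta Q /\
          oper_iso D q O (oper_of D q Lambda zeta Q)].
Proof.
move=> q0 q_inf zeta0 zgen Lmon; split.
- exact: solution_oper.
- exact: solution_injective.
- exact: oper_solution.
Qed.
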